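(* Let $\epsilon\in\mathbb R$, let $\tau=\rho^{(u)}$ be a two-dimensional irreducible representation of the dihedral group $G=I_2(m)$ with representation space $V(\tau)$, and for $k\in\mathbb Z_{>0}$ denote by $$\Lambda_k=\Big\{\pm\sqrt{k^2-(1-\epsilon^2)\sigma_{k+u}^2},\ \pm\sqrt{k^2-(1-\epsilon^2)\sigma_{k-u}^2}\Big\}$$ the set of eigenvalues of $Z_0+\epsilon\sigma$ on the degree-$k$ part of $\ker E_-$, and for $\lambda_k\in\Lambda_k$ let $\mathcal H_c(\tau)_{\lambda_k}$ be the $\lambda_k$-eigenspace of $Z_0+\epsilon\sigma$ in the degree-$k$ part of $\ker E_-$. Let $c$ be real-valued and close enough to $c=0$ such that $M_c(\tau)$ is irreducible and unitarisable. Then the joint $(\mathcal V,\mathfrak u(1,1))$-decomposition of $M_c(\tau)$ is $$M_c(\tau)=V(\tau)\otimes L_{\mathfrak u(1,1)}(1,0)\ \oplus\bigoplus_{k\in\mathbb Z_{>0}}\bigoplus_{\lambda_k\in\Lambda_k}\mathcal H_c(\tau)_{\lambda_k}\otimes L_{\mathfrak u(1,1)}(k+1,\lambda_k).$$ The space $\mathcal H_c(\tau)_{\lambda_k}$ is a one-dimensional irreducible module for $\mathcal V$ if the set $\Lambda_k$ has four distinct eigenvalues. If $\Lambda_k$ contains only two distinct eigenvalues, $\mathcal H_c(\tau)_{\lambda_k}$ is two-dimensional and hence consists of two irreducible modules for $\mathcal V$.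
   Context: Let $E=\mathbb R^2$ with standard Euclidean structure, orthonormal basis $\xi,\eta$ and dual basis $x,y$ of $E^*$; $z=x+iy$, $\bar z=x-iy$, $\zeta=\frac12(\xi-i\eta)$, $\bar\zeta=\frac12(\xi+i\eta)$. $G=I_2(m)$ is the dihedral group of order $2m$ generated by the reflections $s_1,\dots,s_m$, where $s_j$ is the reflection in the root $\alpha_j=\sin(\pi j/m)\xi-\cos(\pi j/m)\eta$; put $a_j=\sin(\pi j/m)x-\cos(\pi j/m)y$. $c$ is a conjugation-invariant function on the reflections. $H_c(G,E)$ is the quotient of $T(E_{\mathbb C}\oplus E_{\mathbb C}^* )\rtimes G$ (where $gX=(g\cdot X)g$) by the relations that elements of $E$ commute, elements of $E^*$ commute, and $[\xi',x']=\langle x',\xi'\rangle-2\sum_{j=1}^mc(s_j)\langle x',\alpha_j\rangle\langle a_j,\xi'\rangle s_j$ for $\xi'\in E$, $x'\in E^*$. With $\omega=\exp(2\pi i/m)$, put $\sigma_k=\sum_{j=1}^mc(s_j)\omega^{kj}$ and $\sigma=\sum_{j=1}^mc(s_j)s_j$. Put $E_+=\frac12z\bar z$, $E_-=-2\zeta\bar\zeta$, $H=z\zeta+\bar z\bar\zeta+1-\sigma$, $Z_0=\bar z\bar\zeta-z\zeta$. Here $\mathfrak u(1,1)\subset H_c(G,E)$ is the Lie algebra spanned by $E_\pm,H$ and the central element $Z_0+\epsilon\sigma$, and $\mathcal V$ is its centraliser in $H_c(G,E)$. $L_{\mathfrak u(1,1)}(\mu,\nu)$ is the irreducible lowest weight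 $\mathfrak u(1,1)$-representation with lowest weight vector (annihilated by $E_-$) on which $H$ acts by $\mu$ and $Z_0+\epsilon\sigma$ by $\nu$. Writing $m=2q$ ($m$ even) or $m=2q-1$ ($m$ odd), the two-dimensional irreducible representations of $G$ are $\rho^{(u)}$, $u=1,\dots,q-1$, on the space with basis $z,\bar z$, given by $\rho^{(u)}(s_j)z=\omega^{ju}\bar z$, $\rho^{(u)}(s_j)\bar z=\omega^{-ju}z$. $M_c(\tau)\cong\mathbb C[E]\otimes V(\tau)$ is the standard module of $H_c(G,E)$, induced from $V(\tau)$ with $E$ acting by zero on $V(\tau)$, graded by polynomial degree; $\sigma$ acts by $0$ on $V(\tau)$. For real $c$, $\ast$ is the conjugate-linear anti-involution of $H_c(G,E)$ with $\xi^*=x$, $x^*=\xi$, $\eta^*=y$, $y^*=\eta$, $s_j^*=s_j$; $M_c(\tau)$ is unitarisable if its Hermitian form $\beta$ with $\beta(hp,q)=\beta(p,h^*q)$, restricting to a $G$-invariant inner product on $V(\tau)$, is positive definite. *)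

(* Defs.v *)
From HB Require Import structures.
From mathcomp Require Import all_boot all_order all_algebra.
From mathcomp Require Import complex.
From mathcomp Require Import boolp classical_sets reals trigo.

Set Implicit Arguments.
Unset Strict Implicit.
Unset Printing Implicit Defensive.

Import Order.TTheory GRing.Theory Num.Theory.
Local Open Scope complex_scope.
Local Open Scope classical_set_scope.
Local Open Scope ring_scope.
Local Open Scope quotient_scope.

Section LinearAlgebra.
Variable K : fieldType.

Definition subspace (V : lmodType K) (W : set V) : Prop :=
  W 0 /\ forall (a : K) v w, W v -> W w -> W (a *: v + w).

Definition span (V : lmodType K) (A : set V) : set V :=
  [set x | exists (n : nat) (a : 'I_n -> K) (v : 'I_n -> V),
     (forall i, A (v i)) /\ x = \sum_(i < n) a i *: v i].

Definition has_dim (V : lmodType K) (W : set V) (n : nat) : Prop :=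
  exists e : 'I_n -> V,
    (forall a : 'I_n -> K, \sum_(i < n) a i *: e i = 0 -> forall i, a i = 0)
    /\ W = span (range e).

Definition linear_on (V U : lmodType K) (W : set V) (g : V -> U) : Prop :=
  forall (a : K) v w, W v -> W w -> g (a *: v + w) = a *: g v + g w.

Definition bilinear_on (V L U : lmodType K) (W : set V) (b : V -> L -> U) :
    Prop :=
  (forall l, linear_on W (b^~ l)) /\
  (forall w, W w -> linear_on setT (b w)).

(* The bilinear map b : W x L -> S exhibits S as W (x) L: it spans S and has
   the universal property. *)
Definition is_tensor_product (V L U : lmodType K)
    (W : set V) (b : V -> L -> U) (S : set U) : Prop :=
  [/\ bilinear_on W b,
      S = span [set s | exists w l, W w /\ s = b w l] &
      forall (T : lmodType K) (f : V -> L -> T), bilinear_on W f ->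
        exists g : U -> T, linear_on S g /\
          forall w l, W w -> g (b w l) = f w l].

(* internal direct sum *)
Definition is_direct_sum (I : eqType) (V : lmodType K)
    (J : pred I) (S : I -> set V) (W : set V) : Prop :=
  [/\ forall i, J i -> subspace (S i),
      W = span (\bigcup_(i in [set i | J i]) S i) &
      forall (s : seq I) (f : I -> V), uniq s ->
        (forall i, i \in s -> J i /\ S i (f i)) ->
        \sum_(i <- s) f i = 0 -> forall i, i \in s -> f i = 0].

End LinearAlgebra.

Section Dihedral.
Variables (R : realType) (m : nat).

Definition vec2 (T : Type) (a b : T) : 'cV[T]_2 :=
  \col_(i < 2) (if i == 0 then a else b).
Definition covec2 (T : Type) (a b : T) : 'rV[T]_2 :=
  \row_(i < 2) (if i == 0 then a else b).

(* Elements of E (resp. E^* ) are columns (resp. rows) of coordinates in the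
   basis xi, eta (resp. x, y); the pairing is the product row *m column. *)
Definition theta (j : nat) : R := pi * j%:R / m%:R.
Definition alpha (j : nat) : 'cV[R]_2 :=
  vec2 (sin (theta j)) (- cos (theta j)).
Definition coalpha (j : nat) : 'rV[R]_2 :=
  covec2 (sin (theta j)) (- cos (theta j)).

(* alpha j is a unit vector *)
Definition refl (j : nat) : 'M[R]_2 := 1%:M - 2 *: (alpha j *m coalpha j).

Inductive dihedral : 'M[R]_2 -> Prop :=
| dihedral1 : dihedral 1%:M
| dihedralM j g : (0 < j <= m)%N -> dihedral g -> dihedral (refl j *m g).

Definition conj_invariant (c : 'M[R]_2 -> R[i]) : Prop :=
  forall g j, dihedral g -> (0 < j <= m)%N ->
    c (g *m refl j *m invmx g) = c (refl j).

(* omega = exp(2 pi i / m), by Euler's formula *)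
Definition omega : R[i] := cos (2 * pi / m%:R) +i* sin (2 * pi / m%:R).

Definition cplx_mx (p q : nat) (A : 'M[R]_(p, q)) : 'M[R[i]]_(p, q) :=
  map_mx (fun a : R => a%:C) A.

Definition pairing (f : 'rV[R[i]]_2) (v : 'cV[R[i]]_2) : R[i] := (f *m v) 0 0.

End Dihedral.

Section CherednikAlgebra.
Variables (R : realType) (m : nat) (c : 'M[R]_2 -> R[i]).

Inductive term : Type :=
| Scal of R[i]
| Vec of 'cV[R[i]]_2
| Cov of 'rV[R[i]]_2
| Grp (g : 'M[R]_2) of dihedral m g
| Add of term & term
| Mul of term & term.

HB.instance Definition _ := gen_eqMixin term.
HB.instance Definition _ := gen_choiceMixin term.

Lemma dihedral_refl j : (0 < j <= m)%N -> dihedral m (refl R m j).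
Proof. by move=> hj; rewrite -[refl _ _ _]mulmx1; apply: dihedralM => //; left. Qed.

(* The value outside 1 <= j <= m is never used. *)
Definition refl_term (j : nat) : term :=
  if pselect (0 < j <= m)%N is left hj then Grp (dihedral_refl hj) else Scal 0.

(* The congruence generated by the axioms of complex associative unital
   algebras, linearity in E_C and E_C^*, multiplicativity in G, and the
   defining relations of H_c(G,E).  The action of G on E^* is contragredient. *)
Inductive eqv : term -> term -> Prop :=
| eqv_refl a : eqv a a
| eqv_sym a b : eqv a b -> eqv b a
| eqv_trans a b d : eqv a b -> eqv b d -> eqv a d
| eqv_Add a a' b b' : eqv a a' -> eqv b b' -> eqv (Add a b) (Add a' b')
| eqv_Mul a a' b b' : eqv a a' -> eqv b b' -> eqv (Mul a b) (Mul a' b')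
| eqv_addA a b d : eqv (Add a (Add b d)) (Add (Add a b) d)
| eqv_addC a b : eqv (Add a b) (Add b a)
| eqv_add0 a : eqv (Add (Scal 0) a) a
| eqv_addN a : eqv (Add (Mul (Scal (-1)) a) a) (Scal 0)
| eqv_mulA a b d : eqv (Mul a (Mul b d)) (Mul (Mul a b) d)
| eqv_1mul a : eqv (Mul (Scal 1) a) a
| eqv_mulDl a b d : eqv (Mul (Add a b) d) (Add (Mul a d) (Mul b d))
| eqv_mulDr a b d : eqv (Mul a (Add b d)) (Add (Mul a b) (Mul a d))
| eqv_ScalD k l : eqv (Scal (k + l)) (Add (Scal k) (Scal l))
| eqv_ScalM k l : eqv (Scal (k * l)) (Mul (Scal k) (Scal l))
| eqv_ScalC k a : eqv (Mul (Scal k) a) (Mul a (Scal k))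
| eqv_Vec k v w : eqv (Vec (k *: v + w)) (Add (Mul (Scal k) (Vec v)) (Vec w))
| eqv_Cov k f h : eqv (Cov (k *: f + h)) (Add (Mul (Scal k) (Cov f)) (Cov h))
| eqv_Grp1 (h1 : dihedral m 1%:M) : eqv (Grp h1) (Scal 1)
| eqv_GrpM g h (hg : dihedral m g) (hh : dihedral m h)
    (hgh : dihedral m (g *m h)) : eqv (Mul (Grp hg) (Grp hh)) (Grp hgh)
| eqv_GrpVec g (hg : dihedral m g) v :
    eqv (Mul (Grp hg) (Vec v)) (Mul (Vec (cplx_mx g *m v)) (Grp hg))
| eqv_GrpCov g (hg : dihedral m g) f :
    eqv (Mul (Grp hg) (Cov f)) (Mul (Cov (f *m invmx (cplx_mx g))) (Grp hg))
| eqv_VecC v w : eqv (Mul (Vec v) (Vec w)) (Mul (Vec w) (Vec v))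
| eqv_CovC f h : eqv (Mul (Cov f) (Cov h)) (Mul (Cov h) (Cov f))
| eqv_VecCov v f :
    eqv (Add (Mul (Vec v) (Cov f)) (Mul (Scal (-1)) (Mul (Cov f) (Vec v))))
        (Add (Scal (pairing f v))
             (Mul (Scal (- 2))
                  (\big[Add/Scal 0]_(1 <= j < m.+1)
                     Mul (Scal (c (refl R m j)
                                * pairing f (cplx_mx (alpha R m j))
                                * pairing (cplx_mx (coalpha R m j)) v))
                         (refl_term j)))).

Definition eqvb (a b : term) : bool := `[< eqv a b >].

Lemma eqvb_equiv : equiv_class_of eqvb.
Proof.
split=> [a|a b|b a d].
- by apply/asboolP; apply: eqv_refl.
- by apply: asbool_equiv_eq; split; apply: eqv_sym.
- by move=> /asboolP hab /asboolP hbd; apply/asboolP; apply: eqv_trans hab hbd.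
Qed.

Canonical eqv_equiv := EquivRelPack eqvb_equiv.
Canonical eqv_equiv_direct := defaultEncModRel eqvb.

Definition cherednik : Type := {eq_quot eqvb}.
HB.instance Definition _ := Choice.on cherednik.
HB.instance Definition _ : EqQuotient term eqvb cherednik :=
  EqQuotient.on cherednik.

Definition cls (t : term) : cherednik := \pi_cherednik t.

Lemma cls_eqv a b : eqv a b -> cls a = cls b.
Proof. by move=> h; apply/eqmodP/asboolP. Qed.

Lemma eqv_repr a : eqv (repr (cls a)) a.
Proof. by apply/asboolP; have /eqmodP := reprK (cls a). Qed.

Definition ch_add (a b : cherednik) := cls (Add (repr a) (repr b)).
Definition ch_mul (a b : cherednik) := cls (Mul (repr a) (repr b)).
Definition ch_opp (a : cherednik) := cls (Mul (Scal (-1)) (repr a)).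
Definition ch_scale (k : R[i]) (a : cherednik) := cls (Mul (Scal k) (repr a)).

Lemma clsD a b : ch_add (cls a) (cls b) = cls (Add a b).
Proof. by apply/cls_eqv/eqv_Add; apply: eqv_repr. Qed.
Lemma clsM a b : ch_mul (cls a) (cls b) = cls (Mul a b).
Proof. by apply/cls_eqv/eqv_Mul; apply: eqv_repr. Qed.
Lemma clsN a : ch_opp (cls a) = cls (Mul (Scal (-1)) a).
Proof. by apply/cls_eqv/eqv_Mul; [apply: eqv_refl | apply: eqv_repr]. Qed.
Lemma clsZ k a : ch_scale k (cls a) = cls (Mul (Scal k) a).
Proof. by apply/cls_eqv/eqv_Mul; [apply: eqv_refl | apply: eqv_repr]. Qed.

Lemma clsP (P : cherednik -> Prop) : (forall t, P (cls t)) -> forall h, P h.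
Proof. by move=> hP h; rewrite -[h]reprK; apply: hP. Qed.

Lemma ch_addA : associative ch_add.
Proof.
elim/clsP=> a; elim/clsP=> b; elim/clsP=> d.
by rewrite !clsD; apply/cls_eqv/eqv_addA.
Qed.
Lemma ch_addC : commutative ch_add.
Proof.
by elim/clsP=> a; elim/clsP=> b; rewrite !clsD; apply/cls_eqv/eqv_addC.
Qed.
Lemma ch_add0 : left_id (cls (Scal 0)) ch_add.
Proof. by elim/clsP=> a; rewrite clsD; apply/cls_eqv/eqv_add0. Qed.
Lemma ch_addN : left_inverse (cls (Scal 0)) ch_opp ch_add.
Proof. by elim/clsP=> a; rewrite clsN clsD; apply/cls_eqv/eqv_addN. Qed.

HB.instance Definition _ :=
  GRing.isZmodule.Build cherednik ch_addA ch_addC ch_add0 ch_addN.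

Lemma ch_mulA : associative ch_mul.
Proof.
elim/clsP=> a; elim/clsP=> b; elim/clsP=> d.
by rewrite !clsM; apply/cls_eqv/eqv_mulA.
Qed.
Lemma ch_1mul : left_id (cls (Scal 1)) ch_mul.
Proof. by elim/clsP=> a; rewrite clsM; apply/cls_eqv/eqv_1mul. Qed.
Lemma ch_mul1 : right_id (cls (Scal 1)) ch_mul.
Proof.
elim/clsP=> a; rewrite clsM; apply/cls_eqv.
exact: eqv_trans (eqv_sym (eqv_ScalC 1 a)) (eqv_1mul a).
Qed.
Lemma ch_mulDl : left_distributive ch_mul +%R.
Proof.
elim/clsP=> a; elim/clsP=> b; elim/clsP=> d.
rewrite [_ + _]clsD [LHS]clsM [RHS]/GRing.add/= !clsM clsD.
exact/cls_eqv/eqv_mulDl.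
Qed.
Lemma ch_mulDr : right_distributive ch_mul +%R.
Proof.
elim/clsP=> a; elim/clsP=> b; elim/clsP=> d.
rewrite [_ + _]clsD [LHS]clsM [RHS]/GRing.add/= !clsM clsD.
exact/cls_eqv/eqv_mulDr.
Qed.

(* Nontriviality (1 != 0) is not part of the construction, hence a pzRing. *)
HB.instance Definition _ := GRing.Zmodule_isPzRing.Build cherednik
  ch_mulA ch_1mul ch_mul1 ch_mulDl ch_mulDr.

Lemma ch_scaleE k (h : cherednik) : ch_scale k h = cls (Scal k) * h.
Proof. by elim/clsP: h => a; rewrite clsZ -clsM. Qed.
Lemma cls_ScalD k l : cls (Scal (k + l)) = cls (Scal k) + cls (Scal l).
Proof. by rewrite [RHS]clsD; apply/cls_eqv/eqv_ScalD. Qed.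
Lemma cls_ScalM k l : cls (Scal (k * l)) = cls (Scal k) * cls (Scal l).
Proof. by rewrite [RHS]clsM; apply/cls_eqv/eqv_ScalM. Qed.

Lemma ch_scaleA k l h : ch_scale k (ch_scale l h) = ch_scale (k * l) h.
Proof. by rewrite !ch_scaleE cls_ScalM mulrA. Qed.
Lemma ch_scale1 : left_id 1 ch_scale.
Proof. by move=> h; rewrite ch_scaleE [LHS]mul1r. Qed.
Lemma ch_scaleDr : right_distributive ch_scale +%R.
Proof. by move=> k h l; rewrite !ch_scaleE mulrDr. Qed.
Lemma ch_scaleDl h : {morph ch_scale^~ h : k l / k + l}.
Proof. by move=> k l; rewrite !ch_scaleE cls_ScalD mulrDl. Qed.

HB.instance Definition _ := GRing.Zmodule_isLmodule.Build R[i] cherednik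
  ch_scaleA ch_scale1 ch_scaleDr ch_scaleDl.

Definition of_scal (k : R[i]) : cherednik := cls (Scal k).
Definition of_vec (v : 'cV[R[i]]_2) : cherednik := cls (Vec v).
Definition of_cov (f : 'rV[R[i]]_2) : cherednik := cls (Cov f).
Definition of_grp (g : 'M[R]_2) (hg : dihedral m g) : cherednik := cls (Grp hg).
Definition srefl (j : nat) : cherednik := cls (refl_term j).

Definition xi_ : cherednik := of_vec (vec2 1 0).
Definition eta_ : cherednik := of_vec (vec2 0 1).
Definition x_ : cherednik := of_cov (covec2 1 0).
Definition y_ : cherednik := of_cov (covec2 0 1).

Definition z_ : cherednik := x_ + 'i *: y_.
Definition zbar_ : cherednik := x_ - 'i *: y_.
Definition zeta_ : cherednik := 2^-1 *: (xi_ - 'i *: eta_).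
Definition zetabar_ : cherednik := 2^-1 *: (xi_ + 'i *: eta_).

Definition sigma_k (k : int) : R[i] :=
  \sum_(1 <= j < m.+1) c (refl R m j) * omega R m ^ (k * j%:Z).
Definition sigma_ : cherednik :=
  \sum_(1 <= j < m.+1) c (refl R m j) *: srefl j.

Definition Eplus : cherednik := 2^-1 *: (z_ * zbar_).
Definition Eminus : cherednik := (- 2) *: (zeta_ * zetabar_).
Definition Hgrad : cherednik := z_ * zeta_ + zbar_ * zetabar_ + 1 - sigma_.
Definition Z0 : cherednik := zbar_ * zetabar_ - z_ * zeta_.
Definition Zeps (eps : R) : cherednik := Z0 + eps%:C *: sigma_.

Definition u11 (eps : R) : set cherednik :=
  span [set h | [\/ h = Eplus, h = Eminus, h = Hgrad | h = Zeps eps]].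

Definition centraliser (A : set cherednik) : set cherednik :=
  [set h | forall X, A X -> h * X = X * h].

Definition conj_anti_involution (st : cherednik -> cherednik) : Prop :=
  [/\ forall (k : R[i]) g h, st (k *: g + h) = k^* *: st g + st h,
      forall g h, st (g * h) = st h * st g &
      forall h, st (st h) = h].

Definition is_star (st : cherednik -> cherednik) : Prop :=
  conj_anti_involution st /\
  [/\ st xi_ = x_, st x_ = xi_, st eta_ = y_, st y_ = eta_ &
      forall j, (0 < j <= m)%N -> st (srefl j) = srefl j].


(* u11 is closed under commutators; act only matters on it. *)
Definition is_u11_rep (eps : R) (L : lmodType R[i])
    (act : cherednik -> L -> L) : Prop :=
  [/\ forall l, linear_on (u11 eps) (act^~ l),
      forall X, u11 eps X -> linear_on setT (act X) &
      forall X Y l, u11 eps X -> u11 eps Y ->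
        act (X * Y - Y * X) l = act X (act Y l) - act Y (act X l)].

(* the modules L_{u(1,1)}(mu, nu), unique up to isomorphism *)
Definition is_lowest_weight_irrep (eps : R) (mu nu : R[i])
    (L : lmodType R[i]) (act : cherednik -> L -> L) : Prop :=
  [/\ is_u11_rep eps act,
      forall W : set L, subspace W ->
        (forall X l, u11 eps X -> W l -> W (act X l)) ->
        W = [set 0] \/ W = setT &
      exists v : L, [/\ v != 0, act Eminus v = 0, act Hgrad v = mu *: v
                      & act (Zeps eps) v = nu *: v]].

Variable u : nat.

(* The standard module is the quotient of the free left H_c-module on the basis
   z, zbar of V(rho^(u)) by the submodule std_rel, i.e. the tensor product of
   H_c with V(rho^(u)) over the subalgebra generated by E and G. *)
Definition gen_z : 'rV[cherednik]_2 := delta_mx 0 0.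
Definition gen_zbar : 'rV[cherednik]_2 := delta_mx 0 1.

(* g (x) v = 1 (x) rho^(u)(g) v for all g in G follows from the case of the
   generators s_j of G. *)
Inductive std_rel : 'rV[cherednik]_2 -> Prop :=
| std_rel0 : std_rel 0
| std_relD p q : std_rel p -> std_rel q -> std_rel (p + q)
| std_relZ (h : cherednik) p : std_rel p -> std_rel (h *: p)
| std_rel_vec_z v : std_rel (of_vec v *: gen_z)
| std_rel_vec_zbar v : std_rel (of_vec v *: gen_zbar)
| std_rel_refl_z j : (0 < j <= m)%N ->
    std_rel (srefl j *: gen_z
             - of_scal (omega R m ^ (j * u)%:Z) *: gen_zbar)
| std_rel_refl_zbar j : (0 < j <= m)%N ->
    std_rel (srefl j *: gen_zbar
             - of_scal (omega R m ^ (- (j * u)%:Z)) *: gen_z).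

Definition std_relb (p q : 'rV[cherednik]_2) : bool := `[< std_rel (p - q) >].

Lemma std_relN p : std_rel p -> std_rel (- p).
Proof. by move=> h; rewrite -scaleN1r; apply: std_relZ. Qed.

Lemma std_relb_equiv : equiv_class_of std_relb.
Proof.
split=> [a|a b|b a d].
- by apply/asboolP; rewrite subrr; apply: std_rel0.
- by apply: asbool_equiv_eq; split=> /std_relN; rewrite opprB.
- move=> /asboolP hab /asboolP hbd; apply/asboolP.
  by have := std_relD hab hbd; rewrite addrA subrK.
Qed.

Canonical std_equiv := EquivRelPack std_relb_equiv.
Canonical std_equiv_direct := defaultEncModRel std_relb.

Definition std_module : Type := {eq_quot std_relb}.
HB.instance Definition _ := Choice.on std_module.
HB.instance Definition _ : EqQuotient 'rV[cherednik]_2 std_relb std_module :=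
  EqQuotient.on std_module.

Definition mcls (p : 'rV[cherednik]_2) : std_module := \pi_std_module p.

Lemma mcls_eq p q : std_rel (p - q) -> mcls p = mcls q.
Proof. by move=> h; apply/eqmodP/asboolP. Qed.
Lemma std_rel_repr p : std_rel (repr (mcls p) - p).
Proof. by apply/asboolP; have /eqmodP := reprK (mcls p). Qed.
Lemma mclsP (P : std_module -> Prop) : (forall t, P (mcls t)) -> forall p, P p.
Proof. by move=> hP p; rewrite -[p]reprK; apply: hP. Qed.

Definition std_add (p q : std_module) := mcls (repr p + repr q).
Definition std_opp (p : std_module) := mcls (- repr p).
Definition act (h : cherednik) (p : std_module) : std_module :=
  mcls (h *: repr p).

Lemma mclsD p q : std_add (mcls p) (mcls q) = mcls (p + q).
Proof.
by apply: mcls_eq; rewrite opprD addrACA; apply: std_relD; apply: std_rel_repr.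
Qed.
Lemma mclsN p : std_opp (mcls p) = mcls (- p).
Proof. by apply: mcls_eq; rewrite -opprD; apply/std_relN/std_rel_repr. Qed.
Lemma mclsZ h p : act h (mcls p) = mcls (h *: p).
Proof. by apply: mcls_eq; rewrite -scalerBr; apply/std_relZ/std_rel_repr. Qed.

Lemma std_addA : associative std_add.
Proof.
by elim/mclsP=> a; elim/mclsP=> b; elim/mclsP=> d; rewrite !mclsD addrA.
Qed.
Lemma std_addC : commutative std_add.
Proof. by elim/mclsP=> a; elim/mclsP=> b; rewrite !mclsD addrC. Qed.
Lemma std_add0 : left_id (mcls 0) std_add.
Proof. by elim/mclsP=> a; rewrite mclsD add0r. Qed.
Lemma std_addN : left_inverse (mcls 0) std_opp std_add.
Proof. by elim/mclsP=> a; rewrite mclsN mclsD addNr. Qed.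

HB.instance Definition _ :=
  GRing.isZmodule.Build std_module std_addA std_addC std_add0 std_addN.

Lemma actA g h p : act g (act h p) = act (g * h) p.
Proof. by elim/mclsP: p => p; rewrite !mclsZ scalerA. Qed.
Lemma act1 p : act 1 p = p.
Proof. by elim/mclsP: p => p; rewrite mclsZ scale1r. Qed.
Lemma actDr h p q : act h (p + q) = act h p + act h q.
Proof.
elim/mclsP: p => p; elim/mclsP: q => q.
by rewrite [p in act h p]mclsD !mclsZ scalerDr [RHS]mclsD.
Qed.
Lemma actDl g h p : act (g + h) p = act g p + act h p.
Proof. by elim/mclsP: p => p; rewrite !mclsZ scalerDl [RHS]mclsD. Qed.

Definition std_scale (k : R[i]) (p : std_module) : std_module :=
  act (of_scal k) p.

Lemma std_scaleA k l p : std_scale k (std_scale l p) = std_scale (k * l) p.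
Proof.
rewrite /std_scale actA; congr act.
exact/esym/cls_ScalM.
Qed.
Lemma std_scale1 : left_id 1 std_scale.
Proof. by move=> p; apply: act1. Qed.
Lemma std_scaleDr : right_distributive std_scale +%R.
Proof. by move=> k p q; apply: actDr. Qed.
Lemma std_scaleDl p : {morph std_scale^~ p : k l / k + l}.
Proof. by move=> k l; rewrite /std_scale /of_scal cls_ScalD actDl. Qed.

HB.instance Definition _ := GRing.Zmodule_isLmodule.Build R[i] std_module
  std_scaleA std_scale1 std_scaleDr std_scaleDl.

(* the image of 1 (x) V(tau) *)
Definition Vtau : set std_module :=
  span [set mcls gen_z; mcls gen_zbar].

(* the image of C[E]_k (x) V(tau) *)
Fixpoint degree_part (k : nat) : set std_module :=
  if k is k'.+1 then
    span [set p | exists f q, degree_part k' q /\ p = act (of_cov f) q]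
  else Vtau.

Definition submodule (A : set cherednik) (W : set std_module) : Prop :=
  subspace W /\ forall h p, A h -> W p -> W (act h p).

Definition irreducible_submodule (A : set cherednik) (W : set std_module) :
    Prop :=
  [/\ submodule A W, W <> [set 0] &
      forall W', submodule A W' -> W' `<=` W -> W' = [set 0] \/ W' = W].

Definition std_irreducible : Prop := irreducible_submodule setT setT.

Definition hermitian_form (b : std_module -> std_module -> R[i]) : Prop :=
  (forall (k : R[i]) p q r, b (k *: p + q) r = k * b p r + b q r) /\
  (forall p q, b q p = (b p q)^* ).

Definition unitarisable : Prop :=
  exists (st : cherednik -> cherednik) (b : std_module -> std_module -> R[i]),
    [/\ is_star st,
        hermitian_form b,
        forall h p q, b (act h p) q = b p (act (st h) q),
        (forall g (hg : dihedral m g) v w, Vtau v -> Vtau w ->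
           b (act (of_grp hg) v) (act (of_grp hg) w) = b v w) &
        forall p, p != 0 -> 0 < b p p].

Definition harmonics (k : nat) : set std_module :=
  [set p | degree_part k p /\ act Eminus p = 0].

Definition harmonics_eigen (eps : R) (k : nat) (lam : R[i]) : set std_module :=
  [set p | harmonics k p /\ act (Zeps eps) p = lam *: p].

(* S is isomorphic to W (x) L_{u(1,1)}(mu, nu) as a joint module for the
   centraliser of u(1,1), acting on the left factor, and for u(1,1), acting on
   the right factor. *)
Definition is_joint_summand (eps : R) (W : set std_module) (mu nu : R[i])
    (S : set std_module) : Prop :=
  submodule (centraliser (u11 eps)) W /\
  exists (L : lmodType R[i]) (actL : cherednik -> L -> L)
         (b : std_module -> L -> std_module),
    [/\ is_lowest_weight_irrep eps mu nu actL,
        is_tensor_product W b S,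
        forall h w l, centraliser (u11 eps) h -> W w ->
          b (act h w) l = act h (b w l) &
        forall X w l, u11 eps X -> W w -> b w (actL X l) = act X (b w l)].

(* The set Lambda_k, as a list possibly with repetitions *)
Definition Lambda (eps : R) (k : nat) : seq R[i] :=
  let r (n : int) : R[i] :=
    sqrtC (k%:R ^+ 2 - (1 - eps%:C ^+ 2) * sigma_k n ^+ 2) in
  [:: r (k%:Z + u%:Z); - r (k%:Z + u%:Z);
      r (k%:Z - u%:Z); - r (k%:Z - u%:Z)].

(* None is the index of V(tau) (x) L(1,0). *)
Definition joint_index (eps : R) (i : option (nat * R[i])) : bool :=
  if i is Some (k, lam) then (0 < k)%N && (lam \in Lambda eps k) else true.

Definition joint_decomposition (eps : R) : Prop :=
  exists S : option (nat * R[i]) -> set std_module,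
    [/\ is_direct_sum (joint_index eps) S setT,
        is_joint_summand eps Vtau 1 0 (S None) &
        forall (k : nat) (lam : R[i]), (0 < k)%N -> lam \in Lambda eps k ->
          is_joint_summand eps (harmonics_eigen eps k lam) k.+1%:R lam
            (S (Some (k, lam)))].

End CherednikAlgebra.

Arguments u11 {R} m c eps.
Arguments harmonics_eigen {R} m c u eps k lam.

(* Main.v *)
From HB Require Import structures.
Require Import Defs.
From mathcomp Require Import all_boot all_order all_algebra.
From mathcomp Require Import complex.
From mathcomp Require Import boolp classical_sets reals trigo.
From mathcomp Require Import zify ring lra.
Import Defs.
Set Implicit Arguments.
Unset Strict Implicit.
Unset Printing Implicit Defensive.
Import Order.TTheory GRing.Theory Num.Theory.
Local Open Scope complex_scope.
Local Open Scope classical_set_scope.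
Local Open Scope ring_scope.

(** The elements [E_plus], [E_minus], [H_grad] form an sl2-triple of the
    Cherednik algebra commuting with the group and with the central element
    [Zdef] of [u(1,1)]. On the standard module [H_grad] acts in degree [k] by
    [k + 1 > 0]; hence every vector is a sum of translates [E_plus ^ n h] of
    harmonic vectors ([span_isotypic]), and a harmonic eigenvector of [Zdef]
    generates a copy of a lowest weight module, realised on the polynomials in
    the raising operator ([poly_act], [jspan_tensor]). The Casimir element and
    [Zdef] separate the summands ([direct_sum]).

    It remains to diagonalise [Zdef] on the harmonic vectors of degree [k > 0].
    The positive form makes them a complement of the image of [E_plus], that is
    of the multiples of [z zbar] ([harm_imEp]), so they have a basis of four
    harmonic parts of the vectors [z ^ k (x) v], [zbar ^ k (x) v]. Modulo [z zbar]
    the operators [Z0] and [sigma] only mix [z ^ k (x) v] with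
    [zbar ^ k (x) v'], where [v'] is the other basis vector; this gives two
    invariant planes with the matrix ([harmfZ])
    [[
        - k          (eps - 1) s
        (1 + eps) s    k
    ]]
    for [s = sigma_(k + u)], respectively [s = sigma_(k - u)], whose square is
    the scalar [k ^ 2 - (1 - eps ^ 2) s ^ 2]. The scalar is nonzero because
    [Zdef] is self-adjoint, so both of its square roots are simple eigenvalues in
    the plane ([eigenline_ex], [eigenline_line]). That the four vectors are
    independent rests on the independence of monomials in the standard module,
    which is detected by functionals on which the algebra acts through transposed
    Dunkl operators ([ev_eqv], [std_independent]).

    With four eigenvalues each eigenspace is a line. With two, an eigenspace is
    the sum of one line in each plane, and these lines are submodules because the
    centraliser of sl2 is spanned by the products of powers of the rotation
    [Z0] with group elements ([centraliser_rot]), which preserve both planes. The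
    determination of the centraliser filters the algebra by word length: ordered
    words of weight zero are, modulo shorter ones, combinations of these
    products and of brackets [br E_plus y] with [y] of weight -2 ([word_Q]), and
    an invariant bracket of this kind vanishes ([br_Em_Ep_inj]). *)

(** * Roots of unity, reflections and the sums sigma_k *)

Section RootOfUnity.
Variables (R : realType) (m : nat).
Hypothesis m_gt0 : (0 < m)%N.
Local Notation om := (omega R m).

Definition expi (x : R) : R[i] := cos x +i* sin x.

Lemma expiD x y : expi (x + y) = expi x * expi y.
Proof.
apply/eqP; rewrite eq_complex /= cosD sinD /=.
by rewrite eqxx addrC eqxx.
Qed.

Lemma expi0 : expi 0 = 1.
Proof. by rewrite /expi cos0 sin0. Qed.

Lemma omega_expi n : om ^+ n = expi (2 * theta R m n).
Proof.
elim: n => [|n IH]; first by rewrite expr0 /theta !mulr0 mul0r mulr0 expi0.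
rewrite exprS IH [om]/omega -/(expi _) -expiD; congr expi.
by rewrite /theta -(natr1 n); field; rewrite pnatr_eq0 -lt0n.
Qed.

Lemma omega_m : om ^+ m = 1.
Proof.
rewrite omega_expi /theta -mulrA divff ?pnatr_eq0 -?lt0n // mulr1 mulr_natl.
by rewrite /expi cos2pi sin2pi.
Qed.

Lemma omega_neq0 : om != 0.
Proof.
by apply/eqP=> h; have := omega_m; rewrite h expr0n gtn_eqF //= => /eqP;
  rewrite eq_sym oner_eq0.
Qed.

Lemma omega_neq1 n : (0 < n < m)%N -> om ^+ n != 1.
Proof.
move=> /andP[n0 nm]; rewrite omega_expi; apply/eqP => -[h _].
have : 0 < sin (theta R m n).
  apply: sin_gt0_pi; rewrite /theta divr_gt0 ?mulr_gt0 ?pi_gt0 ?ltr0n //=.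
  by rewrite ltr_pdivrMr ?ltr0n // ltr_pM2l ?pi_gt0 // ltr_nat.
move: h; rewrite mulr_natl cos_mulr2n cos2sin2 => h.
have h2 : sin (theta R m n) ^+ 2 = 0 by move: h; rewrite mulr2n; lra.
by move: h2 => /eqP; rewrite sqrf_eq0 => /eqP ->; rewrite ltxx.
Qed.

Lemma conj_omega : om^* = om^-1.
Proof.
apply: (mulfI omega_neq0); rewrite divff ?omega_neq0 //.
rewrite -normCK [om]/omega normc_def /= cos2Dsin2 sqrtr1.
by rewrite expr1n.
Qed.

Lemma refl_expi j :
  refl R m j = \matrix_(a, b) (if a == 0 then if b == 0 then cos (2 * theta R m j) else sin (2 * theta R m j)
     else if b == 0 then sin (2 * theta R m j) else - cos (2 * theta R m j)).
Proof.
set t := theta R m j.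
have hc : cos (2 * t) = 1 - 2 * sin t ^+ 2.
  by rewrite mulr_natl cos_mulr2n cos2sin2 mulr2n; ring.
have hs : sin (2 * t) = 2 * (sin t * cos t).
  by rewrite mulr_natl sin_mulr2n mulr2n; ring.
have E := cos2Dsin2 t.
apply/matrixP => a b; rewrite !mxE big_ord1 !mxE -/t hc hs.
case: a => [[|[|//]] ?]; case: b => [[|[|//]] ?] /=; rewrite /= ?mulr0n ?mulr1n; lra.
Qed.

End RootOfUnity.

Section DihedralMatrices.
Variables (R : realType) (m : nat).
Hypothesis m_gt0 : (0 < m)%N.
Local Notation om := (omega R m).

(** Coordinates [v = x + i y] on the plane turn every element of the dihedral
    group into [v |-> rho v] (for [b = false]) or [v |-> rho v^*] (for
    [b = true]) with [rho] a root of unity. *)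
Definition gmx (b : bool) (rho : R[i]) : 'M[R]_2 :=
  \matrix_(i, j) (if j == 0 then if i == 0 then complex.Re rho else complex.Im rho
                  else (-1) ^+ b * (if i == 0 then - complex.Im rho else complex.Re rho)).

Lemma gmxM b1 b2 r1 r2 :
  gmx b1 r1 *m gmx b2 r2 = gmx (b1 (+) b2) (r1 * (if b1 then r2^* else r2)).
Proof.
have hc : forall r : R[i], r^* = (complex.Re r) -i* (complex.Im r) by case.
case: r1 r2 => [x1 y1] [x2 y2]; rewrite hc.
apply/matrixP => i j; rewrite !mxE !big_ord_recl big_ord0 !mxE.
case: i => [[|[|//]] ?]; case: j => [[|[|//]] ?];
  case: b1; case: b2 => /=; ring.
Qed.

Lemma gmx1 : gmx false 1 = 1%:M.
Proof.
apply/matrixP => i j; rewrite !mxE.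
by case: i => [[|[|//]] ?]; case: j => [[|[|//]] ?];
  rewrite /= ?mul1r ?mulr1 ?oppr0.
Qed.

Lemma refl_gmx j : refl R m j = gmx true (om ^+ j).
Proof.
rewrite refl_expi omega_expi //; apply/matrixP => a b; rewrite !mxE.
by case: a => [[|[|//]] ?]; case: b => [[|[|//]] ?]; rewrite /=; lra.
Qed.

Lemma conj_omz (k : int) : (om ^ k)^* = om ^ (- k).
Proof. by rewrite fmorphXz /= conj_omega // exprz_inv. Qed.

Lemma dihedral_gmx g : dihedral m g ->
  exists b (k : int), g = gmx b (om ^ k).
Proof.
elim=> [|j h _ _ [b [k ->]]]; first by exists false, 0; rewrite expr0z gmx1.
exists (~~ b), (j%:Z - k); rewrite refl_gmx gmxM conj_omz.
by rewrite expfzDr ?omega_neq0.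
Qed.

Lemma omz_mulm (k : int) : om ^ (k * m%:Z) = 1.
Proof. by rewrite mulrC -exprz_exp -[om ^ m]/(om ^+ m) omega_m // exp1rz. Qed.

Lemma omz_nat (k : int) : exists2 j, (0 < j <= m)%N & om ^ k = om ^+ j.
Proof.
have mne : (m%:Z != 0) by rewrite eqz_nat -lt0n.
pose r := `|(k %% m)%Z|%N.
have hr : (r < m)%N by rewrite /r; have := ltz_mod k mne; have := modz_ge0 k mne; lia.
have hk : om ^ k = om ^+ r.
  rewrite {1}(divz_eq k m) expfzDr ?omega_neq0 //.
  rewrite omz_mulm mul1r /r.
  by rewrite -[RHS]/(om ^ _%:Z) gez0_abs ?modz_ge0.
have [r0|r0] := posnP r; last by exists r => //; rewrite r0 ltnW.
by exists m; rewrite ?m_gt0 ?leqnn // hk r0 omega_m.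
Qed.

End DihedralMatrices.

Section Sigma.
Variables (R : realType) (m : nat) (c : 'M[R]_2 -> R[i]).
Hypothesis m_gt0 : (0 < m)%N.
Hypothesis hc : conj_invariant m c.
Local Notation om := (omega R m).

Definition cz (k : int) : R[i] := c (gmx true (om ^ k)).

Lemma cz_refl j : c (refl R m j) = cz j.
Proof. by rewrite refl_gmx. Qed.

(** Conjugating [s_k] by [s_i] gives [s_(2 i - k)]. *)
Lemma cz_sym i (k : int) : (0 < i <= m)%N -> cz (i%:Z *+ 2 - k) = cz k.
Proof.
move=> hi; have [j hj hk] := omz_nat R m_gt0 k.
have hd : dihedral m (refl R m i).
  by rewrite -[refl _ _ _]mulmx1; apply: dihedralM => //; left.
have u : refl R m i *m refl R m i = 1%:M.
  rewrite refl_gmx // gmxM /= -[om ^+ i]/(om ^ i) conj_omz // -expfzDr ?omega_neq0 //.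
  by rewrite subrr expr0z gmx1.
have iv : invmx (refl R m i) = refl R m i.
  have [u1 u2] := mulmx1_unit u.
  by rewrite -[LHS]mulmx1 -u mulmxA mulVmx // mul1mx.
have := hc hd hj; rewrite iv !refl_gmx // /cz hk => <-.
congr c; rewrite -hk -[om ^+ i]/(om ^ i%:Z) !gmxM /= !conj_omz //.
rewrite -!expfzDr ?omega_neq0 //; congr (gmx _ (_ ^ _)); lia.
Qed.

Lemma cz_period (k : int) : cz (k + m%:Z) = cz k.
Proof. by rewrite /cz expfzDr ?omega_neq0 // -{1}[m%:Z]mul1r omz_mulm // mulr1. Qed.

Lemma czN (k : int) : cz (- k) = cz k.
Proof.
have h : (0 < m <= m)%N by rewrite m_gt0 leqnn.
by rewrite -(cz_sym k h) -(cz_period (- k)) -(cz_period (_ + m%:Z)); congr cz; lia.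
Qed.

Lemma cz2 (k : int) : cz (k + 2) = cz k.
Proof.
have h : (0 < 1 <= m)%N by rewrite m_gt0.
by rewrite -[RHS]czN -(cz_sym (- k) h); congr cz; lia.
Qed.

Lemma sum_period (F : nat -> R[i]) : F m = F 0%N ->
  \sum_(1 <= j < m.+1) F j = \sum_(0 <= j < m) F j.
Proof.
move: m_gt0; case: m => // n _ h.
by rewrite big_add1 [RHS]big_nat_recl //= big_nat_recr //= h addrC.
Qed.

Lemma sigma_kE n : sigma_k m c n = \sum_(0 <= j < m) cz j * om ^ (n * j%:Z).
Proof.
rewrite /sigma_k -sum_period.
  by apply: eq_bigr => j _; rewrite cz_refl.
rewrite mulr0 omz_mulm //.
by rewrite -[m%:Z]add0r cz_period.
Qed.

Lemma sigma_kN n : sigma_k m c (- n) = sigma_k m c n.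
Proof.
rewrite [RHS]sigma_kE /sigma_k big_nat_rev big_add1 /=.
rewrite big_nat [RHS]big_nat; apply: eq_bigr => j /andP[_ hj].
rewrite cz_refl.
have -> : (1 + m.+1 - j.+2)%N%:Z = - j%:Z + m%:Z by lia.
rewrite cz_period czN; congr (_ * _).
rewrite mulrDr expfzDr ?omega_neq0 // mulrNN.
by rewrite omz_mulm // mulr1.
Qed.

(** Since [c] takes the same value on [s_j] and [s_(j + 2)], shifting the
    summation index by 2 multiplies [sigma_n] by [omega ^ (2 n)]. For
    [0 < u < q] this forces [sigma_u = 0], so that [sigma] kills [V(tau)]. *)
Lemma sigma_k_shift n : sigma_k m c n * (1 - om ^ (n *+ 2)) = 0.
Proof.
have sh (F : int -> R[i]) : (forall k, F (k + m%:Z) = F k) ->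
    \sum_(0 <= j < m) F (j%:Z + 1) = \sum_(0 <= j < m) F j%:Z.
  move=> hF; rewrite -(@sum_period (fun j => F j%:Z)) ?big_add1 /=; last first.
    by rewrite -[m%:Z]add0r hF.
  by apply: eq_bigr => j _; congr F; lia.
pose F (k : int) := cz k * om ^ (n * k).
have hF k : F (k + m%:Z) = F k.
  rewrite /F cz_period mulrDr expfzDr ?omega_neq0 //.
  by rewrite omz_mulm // mulr1.
have e1 := sh F hF.
have e2 := sh (fun k => F (k + 1)) (fun k => etrans (congr1 F (addrAC _ _ _)) (hF _)).
rewrite mulrBr mulr1; apply/eqP; rewrite subr_eq0; apply/eqP.
rewrite sigma_kE -/(F _) -[LHS]e1 -[LHS]e2 mulr_suml; apply: eq_bigr => j _.
rewrite /F -addrA cz2 -mulrA -expfzDr ?omega_neq0 //; congr (_ * om ^ _); lia.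
Qed.

Lemma sigma_k_eq0 (u q : nat) : m = (2 * q)%N \/ m = (2 * q - 1)%N ->
  (0 < u < q)%N -> sigma_k m c u = 0.
Proof.
move=> hm hu; have := sigma_k_shift u => /eqP; rewrite mulf_eq0 subr_eq0.
case/orP => [/eqP //|]; rewrite eq_sym => /eqP h.
suff /eqP : om ^+ (u * 2) != 1 by case; rewrite -h -mulr_natr -PoszM.
by apply: omega_neq1 => //; lia.
Qed.

End Sigma.

(** * Commutators *)

Section Commutator.
Variable A : pzRingType.
Implicit Types x y t : A.

Definition br x y : A := x * y - y * x.

Lemma br_def x y : br x y = x * y - y * x.
Proof. by []. Qed.

Lemma br0r x : br x 0 = 0.
Proof. by rewrite /br mulr0 mul0r subrr. Qed.

Lemma brE x y : x * y = y * x + br x y.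
Proof. by rewrite addrC subrK. Qed.

Lemma brN x y : br x y = - br y x.
Proof. by rewrite /br opprB. Qed.

Lemma brMr x y t : br x (y * t) = br x y * t + y * br x t.
Proof. by rewrite /br mulrBl mulrBr !mulrA addrA subrK. Qed.

Lemma brMl x y t : br (x * y) t = x * br y t + br x t * y.
Proof. by rewrite /br mulrBl mulrBr !mulrA addrA subrK. Qed.

Lemma brDr x y t : br x (y + t) = br x y + br x t.
Proof. by rewrite /br mulrDl mulrDr opprD addrACA. Qed.

Lemma brDl x y t : br (x + y) t = br x t + br y t.
Proof. by rewrite /br mulrDl mulrDr opprD addrACA. Qed.

Lemma brNr x y : br x (- y) = - br x y.
Proof. by rewrite /br mulNr mulrN opprB opprK addrC. Qed.

Lemma brBr x y t : br x (y - t) = br x y - br x t.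
Proof. by rewrite brDr brNr. Qed.

Lemma jacobi x y t : br (br x y) t = br x (br y t) - br y (br x t).
Proof.
transitivity (br (x * y - y * x) t); first by [].
rewrite brDl [br (- _) _]brN brNr -brN !brMl.
rewrite [br x (br y t)]/br [br y (br x t)]/br opprB opprD.
by rewrite [- _ - _]addrC addrACA.
Qed.

End Commutator.

(** * The algebra in complex coordinates *)

Section Relations.
Variables (R : realType) (m : nat) (c : 'M[R]_2 -> R[i]).
Hypothesis m_gt0 : (0 < m)%N.
Local Notation H := (cherednik m c).
Implicit Types (h x y : H) (e : bool).

Lemma scale_of_scal (k : R[i]) h : k *: h = of_scal m c k * h.
Proof. exact: ch_scaleE. Qed.

Lemma of_scalE k : of_scal m c k = k *: (1 : H).
Proof. by rewrite scale_of_scal mulr1. Qed.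

Lemma of_scalC k h : of_scal m c k * h = h * of_scal m c k.
Proof.
elim/clsP: h => a; rewrite [LHS]clsM [RHS]clsM.
exact/cls_eqv/eqv_ScalC.
Qed.

Lemma chZl (k : R[i]) x y : (k *: x) * y = k *: (x * y).
Proof. by rewrite !scale_of_scal mulrA. Qed.

Lemma chZr (k : R[i]) x y : x * (k *: y) = k *: (x * y).
Proof. by rewrite !scale_of_scal mulrA -of_scalC mulrA. Qed.

Lemma of_vec_linear k v w : of_vec m c (k *: v + w) = k *: of_vec m c v + of_vec m c w.
Proof.
transitivity (cls c (Add (Mul (Scal m k) (@Vec R m v)) (@Vec R m w))).
  exact/cls_eqv/eqv_Vec.
by rewrite -clsD -clsZ.
Qed.

Lemma of_cov_linear k v w : of_cov m c (k *: v + w) = k *: of_cov m c v + of_cov m c w.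
Proof.
transitivity (cls c (Add (Mul (Scal m k) (@Cov R m v)) (@Cov R m w))).
  exact/cls_eqv/eqv_Cov.
by rewrite -clsD -clsZ.
Qed.

Lemma of_vec0 : of_vec m c 0 = 0.
Proof.
have := of_vec_linear 1 0 0; rewrite !scale1r addr0 => h.
by apply: (addIr (of_vec m c 0)); rewrite add0r.
Qed.

Lemma of_cov0 : of_cov m c 0 = 0.
Proof.
have := of_cov_linear 1 0 0; rewrite !scale1r addr0 => h.
by apply: (addIr (of_cov m c 0)); rewrite add0r.
Qed.

Lemma of_vecZ k v : of_vec m c (k *: v) = k *: of_vec m c v.
Proof. by rewrite -[k *: v]addr0 of_vec_linear of_vec0 addr0. Qed.

Lemma of_covZ k v : of_cov m c (k *: v) = k *: of_cov m c v.
Proof. by rewrite -[k *: v]addr0 of_cov_linear of_cov0 addr0. Qed.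

(** The booleans [true], [false] index the pairs exchanged by the reflections:
    [z_letter] gives [z], [zbar] and [w_letter] the dual basis [zeta], [zetabar].
    This makes every relation below a single statement. *)
Definition z_letter e : H := of_cov m c (covec2 1 (if e then 'i else - 'i)).
Definition w_letter e : H := of_vec m c (2^-1 *: vec2 1 (if e then - 'i else 'i)).
Definition sg e : int := if e then -1 else 1.

Lemma z_E : z_ m c = z_letter true.
Proof.
rewrite /z_ /x_ /y_ /z_letter addrC -of_cov_linear; congr of_cov.
by apply/matrixP => i j; rewrite !mxE; case: j => [[|[|//]] ?] /=;
  rewrite ?mulr0 ?mulr1 ?add0r ?addr0.
Qed.

Lemma zbar_E : zbar_ m c = z_letter false.
Proof.
rewrite /zbar_ /x_ /y_ /z_letter addrC -scaleNr -of_cov_linear; congr of_cov.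
by apply/matrixP => i j; rewrite !mxE; case: j => [[|[|//]] ?] /=;
  rewrite ?mulr0 ?mulr1 ?add0r ?addr0.
Qed.

Lemma zeta_E : zeta_ m c = w_letter true.
Proof.
rewrite /zeta_ /xi_ /eta_ /w_letter addrC -scaleNr -of_vec_linear of_vecZ; congr (_ *: of_vec _ _ _).
by apply/matrixP => i j; rewrite !mxE; case: i => [[|[|//]] ?] /=;
  rewrite ?mulr0 ?mulr1 ?add0r ?addr0.
Qed.

Lemma zetabar_E : zetabar_ m c = w_letter false.
Proof.
rewrite /zetabar_ /xi_ /eta_ /w_letter addrC -of_vec_linear of_vecZ; congr (_ *: of_vec _ _ _).
by apply/matrixP => i j; rewrite !mxE; case: i => [[|[|//]] ?] /=;
  rewrite ?mulr0 ?mulr1 ?add0r ?addr0.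
Qed.

Lemma of_vec_ww v : of_vec m c v =
  (v 0 0 + 'i * v 1 0) *: w_letter true + (v 0 0 - 'i * v 1 0) *: w_letter false.
Proof.
rewrite /w_letter -(of_vecZ (_ - _)) -of_vec_linear; congr of_vec.
apply/matrixP => i j; rewrite !mxE ord1; have := sqrCi R[i].
case: i => [[|[|//]] hi] /=.
  rewrite (_ : Ordinal hi = 0); last exact/val_inj.
  by move=> _; field.
rewrite (_ : Ordinal hi = 1); last exact/val_inj.
by move=> i2; apply/eqP; rewrite -subr_eq0; apply/eqP; field: i2.
Qed.

Lemma of_cov_zz f : of_cov m c f =
  ((f 0 0 - 'i * f 0 1) / 2) *: z_letter true + ((f 0 0 + 'i * f 0 1) / 2) *: z_letter false.
Proof.
rewrite /z_letter -[X in _ + X]of_covZ -of_cov_linear; congr of_cov.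
apply/matrixP => i j; rewrite !mxE ord1; have := sqrCi R[i].
case: j => [[|[|//]] hi] /=.
  rewrite (_ : Ordinal hi = 0); last exact/val_inj.
  by move=> _; field.
rewrite (_ : Ordinal hi = 1); last exact/val_inj.
by move=> i2; apply/eqP; rewrite -subr_eq0; apply/eqP; field: i2.
Qed.

Lemma wwC e e' : w_letter e * w_letter e' = w_letter e' * w_letter e.
Proof. by rewrite [LHS]clsM [RHS]clsM; apply/cls_eqv/eqv_VecC. Qed.

Lemma zzC e e' : z_letter e * z_letter e' = z_letter e' * z_letter e.
Proof. by rewrite [LHS]clsM [RHS]clsM; apply/cls_eqv/eqv_CovC. Qed.

End Relations.

Section GroupRelations.
Variables (R : realType) (m : nat) (c : 'M[R]_2 -> R[i]).
Hypothesis m_gt0 : (0 < m)%N.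
Local Notation om := (omega R m).
Local Notation H := (cherednik m c).
Local Notation zz := (z_letter m c).
Local Notation ww := (w_letter m c).
Implicit Types (h x y : H) (e : bool).

Lemma omz_ReIm (k : int) :
  om ^ k = (complex.Re (om ^ k))%:C + 'i * (complex.Im (om ^ k))%:C /\
  om ^ (- k) = (complex.Re (om ^ k))%:C - 'i * (complex.Im (om ^ k))%:C.
Proof.
rewrite -conj_omz // -complexiE -complexE; split=> //; case: (om ^ k) => a b.
by apply/eqP; rewrite eq_complex /=; apply/andP; split; apply/eqP; ring.
Qed.

Lemma grp_ww b k e (hg : dihedral m (gmx b (om ^ k))) :
  of_grp c hg * ww e = om ^ (- (k * sg (e (+) b))) *: (ww (e (+) b) * of_grp c hg).
Proof.
transitivity (of_vec m c (cplx_mx (gmx b (om ^ k)) *m (2^-1 *: vec2 1 (if e then - 'i else 'i))) * of_grp c hg).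
  by rewrite [LHS]clsM [RHS]clsM; apply/cls_eqv/eqv_GrpVec.
rewrite -chZl /ww -of_vecZ; congr (of_vec _ _ _ * _).
have [h1 h2] := omz_ReIm k; have := sqrCi R[i] => i2.
have -> : om ^ (- (k * sg (e (+) b))) =
    if e (+) b then (complex.Re (om ^ k))%:C + 'i * (complex.Im (om ^ k))%:C else (complex.Re (om ^ k))%:C - 'i * (complex.Im (om ^ k))%:C.
  by rewrite -h2 -h1 /sg; case: (e (+) b); congr (_ ^ _); lia.
clear hg; apply/matrixP => i j; rewrite !mxE !big_ord_recl big_ord0 !mxE ord1.
case: i => [[|[|//]] ?]; case: e; case: b => /=;
  rewrite ?expr0 ?expr1 ?mulN1r ?mul1r ?rmorphN /=; ring: i2.
Qed.

Lemma inv_gmx b (k : int) :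
  invmx (cplx_mx (gmx b (om ^ k))) = cplx_mx (gmx b (om ^ (if b then k else - k))).
Proof.
have u : cplx_mx (gmx b (om ^ k)) *m cplx_mx (gmx b (om ^ (if b then k else - k))) = 1%:M.
  rewrite /cplx_mx -map_mxM gmxM addbb.
  suff -> : om ^ k * (if b then (om ^ (if b then k else - k))^*
                      else om ^ (if b then k else - k)) = 1.
    by rewrite gmx1 map_mx1.
  by case: b; rewrite ?conj_omz // -expfzDr ?omega_neq0 // subrr.
have [u1 u2] := mulmx1_unit u.
by rewrite -[LHS]mulmx1 -u mulmxA mulVmx // mul1mx.
Qed.

Lemma grp_zz b k e (hg : dihedral m (gmx b (om ^ k))) :
  of_grp c hg * zz e = om ^ (k * sg (e (+) b)) *: (zz (e (+) b) * of_grp c hg).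
Proof.
transitivity (of_cov m c (covec2 1 (if e then 'i else - 'i) *m invmx (cplx_mx (gmx b (om ^ k)))) * of_grp c hg).
  by rewrite [LHS]clsM [RHS]clsM; apply/cls_eqv/eqv_GrpCov.
rewrite inv_gmx -chZl /zz -of_covZ; congr (of_cov _ _ _ * _).
have [h1 h2] := omz_ReIm k; have := sqrCi R[i] => i2.
have -> : om ^ (k * sg (e (+) b)) =
    if e (+) b then (complex.Re (om ^ k))%:C - 'i * (complex.Im (om ^ k))%:C else (complex.Re (om ^ k))%:C + 'i * (complex.Im (om ^ k))%:C.
  by rewrite -h2 -h1 /sg; case: (e (+) b); congr (_ ^ _); lia.
clear hg.
have hk : om ^ (if b then k else - k) = complex.Re (om ^ k) +i* (if b then complex.Im (om ^ k) else - complex.Im (om ^ k)).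
  case: b; first by case: (om ^ k).
  by rewrite -conj_omz //; case: (om ^ k).
rewrite hk {hk}.
apply/matrixP => i j; rewrite !mxE !big_ord_recl big_ord0 !mxE.
case: j => [[|[|//]] ?]; case: e; case: b => /=;
  rewrite ?expr0 ?expr1 ?mulN1r ?mul1r ?rmorphN /=; ring: i2.
Qed.

Lemma sreflE j (hj : (0 < j <= m)%N) :
  exists hg : dihedral m (gmx true (om ^ j%:Z)), srefl m c j = of_grp c hg.
Proof.
rewrite /srefl /refl_term; case: pselect => // h.
have hd := dihedral_refl R h.
rewrite /of_grp; move: (dihedral_refl R h); rewrite refl_gmx // => hg.
by exists hg.
Qed.

Lemma srefl_zz j e : (0 < j <= m)%N ->
  srefl m c j * zz e = om ^ (j%:Z * sg (~~ e)) *: (zz (~~ e) * srefl m c j).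
Proof. by case/sreflE => hg ->; rewrite grp_zz addbT. Qed.

Lemma srefl_ww j e : (0 < j <= m)%N ->
  srefl m c j * ww e = om ^ (j%:Z * sg e) *: (ww (~~ e) * srefl m c j).
Proof.
by case/sreflE => hg ->; rewrite grp_ww addbT; congr (_ ^ _ *: _);
  case: e; rewrite /sg /=; lia.
Qed.

(** The commutators of letters are these sums of reflections, the one for
    [n = 0] being [sigma_]; moving a letter across shifts [n]. *)
Definition refl_sum (n : int) : H :=
  \sum_(1 <= j < m.+1) (c (refl R m j) * om ^ (n * j%:Z)) *: srefl m c j.

Lemma sigma_E : sigma_ m c = refl_sum 0.
Proof. by apply: eq_bigr => j _; rewrite mul0r expr0z mulr1. Qed.

Lemma refl_sum_zz n e : refl_sum n * zz e = zz (~~ e) * refl_sum (n + sg (~~ e)).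
Proof.
rewrite /refl_sum mulr_suml mulr_sumr !big_nat; apply: eq_bigr => j hj.
rewrite chZl srefl_zz // scalerA chZr -mulrA -expfzDr ?omega_neq0 //.
by rewrite mulrDl [_ * j%:Z in RHS]mulrC [_ * j%:Z in X in X = _]mulrC; congr (_ * om ^ _ *: _); ring.
Qed.

Lemma refl_sum_ww n e : refl_sum n * ww e = ww (~~ e) * refl_sum (n + sg e).
Proof.
rewrite /refl_sum mulr_suml mulr_sumr !big_nat; apply: eq_bigr => j hj.
rewrite chZl srefl_ww // scalerA chZr -mulrA -expfzDr ?omega_neq0 //.
by congr (_ * om ^ _ *: _); ring.
Qed.

Lemma cls_sum (I : Type) (r : seq I) (P : pred I) (F : I -> term R m) :
  cls c (\big[@Add R m/Scal m 0]_(i <- r | P i) F i) = \sum_(i <- r | P i) cls c (F i).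
Proof. by apply: (big_morph (cls c)) => // a b; rewrite -clsD. Qed.

Lemma clsDE (a b : term R m) : cls c (Add a b) = cls c a + cls c b.
Proof. by rewrite -clsD. Qed.
Lemma clsZE k (b : term R m) : cls c (Mul (Scal m k) b) = k *: cls c b.
Proof. by rewrite -clsZ. Qed.
Lemma clsME (a b : term R m) : cls c (Mul a b) = cls c a * cls c b.
Proof. by rewrite -clsM. Qed.

Lemma br_vec_cov v f : br (of_vec m c v) (of_cov m c f) =
  pairing f v *: (1 : H) - 2 *: \sum_(1 <= j < m.+1)
    (c (refl R m j) * pairing f (cplx_mx (alpha R m j))
       * pairing (cplx_mx (coalpha R m j)) v) *: srefl m c j.
Proof.
have := cls_eqv (eqv_VecCov m c v f).
rewrite !(clsDE, clsZE) !clsME cls_sum scaleN1r scaleNr.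
by under eq_bigr do rewrite clsZE; rewrite -of_scalE.
Qed.

(** The half-angle formulas turn the products of root coordinates in the
    defining relation into powers of [omega]. *)
Lemma br_ww_zz e e' : br (ww e) (zz e') =
  if e == e' then 1 - refl_sum 0 else refl_sum (sg e).
Proof.
rewrite br_vec_cov.
have hp : pairing (covec2 1 (if e' then 'i else - 'i)) (2^-1 *: vec2 1 (if e then - 'i else 'i))
    = (e == e')%:R :> R[i].
  rewrite /pairing !mxE !big_ord_recl big_ord0 !mxE /=; have := sqrCi R[i] => i2.
  by case: e; case: e' => /=; field: i2.
have hs : 2 *: \sum_(1 <= j < m.+1)
    (c (refl R m j) * pairing (covec2 1 (if e' then 'i else - 'i)) (cplx_mx (alpha R m j))
       * pairing (cplx_mx (coalpha R m j)) (2^-1 *: vec2 1 (if e then - 'i else 'i))) *: srefl m c j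
    = if e == e' then refl_sum 0 else - refl_sum (sg e).
  transitivity ((-1) ^+ (e != e') *: refl_sum (if e == e' then 0 else sg e)); last first.
    by case: (e == e'); rewrite /= ?expr0 ?scale1r // expr1 scaleN1r.
  rewrite /refl_sum !scaler_sumr; apply: eq_bigr => j _; rewrite !scalerA; congr (_ *: _).
  rewrite [RHS]mulrCA -!mulrA [LHS]mulrCA; congr (_ * _).
  have hom (t : R) : expi (2 * t) = (cos t)%:C ^+ 2 - (sin t)%:C ^+ 2 + 2 * 'i * ((sin t)%:C * (cos t)%:C).
    rewrite -complexiE mulr_natl mulr2n expiD.
    by apply/eqP; rewrite eq_complex /=; apply/andP; split; apply/eqP; ring.
  have hn : om ^ (- j%:Z) = (cos (theta R m j))%:C ^+ 2 - (sin (theta R m j))%:C ^+ 2 - 2 * 'i * ((sin (theta R m j))%:C * (cos (theta R m j))%:C).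
    rewrite -conj_omz // -[om ^ _]/(om ^+ _) omega_expi // -complexiE mulr_natl mulr2n expiD.
    by apply/eqP; rewrite eq_complex /=; apply/andP; split; apply/eqP; ring.
  have hp' : om ^ j%:Z = (cos (theta R m j))%:C ^+ 2 - (sin (theta R m j))%:C ^+ 2 + 2 * 'i * ((sin (theta R m j))%:C * (cos (theta R m j))%:C).
    by rewrite -hom -[om ^ _]/(om ^+ _) omega_expi.
  have cs : (cos (theta R m j))%:C ^+ 2 = 1 - (sin (theta R m j))%:C ^+ 2 :> R[i].
    by apply/eqP; rewrite -subr_eq opprK -!rmorphXn /= -rmorphD /= cos2Dsin2.
  have := sqrCi R[i] => i2.
  rewrite /pairing !mxE !big_ord_recl !big_ord0 !mxE /= rmorphN /=.
  move: cs hn hp'; set x := (cos _)%:C; set y := (sin _)%:C => cs hn hp'; clear hp.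
  case: e; case: e' => /=; rewrite ?expr0 ?expr1 ?mul0r ?expr0z ?mulN1r ?mul1r ?hn ?hp'.
  - by field: i2 cs.
  - by field: i2.
  - by field: i2.
  - by field: i2 cs.
by rewrite hp hs; case: (e == e'); rewrite /= ?scale1r // scale0r add0r opprK.
Qed.

End GroupRelations.

(** * Spans and sums of eigenvectors *)

Section LinearSpan.
Variables (K : fieldType) (V : lmodType K).
Implicit Types (W A : set V) (x y : V).

Lemma subspaceD W x y : subspace W -> W x -> W y -> W (x + y).
Proof. by move=> [_ h] hx hy; rewrite -[x]scale1r; apply: h. Qed.

Lemma subspaceZ W a x : subspace W -> W x -> W (a *: x).
Proof. by move=> [h0 h] hx; rewrite -[X in W X]addr0; apply: h. Qed.

Lemma subspaceN W x : subspace W -> W x -> W (- x).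
Proof. by move=> hW hx; rewrite -scaleN1r; apply: subspaceZ. Qed.

Lemma subspaceB W x y : subspace W -> W x -> W y -> W (x - y).
Proof. by move=> hW hx hy; apply: subspaceD => //; apply: subspaceN. Qed.

Lemma subspace_sum W (I : Type) (r : seq I) (P : pred I) (F : I -> V) :
  subspace W -> (forall i, P i -> W (F i)) -> W (\sum_(i <- r | P i) F i).
Proof.
move=> hW hF; elim/big_ind: _ => //; first by case: hW.
by move=> x y; apply: subspaceD.
Qed.

Lemma span_subspace A : subspace (span A).
Proof.
split; first by exists 0%N, (fun _ => 0), (fun _ => 0); rewrite big_ord0; split=> // -[].
move=> k x y [n [a [v [hv ->]]]] [n' [a' [v' [hv' ->]]]].
exists (n + n')%N, (fun i => match split i with inl j => k * a j | inr j => a' j end),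
  (fun i => match split i with inl j => v j | inr j => v' j end).
split; first by move=> i; case: (split i).
rewrite big_split_ord scaler_sumr; congr (_ + _); apply: eq_bigr => i _.
  by rewrite (unsplitK (inl i)) scalerA.
by rewrite (unsplitK (inr i)).
Qed.

Lemma sub_span A : A `<=` span A.
Proof.
by move=> x hx; exists 1%N, (fun _ => 1), (fun _ => x); rewrite big_ord1 scale1r.
Qed.

Lemma span_min A W : subspace W -> A `<=` W -> span A `<=` W.
Proof.
move=> hW hA x [n [a [v [hv ->]]]]; apply: subspace_sum => // i _.
by apply: subspaceZ => //; apply: hA.
Qed.

End LinearSpan.

Section LinearMap.
Variables (K : fieldType) (V U : lmodType K) (D : V -> U).
Hypothesis D_lin : forall a x y, D (a *: x + y) = a *: D x + D y.

Lemma lin0 : D 0 = 0.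
Proof.
have := D_lin 1 0 0; rewrite !scale1r addr0 => h.
by apply: (addIr (D 0)); rewrite add0r.
Qed.

Lemma linD x y : D (x + y) = D x + D y.
Proof. by rewrite -[x]scale1r D_lin !scale1r. Qed.

Lemma linZ a x : D (a *: x) = a *: D x.
Proof. by rewrite -[a *: x]addr0 D_lin lin0 !addr0. Qed.

Lemma lin_sum (I : Type) (r : seq I) (P : pred I) (F : I -> V) :
  D (\sum_(i <- r | P i) F i) = \sum_(i <- r | P i) D (F i).
Proof. by apply: (big_morph D) => [y t|]; [exact: linD | exact: lin0]. Qed.

End LinearMap.

Section Eigenvectors.
Variables (K : fieldType) (V : lmodType K) (D : V -> V).
Hypothesis D_lin : forall a x y, D (a *: x + y) = a *: D x + D y.

(** If [D] has eigenvalue [mu] on the sum and [n] on one term, then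
    [(D - n) / (mu - n)] fixes the sum and kills that term, so that induction
    on the number of terms applies. *)
Lemma eigen_sum_eq0 (I : Type) (r : seq I) (P : pred I) (n : I -> K)
    (v : I -> V) mu y :
  D y = mu *: y -> y = \sum_(i <- r | P i) v i ->
  (forall i, P i -> D (v i) = n i *: v i) -> (forall i, P i -> n i != mu) ->
  y = 0.
Proof.
elim: r v y => [|i r IH] v y hy hs hv hn; first by rewrite hs big_nil.
case: (boolP (P i)) hs => hi; rewrite big_cons ?hi ?(negbTE hi) => hs; last exact: (IH v).
have d0 : mu - n i != 0 by rewrite subr_eq0 eq_sym hn.
apply: (IH (fun j => ((n j - n i) / (mu - n i)) *: v j)) => // [|j hj]; last first.
  by rewrite (linZ D_lin) hv // !scalerA mulrC.
transitivity ((mu - n i)^-1 *: (D y - n i *: y)).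
  by rewrite hy -scalerBl scalerA mulVf // scale1r.
rewrite hs (linD D_lin) (lin_sum D_lin) hv // [n i *: (_ + _)]scalerDr opprD addrACA subrr add0r.
rewrite scaler_sumr -sumrB scaler_sumr; apply: eq_bigr => j hj.
by rewrite hv // -scalerBl scalerA mulrC.
Qed.

Lemma eigen_proj (I : Type) (r : seq I) (P : pred I) (n : I -> K)
    (v : I -> V) mu x :
  D x = mu *: x -> x = \sum_(i <- r | P i) v i ->
  (forall i, P i -> D (v i) = n i *: v i) ->
  x = \sum_(i <- r | P i && (n i == mu)) v i.
Proof.
move=> hx hs hv; apply/eqP; rewrite -subr_eq0; apply/eqP.
apply: (@eigen_sum_eq0 I r (fun i => P i && (n i != mu)) n v mu).
- rewrite -scaleN1r addrC D_lin hx scalerDr (lin_sum D_lin); congr (_ + _).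
  rewrite [RHS]scalerA mulrC -scalerA; congr (_ *: _); rewrite scaler_sumr.
  by apply: eq_bigr => i /andP[hi /eqP <-]; rewrite hv.
- by rewrite {1}hs (bigID (fun i => n i == mu)) /= addrAC subrr add0r.
- by move=> i /andP[hi _]; apply: hv.
- by move=> i /andP[].
Qed.

End Eigenvectors.

(** * The sl2-triple *)

Section BrScale.
Variables (K : nzRingType) (A : algType K).
Implicit Types (x y : A) (k : K).

Lemma brZr k x y : br x (k *: y) = k *: br x y.
Proof. by rewrite /br -scalerAl -scalerAr scalerBr. Qed.

Lemma brZl k x y : br (k *: x) y = k *: br x y.
Proof. by rewrite /br -scalerAl -scalerAr scalerBr. Qed.

Lemma br0_comm x y : x * y = y * x -> br x y = 0.
Proof. by rewrite /br => ->; rewrite subrr. Qed.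

End BrScale.

Section Sl2.
Variables (K : numClosedFieldType) (A : algType K).

(** The relations of the rational Cherednik algebra of a dihedral group in the
    letters [z], [w]: [G] is the image of the group and [S n] stands for
    [refl_sum n]. The commutator of a derivative with a coordinate is the only
    place where the parameters enter. *)
Record cherednik_rel (z w : bool -> A) (S : int -> A) (G : set A) : Prop :=
 CherednikRel {
  zC : forall e e', z e * z e' = z e' * z e;
  wC : forall e e', w e * w e' = w e' * w e;
  br_wz : forall e e', br (w e) (z e') = if e == e' then 1 - S 0 else S (sg e);
  Sz : forall n e, S n * z e = z (~~ e) * S (n + sg (~~ e));
  Sw : forall n e, S n * w e = w (~~ e) * S (n + sg e);
  SG : forall n, span G (S n);
  G1 : G 1;
  GM : forall g h, G g -> G h -> G (g * h);
  Gzw : forall g, G g -> exists (b : bool) (a : bool -> K),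
    [/\ a true * a false = 1,
        forall e, g * z e = a e *: (z (e (+) b) * g) &
        forall e, g * w e = a (~~ e) *: (w (e (+) b) * g)];
  word_ind : forall P : set A, subspace P -> P 1 ->
    (forall e x, P x -> P (z e * x)) -> (forall e x, P x -> P (w e * x)) ->
    (forall g x, G g -> P x -> P (g * x)) -> forall x, P x
}.

Variables (z w : bool -> A) (S : int -> A) (G : set A).
Hypothesis D : cherednik_rel z w S G.

Definition E_plus : A := 2^-1 *: (z true * z false).
Definition E_minus : A := (- 2) *: (w true * w false).
Definition H_grad : A := z true * w true + z false * w false + 1 - S 0.
Definition Z_rot : A := z false * w false - z true * w true.
Implicit Types (x y : A) (e : bool).

Lemma Ep_z e : E_plus = 2^-1 *: (z e * z (~~ e)).
Proof. by rewrite /E_plus; case: e; last rewrite (zC D). Qed.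

Lemma Em_w e : E_minus = (- 2) *: (w e * w (~~ e)).
Proof. by rewrite /E_minus; case: e; last rewrite (wC D). Qed.

Lemma br_z e e' : br (z e) (z e') = 0.
Proof. exact/br0_comm/(zC D). Qed.

Lemma br_w e e' : br (w e) (w e') = 0.
Proof. exact/br0_comm/(wC D). Qed.

Lemma br_Ep_z e : br E_plus (z e) = 0.
Proof. by rewrite (Ep_z e) brZl brMl !br_z mulr0 mul0r addr0 scaler0. Qed.

Lemma br_Em_w e : br E_minus (w e) = 0.
Proof. by rewrite (Em_w e) brZl brMl !br_w mulr0 mul0r addr0 scaler0. Qed.

(** The two sums of reflections produced by the Leibniz rule cancel; this is why
    the deformed Laplacian still differentiates coordinates as at [c = 0]. *)
Lemma br_Em_z e : br E_minus (z e) = (- 2) *: w (~~ e).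
Proof.
rewrite (Em_w e) brZl brMl !(br_wz D) // eqxx; congr (_ *: _).
have -> : (~~ e == e) = false by case: e.
by rewrite mulrBl mul1r (Sw D) negbK add0r addrCA subrr addr0.
Qed.

Lemma br_Ep_w e : br E_plus (w e) = (- 2^-1) *: z (~~ e).
Proof.
rewrite brN (Ep_z e) brZr brMr !(br_wz D) // eqxx.
have -> : (e == ~~ e) = false by case: e.
rewrite mulrBl mul1r (Sz D) negbK add0r.
by rewrite addrNK scaleNr.
Qed.

Lemma br_Ep_G g : G g -> br E_plus g = 0.
Proof.
move=> /(Gzw D) [b [a [ha hz _]]]; apply: br0_comm; symmetry.
rewrite /E_plus -scalerAr -scalerAl; congr (_ *: _).
rewrite mulrA hz -scalerAl -mulrA hz -scalerAr scalerA ha scale1r mulrA.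
by rewrite addTb addFb; congr (_ * _); case: b {hz}; rewrite // (zC D).
Qed.

Lemma br_Em_G g : G g -> br E_minus g = 0.
Proof.
move=> /(Gzw D) [b [a [ha _ hw]]]; apply: br0_comm; symmetry.
rewrite /E_minus -scalerAr -scalerAl; congr (_ *: _).
rewrite mulrA hw -scalerAl -mulrA hw -scalerAr scalerA mulrC ha scale1r mulrA.
by rewrite addTb addFb; congr (_ * _); case: b {hw}; rewrite // (wC D).
Qed.

Lemma subspace_br0 x : subspace [set y | br x y = 0].
Proof.
split=> [|k y t /= hy ht]; first by rewrite /= br0r.
by rewrite brDr brZr hy ht scaler0 addr0.
Qed.

Lemma br_S x n : (forall g, G g -> br x g = 0) -> br x (S n) = 0.
Proof. by move=> h; apply: (span_min (subspace_br0 x) h) (SG D n). Qed.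

Lemma br_Ep_Em : br E_plus E_minus = H_grad.
Proof.
rewrite /E_minus brZr brMr !br_Ep_w /= -scalerAl -scalerAr -scalerDr scalerA.
rewrite mulrNN divff ?pnatr_eq0 // scale1r.
rewrite [w true * _]brE (br_wz D) addrC /H_grad /=.
by rewrite addrAC addrA.
Qed.

(** The Jacobi identity for [br_Ep_Em] avoids sums of reflections. *)
Lemma br_H_z e : br H_grad (z e) = z e.
Proof.
rewrite -br_Ep_Em jacobi br_Ep_z br_Em_z br0r subr0.
by rewrite brZr br_Ep_w negbK scalerA mulrNN divff ?pnatr_eq0 // scale1r.
Qed.

Lemma br_H_w e : br H_grad (w e) = - w e.
Proof.
rewrite -br_Ep_Em jacobi br_Em_w br_Ep_w br0r sub0r.
by rewrite brZr br_Em_z negbK scalerA mulrNN mulVf ?pnatr_eq0 // scale1r.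
Qed.

Lemma br_H0 x : br E_plus x = 0 -> br E_minus x = 0 -> br H_grad x = 0.
Proof. by move=> h1 h2; rewrite -br_Ep_Em jacobi h1 h2 !br0r subrr. Qed.

Lemma br_H_G g : G g -> br H_grad g = 0.
Proof. by move=> h; rewrite br_H0 ?br_Ep_G ?br_Em_G. Qed.

Lemma br_H_Ep : br H_grad E_plus = 2 *: E_plus.
Proof. by rewrite /E_plus brZr brMr !br_H_z -mulr2n scaler_nat scalerMnr. Qed.

Lemma br_H_Em : br H_grad E_minus = - 2 *: E_minus.
Proof.
rewrite [in RHS]scaleNr scaler_nat /E_minus brZr brMr !br_H_w.
by rewrite mulNr mulrN -opprD -mulr2n scalerN scalerMnr.
Qed.

Lemma br_Ep_Zrot : br E_plus Z_rot = 0.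
Proof.
rewrite /Z_rot brBr !brMr !br_Ep_z !mul0r !add0r !br_Ep_w -!scalerAr /=.
by rewrite (zC D) subrr.
Qed.

Lemma br_Em_Zrot : br E_minus Z_rot = 0.
Proof.
rewrite /Z_rot brBr !brMr !br_Em_w !mulr0 !addr0 !br_Em_z -!scalerAl /=.
by rewrite (wC D) subrr.
Qed.

Variable eps : K.
Definition Zdef : A := Z_rot + eps *: S 0.

Lemma br_Ep_Zdef : br E_plus Zdef = 0.
Proof.
by rewrite brDr br_Ep_Zrot brZr br_S ?scaler0 ?addr0 //; exact: br_Ep_G.
Qed.

Lemma br_Em_Zdef : br E_minus Zdef = 0.
Proof.
by rewrite brDr br_Em_Zrot brZr br_S ?scaler0 ?addr0 //; exact: br_Em_G.
Qed.

End Sl2.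

(** * Filtration by word length *)

Section Filtration.
Variables (K : numClosedFieldType) (A : algType K).
Variables (z w : bool -> A) (S : int -> A) (G : set A).
Hypothesis D : cherednik_rel z w S G.
Implicit Types (x y : A) (e : bool).

(** Products of at most [n] letters, with coefficients in the group algebra on
    the right. Up to shorter products the letters commute. *)
Fixpoint filt (n : nat) : set A :=
  if n is n'.+1 then
    span [set x | filt n' x \/ exists e y, filt n' y /\ (x = z e * y \/ x = w e * y)]
  else span G.

Arguments filt : simpl never.

Lemma filt_subspace n : subspace (filt n).
Proof. by case: n => [|n]; apply: span_subspace. Qed.

Lemma filtS n x : filt n x -> filt n.+1 x.
Proof. by move=> hx; apply: sub_span; left. Qed.

Lemma filt_le n p x : (n <= p)%N -> filt n x -> filt p x.
Proof.
move=> /subnK <-; elim: (p - n)%N => // k IH hx.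
by rewrite addSn; apply/filtS/IH.
Qed.

Lemma filt_z n e x : filt n x -> filt n.+1 (z e * x).
Proof. by move=> hx; apply: sub_span; right; exists e, x; split=> //; left. Qed.

Lemma filt_w n e x : filt n x -> filt n.+1 (w e * x).
Proof. by move=> hx; apply: sub_span; right; exists e, x; split=> //; right. Qed.

Lemma filt_zX n a e x : filt n x -> filt (a + n) (z e ^+ a * x).
Proof.
move=> hx; elim: a => [|a IH]; first by rewrite expr0 mul1r.
by rewrite exprS -mulrA; apply: filt_z.
Qed.

Lemma filt_wX n a e x : filt n x -> filt (a + n) (w e ^+ a * x).
Proof.
move=> hx; elim: a => [|a IH]; first by rewrite expr0 mul1r.
by rewrite exprS -mulrA; apply: filt_w.
Qed.

Lemma subspace_mul (W : set A) y : subspace W -> subspace [set x | W (y * x)].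
Proof.
move=> hW; split=> [|k x t /= hx ht]; first by rewrite /= mulr0; case: hW.
by rewrite mulrDr -scalerAr; apply: hW.2.
Qed.

Lemma subspace_mulr (W : set A) y : subspace W -> subspace [set x | W (x * y)].
Proof.
move=> hW; split=> [|k x t /= hx ht]; first by rewrite /= mul0r; case: hW.
by rewrite mulrDl -scalerAl; apply: hW.2.
Qed.

Lemma filt_G n g x : G g -> filt n x -> filt n (g * x).
Proof.
move=> hg; elim: n x => [|n IH] x.
  apply: (span_min (subspace_mul g (filt_subspace 0))) => h hh.
  by apply: sub_span; apply: (GM D).
apply: (span_min (subspace_mul g (filt_subspace n.+1))) => {}x.
have [b [a [_ hz hw]]] := Gzw D hg.
case=> [hx|[e [y [hy [->|->]]]]] /=; first exact/filtS/IH.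
- rewrite mulrA hz -scalerAl -mulrA; apply: (subspaceZ _ (filt_subspace _)).
  exact/filt_z/IH.
- rewrite mulrA hw -scalerAl -mulrA; apply: (subspaceZ _ (filt_subspace _)).
  exact/filt_w/IH.
Qed.

Lemma filt_S n k x : filt n x -> filt n (S k * x).
Proof.
move=> hx; apply: (span_min (subspace_mulr x (filt_subspace n))) (SG D k) => g hg.
exact: filt_G.
Qed.

Lemma filt_br n e e' x : filt n x -> filt n (w e * (z e' * x) - z e' * (w e * x)).
Proof.
move=> hx; rewrite !mulrA -mulrBl -br_def (br_wz D); case: eqP => _.
  rewrite mulrBl mul1r; apply: subspaceB => //; first exact: filt_subspace.
  exact: filt_S.
exact: filt_S.
Qed.

Lemma filt_all x : exists n, filt n x.
Proof.
move: x; apply: (word_ind D) => [| |e x [n hn]|e x [n hn]|g x hg [n hn]].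
- split=> [|k x y [n hn] [p hp]]; first by exists 0%N; case: (filt_subspace 0).
  exists (n + p)%N; apply: (filt_subspace _).2.
    by apply: filt_le hn; rewrite leq_addr.
  by apply: filt_le hp; rewrite leq_addl.
- by exists 0%N; apply: sub_span; apply: (G1 D).
- by exists n.+1; apply: filt_z.
- by exists n.+1; apply: filt_w.
- by exists n; apply: filt_G.
Qed.

Lemma filt_w_zX n a e e' y : filt n y ->
  filt (a + n) (w e * (z e' ^+ a * y) - z e' ^+ a * (w e * y)).
Proof.
move=> hy; elim: a => [|a IH].
  by rewrite expr0 !mul1r subrr; case: (filt_subspace n).
rewrite exprS -!mulrA.
have -> : w e * (z e' * (z e' ^+ a * y)) - z e' * (z e' ^+ a * (w e * y)) =
  (w e * (z e' * (z e' ^+ a * y)) - z e' * (w e * (z e' ^+ a * y))) +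
  z e' * (w e * (z e' ^+ a * y) - z e' ^+ a * (w e * y)).
  by rewrite mulrBr addrA subrK.
apply: subspaceD; first exact: filt_subspace.
  by apply/filtS/filt_br/filt_zX.
exact: filt_z.
Qed.

Lemma filt_wX_z n a e e' y : filt n y ->
  filt (a + n) (w e ^+ a * (z e' * y) - z e' * (w e ^+ a * y)).
Proof.
move=> hy; elim: a => [|a IH].
  by rewrite expr0 !mul1r subrr; case: (filt_subspace n).
rewrite exprS -!mulrA.
have -> : w e * (w e ^+ a * (z e' * y)) - z e' * (w e * (w e ^+ a * y)) =
  w e * (w e ^+ a * (z e' * y) - z e' * (w e ^+ a * y)) +
  (w e * (z e' * (w e ^+ a * y)) - z e' * (w e * (w e ^+ a * y))).
  by rewrite mulrBr addrA subrK.
apply: subspaceD; first exact: filt_subspace.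
  exact: filt_w.
by apply/filtS/filt_br/filt_wX.
Qed.

Definition ordered_word (a b c d : nat) (g : A) : A :=
  z true ^+ a * (z false ^+ b * (w true ^+ c * (w false ^+ d * g))).

Lemma filt_G0 g : G g -> filt 0 g. Proof. exact: sub_span. Qed.

Lemma filt_word a b c d g : G g -> filt (a + (b + (c + d))) (ordered_word a b c d g).
Proof.
move=> hg; do 2!apply: filt_zX; apply: filt_wX.
by have := filt_wX d false (filt_G0 hg); rewrite addn0.
Qed.

(** Normal ordering, by induction on the length: the letter in front is moved
    to its place and the commutators are shorter. *)
Lemma filt_sub_words n x : filt n x ->
  span [set t | exists a b c d g,
    [/\ G g, (a + (b + (c + d)) <= n)%N & t = ordered_word a b c d g]] x.
Proof.
elim: n x => [|n IH] x.
  apply: span_min; first exact: span_subspace.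
  move=> g hg; apply: sub_span; exists 0%N, 0%N, 0%N, 0%N, g.
  by rewrite /ordered_word !expr0 !mul1r.
have up : forall y, filt n y ->
    span [set t | exists a b c d g,
      [/\ G g, (a + (b + (c + d)) <= n.+1)%N & t = ordered_word a b c d g]] y.
  move=> y /IH; apply: span_min; first exact: span_subspace.
  move=> t [a [b [c [d [g [hg hl ->]]]]]]; apply: sub_span.
  by exists a, b, c, d, g; split=> //; apply: leqW.
apply: span_min; first exact: span_subspace.
move=> t [/up //|[e [y [/IH hy E]]]].
have Wsp := span_subspace [set t | exists a b c d g,
      [/\ G g, (a + (b + (c + d)) <= n.+1)%N & t = ordered_word a b c d g]].
case: E => ->.
  apply: (span_min (subspace_mul (z e) Wsp) _ hy) => {y hy}t' /= [a [b [c [d [g [hg hl ->]]]]]].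
  apply: sub_span; case: e.
    by exists a.+1, b, c, d, g; split=> //; rewrite /ordered_word exprS -!mulrA.
  exists a, b.+1, c, d, g; split=> //; first by rewrite addSn addnS ltnS.
  rewrite /ordered_word exprS -mulrA !mulrA; congr (_ * _ * _ * _ * _).
  by apply: commrX; apply: (zC D).
apply: (span_min (subspace_mul (w e) Wsp) _ hy) => {y hy}t' /= [a [b [c [d [g [hg hl ->]]]]]].
pose y := w true ^+ c * (w false ^+ d * g).
have hy : filt (c + d) y.
  by apply: filt_wX; have := filt_wX d false (filt_G0 hg); rewrite addn0.
have -> : w e * ordered_word a b c d g =
    (w e * (z true ^+ a * (z false ^+ b * y)) - z true ^+ a * (w e * (z false ^+ b * y)))
  + (z true ^+ a * (w e * (z false ^+ b * y) - z false ^+ b * (w e * y))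
  + z true ^+ a * (z false ^+ b * (w e * y))).
  by rewrite mulrBr subrK subrK.
apply: subspaceD => //.
  by apply: up; apply: filt_le hl _; apply: filt_w_zX; apply: filt_zX.
apply: subspaceD => //.
  by apply: up; apply: filt_le hl _; apply: filt_zX; apply: filt_w_zX.
apply: sub_span; case: e.
  exists a, b, c.+1, d, g; split=> //; first by rewrite addSn !addnS ltnS.
  by rewrite /ordered_word /y exprS -!mulrA.
exists a, b, c, d.+1, g; split=> //; first by rewrite !addnS ltnS.
rewrite /ordered_word /y exprS !mulrA; congr (_ * _ * _); rewrite -!mulrA; do 2!congr (_ * _).
by apply: commrX; apply: (wC D).
Qed.

End Filtration.

(** * The centraliser of sl2 *)

Section WeightZeroElements.
Variables (K : numClosedFieldType) (A : algType K).
Variables (z w : bool -> A) (S : int -> A) (G : set A).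
Hypothesis D : cherednik_rel z w S G.
Local Notation Ep := (E_plus z).
Local Notation Hg := (H_grad z w S).
Local Notation Zrot := (Z_rot z w).
Local Notation word := (ordered_word z w).
Local Notation filt := (filt z w G).
Implicit Types (x y : A) (e : bool).

Lemma br_H_zM k e x : br Hg x = k *: x -> br Hg (z e * x) = (1 + k) *: (z e * x).
Proof.
by move=> hx; rewrite brMr hx (br_H_z D) -scalerAr scalerDl scale1r.
Qed.

Lemma br_H_wM k e x : br Hg x = k *: x -> br Hg (w e * x) = (k - 1) *: (w e * x).
Proof.
by move=> hx; rewrite brMr hx (br_H_w D) -scalerAr scalerDl scaleN1r mulNr addrC.
Qed.

Lemma br_H_zX k a e x : br Hg x = k *: x ->
  br Hg (z e ^+ a * x) = (a%:R + k) *: (z e ^+ a * x).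
Proof.
move=> hx; elim: a => [|a IH]; first by rewrite expr0 !mul1r add0r.
by rewrite exprS -mulrA (br_H_zM _ IH) addrA nat1r.
Qed.

Lemma br_H_wX k a e x : br Hg x = k *: x ->
  br Hg (w e ^+ a * x) = (k - a%:R) *: (w e ^+ a * x).
Proof.
move=> hx; elim: a => [|a IH]; first by rewrite expr0 !mul1r subr0.
by rewrite exprS -mulrA (br_H_wM _ IH) -addrA -opprD natr1.
Qed.

Lemma br_H_word a b c d g : G g ->
  br Hg (word a b c d g) = ((a + b)%:R - (c + d)%:R) *: word a b c d g.
Proof.
move=> hg; have h0 : br Hg g = 0 *: g by rewrite scale0r (br_H_G D).
rewrite /ordered_word (br_H_zX _ _ (br_H_zX _ _ (br_H_wX _ _ (br_H_wX _ _ h0)))).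
by congr (_ *: _); rewrite !natrD; ring.
Qed.

(** To leading order [ad E_plus] acts on words as the derivation sending [w e] to
    [- z (~~ e) / 2]. *)
Lemma filt_br_wX n e k y : filt k y ->
  filt (n + k).-1 (br Ep (w e ^+ n) * y + (n%:R / 2) *: (z (~~ e) * (w e ^+ n.-1 * y))).
Proof.
move=> hy; case: n => [|n].
  rewrite mul0r scale0r addr0 expr0 br_def mulr1 mul1r subrr mul0r.
  by case: (filt_subspace z w G (0 + k).-1).
rewrite addSn /=; elim: n => [|n IH].
  rewrite expr1 (br_Ep_w D) expr0 mul1r -scalerAl -scalerDl mul1r addNr scale0r.
  by case: (filt_subspace z w G (0 + k)).
rewrite [w e ^+ n.+2]exprS brMr (br_Ep_w D) mulrDl.
set P := br Ep _ in IH *; set q := z (~~ e) * (w e ^+ n * y) in IH.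
have -> : - 2^-1 *: z (~~ e) * w e ^+ n.+1 * y + w e * P * y +
    (n.+2%:R / 2) *: (z (~~ e) * (w e ^+ n.+1 * y)) =
   w e * (P * y + (n.+1%:R / 2) *: q) +
   (n.+1%:R / 2) *: - (w e * (z (~~ e) * (w e ^+ n * y)) - z (~~ e) * (w e * (w e ^+ n * y))).
  have e1 : - 2^-1 *: z (~~ e) * w e ^+ n.+1 * y = - 2^-1 *: (z (~~ e) * (w e ^+ n.+1 * y)).
    by rewrite -!scalerAl mulrA.
  have e2 : z (~~ e) * (w e * (w e ^+ n * y)) = z (~~ e) * (w e ^+ n.+1 * y).
    by rewrite exprS !mulrA.
  rewrite e1 e2 -[w e * P * y]mulrA -/q opprB scalerBr mulrDr -scalerAr.
  rewrite -[RHS]addrA [X in _ = _ + X]addrC subrK [LHS]addrAC -scalerDl addrC.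
  congr (_ + _ *: _).
  by rewrite -(natr1 n.+1); field.
rewrite addSn; apply: subspaceD; first exact: filt_subspace.
  exact: filt_w.
apply: subspaceZ; first exact: filt_subspace.
apply: subspaceN; first exact: filt_subspace.
by apply/filtS/(filt_br D)/filt_wX.
Qed.

Lemma br_mul0 x y t : br x y = 0 -> br x (y * t) = y * br x t.
Proof. by move=> h; rewrite brMr h mul0r add0r. Qed.

Lemma br_Ep_zX a e : br Ep (z e ^+ a) = 0.
Proof.
elim: a => [|a IH]; first by rewrite expr0 br_def mulr1 mul1r subrr.
by rewrite exprS br_mul0 ?(br_Ep_z D) // IH mulr0.
Qed.

Lemma filt_br_word a b c d g : G g ->
  filt (a + (b + (c + d))).-1
    (br Ep (word a b c d g) + 2^-1 *: (c%:R *: word a b.+1 c.-1 d g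
                                      + d%:R *: word a.+1 b c d.-1 g)).
Proof.
move=> hg; have fS n := filt_subspace z w G n.
have [cd0|cd0] := posnP (c + d)%N.
  have [-> ->] : c = 0%N /\ d = 0%N by lia.
  rewrite !scale0r addr0 scaler0 addr0 /ordered_word !expr0 !mul1r.
  rewrite !br_mul0 ?br_Ep_zX // (br_Ep_G D hg) !mulr0.
  by case: (fS (a + (b + (0 + 0))).-1).
pose y := w false ^+ d * g.
have hy : filt d y by have := filt_wX d false (filt_G0 z w hg); rewrite addn0.
have h1 := filt_br_wX c true hy.
have h2 : filt (c + d).-1 (w true ^+ c * (br Ep (w false ^+ d) * g
     + (d%:R / 2) *: (z true * (w false ^+ d.-1 * g)))).
  have [-> |d0] := posnP d.
    rewrite mul0r scale0r addr0 expr0 br_def mulr1 mul1r subrr mul0r mulr0.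
    by case: (fS (c + 0).-1).
  have -> : (c + d).-1 = (c + d.-1)%N by lia.
  by apply: filt_wX; have := filt_br_wX d false (filt_G0 z w hg); rewrite addn0.
have h3 : filt (c + d).-1 ((d%:R / 2) *: (w true ^+ c * (z true * (w false ^+ d.-1 * g))
     - z true * (w true ^+ c * (w false ^+ d.-1 * g)))).
  have [-> |d0] := posnP d; first by rewrite mul0r scale0r; case: (fS (c + 0).-1).
  apply: subspaceZ => //.
  have -> : (c + d).-1 = (c + d.-1)%N by lia.
  by apply: (filt_wX_z D); have := filt_wX d.-1 false (filt_G0 z w hg); rewrite addn0.
have -> : (a + (b + (c + d))).-1 = (a + (b + (c + d).-1))%N by lia.
have -> : br Ep (word a b c d g) + 2^-1 *: (c%:R *: word a b.+1 c.-1 d g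
   + d%:R *: word a.+1 b c d.-1 g) =
   z true ^+ a * (z false ^+ b * (
   (br Ep (w true ^+ c) * y + (c%:R / 2) *: (z false * (w true ^+ c.-1 * y)))
  + (w true ^+ c * (br Ep (w false ^+ d) * g
     + (d%:R / 2) *: (z true * (w false ^+ d.-1 * g)))
    - (d%:R / 2) *: (w true ^+ c * (z true * (w false ^+ d.-1 * g))
     - z true * (w true ^+ c * (w false ^+ d.-1 * g)))))).
  have -> : word a b.+1 c.-1 d g = z true ^+ a * (z false ^+ b * (z false * (w true ^+ c.-1 * y))).
    by rewrite /ordered_word exprSr -!mulrA.
  have -> : word a.+1 b c d.-1 g = z true ^+ a * (z false ^+ b * (z true * (w true ^+ c * (w false ^+ d.-1 * g)))).
    rewrite /ordered_word exprSr -!mulrA; congr (_ * _); rewrite !mulrA; do 3!congr (_ * _).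
    by apply: commrX; apply: (zC D).
  rewrite /ordered_word -/y (br_mul0 _ (br_Ep_zX a true)) (br_mul0 _ (br_Ep_zX b false)) [br Ep (_ * y)]brMr [br Ep y]brMr (br_Ep_G D hg) mulr0 addr0.
  set p := w true ^+ c * (z true * _); set q := z true * (w true ^+ c * _).
  rewrite [w true ^+ c * (_ + _)]mulrDr -scalerAr -/p [_ *: (p - q)]scalerBr opprB.
  rewrite -[_ + _ *: p + _]addrA [_ *: p + _]addrC subrK.
  have push k x : k *: (z true ^+ a * (z false ^+ b * x)) = z true ^+ a * (z false ^+ b * (k *: x)).
    by rewrite -!scalerAr.
  rewrite scalerDr !scalerA !push -!mulrDr; do 2!congr (_ * _).
  by rewrite addrACA ![2^-1 * _]mulrC.
by do 2!apply: filt_zX; apply: subspaceD => //; apply: subspaceB.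
Qed.

Lemma br_H_Zrot : br Hg Zrot = 0.
Proof. by apply: (br_H0 D); [exact: (br_Ep_Zrot D) | exact: (br_Em_Zrot D)]. Qed.

Definition rot_alg : set A := span [set x | exists n g, G g /\ x = Zrot ^+ n * g].

(** The ad-sl2 module generated by [y] of weight -2 should not meet the
    invariants; the elements below are the candidates for the weight-zero part
    of the algebra. *)
Definition rot_modEp : set A := [set x | exists b y,
  [/\ rot_alg b, br Hg y = (- 2) *: y & x = b + br Ep y]].

Local Notation Q := rot_modEp.

Lemma rot_modEp_subspace : subspace Q.
Proof.
split.
  exists 0, 0; split; first by case: (span_subspace [set x | exists n g, G g /\ x = Zrot ^+ n * g]).
    by rewrite br0r scaler0.
  by rewrite br0r addr0.
move=> k x x' [b [y [hb hy ->]]] [b' [y' [hb' hy' ->]]].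
exists (k *: b + b'), (k *: y + y'); split.
- exact: (span_subspace _).2.
- by rewrite brDr brZr hy hy' scalerDr !scalerA mulrC.
- by rewrite scalerDr brDr brZr addrACA.
Qed.

Lemma rot_modEp_Zrot x : Q x -> Q (Zrot * x).
Proof.
move=> [b [y [hb hy ->]]]; exists (Zrot * b), (Zrot * y); split.
- apply: (span_min (subspace_mul Zrot (span_subspace _)) _ hb) => t [n [g [hg ->]]].
  by apply: sub_span; exists n.+1, g; rewrite mulrA -exprS.
- by rewrite (br_mul0 _ br_H_Zrot) hy scalerAr.
- by rewrite mulrDr (br_mul0 _ (br_Ep_Zrot D)).
Qed.

Section Step.
Variables (n : nat) (g : A).
Hypothesis hg : G g.
Hypothesis IH : forall x, filt n x -> br Hg x = 0 -> Q x.

Lemma br_H_word0 a b c d : (a + b = c + d)%N -> br Hg (word a b c d g) = 0.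
Proof. by move=> h; rewrite br_H_word // h subrr scale0r. Qed.

(** Modulo shorter words, [ad E_plus] of a word of weight -2 gives a linear
    relation between two neighbouring words of weight zero. These relations
    connect [(a, b, c, d)] to [(a + 1, b - 1, c + 1, d - 1)]. *)
Lemma word_rel a b c d : (a + b + 2 = c + d)%N -> (a + (b + (c + d)) = n.+1)%N ->
  Q (c%:R *: word a b.+1 c.-1 d g + d%:R *: word a.+1 b c d.-1 g).
Proof.
move=> h1 h2; have hf := filt_br_word a b c d hg.
have hy : br Hg (word a b c d g) = (-2) *: word a b c d g.
  by rewrite br_H_word //; congr (_ *: _); rewrite -h1 !natrD; ring.
have hEp : br Hg (br Ep (word a b c d g)) = 0.
  have := jacobi Hg Ep (word a b c d g); rewrite (br_H_Ep D) brZl hy brZr => h.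
  by rewrite -[LHS](subrK (-2 *: br Ep (word a b c d g))) -h -scalerDl subrr scale0r.
set t := c%:R *: _ + _ in hf *.
have ht : br Hg t = 0.
  rewrite /t brDr !brZr.
  have -> : c%:R *: br Hg (word a b.+1 c.-1 d g) = 0.
    case: (posnP c) => [->|c0]; first by rewrite scale0r.
    by rewrite br_H_word0 ?scaler0 //; lia.
  case: (posnP d) => [->|d0]; first by rewrite scale0r addr0.
  by rewrite br_H_word0 ?scaler0 ?addr0 //; lia.
have hQ : Q (br Ep (word a b c d g) + 2^-1 *: t).
  apply: IH; first by move: hf; rewrite h2.
  by rewrite brDr hEp brZr ht scaler0 addr0.
have hQ2 : Q (br Ep (word a b c d g)).
  exists 0, (word a b c d g); split; rewrite ?add0r //.
  by case: (span_subspace [set x | exists n g, G g /\ x = Zrot ^+ n * g]).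
have -> : t = 2 *: (br Ep (word a b c d g) + 2^-1 *: t - br Ep (word a b c d g)).
  by rewrite addrAC subrr add0r scalerA divff ?pnatr_eq0 // scale1r.
apply: subspaceZ; first exact: rot_modEp_subspace.
by apply: subspaceB => //; exact: rot_modEp_subspace.
Qed.

Lemma Q_solve k (x y : A) : Q (k *: x + y) -> Q y -> k != 0 -> Q x.
Proof.
move=> h1 h2 k0; have -> : x = k^-1 *: (k *: x + y - y) by rewrite addrK scalerA mulVf // scale1r.
apply: subspaceZ; first exact: rot_modEp_subspace.
by apply: subspaceB => //; exact: rot_modEp_subspace.
Qed.

(** Going down the chain of relations ends at a word with [c = 0], where only one
    of the two terms survives. *)
Lemma word_gt a b c d : (a + b = c + d)%N -> (a + (b + (c + d)) = n.+1)%N ->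
  (c < a)%N -> Q (word a b c d g).
Proof.
have QZ k x : Q x -> Q (k *: x) by apply: subspaceZ; exact: rot_modEp_subspace.
elim: c a b d => [|c IHc] [//|a] b d h1 h2 hlt.
  have := @word_rel a b 0 d.+1; rewrite scale0r add0r /= => h.
  by apply: (@Q_solve d.+1%:R _ 0); rewrite ?addr0 ?pnatr_eq0 //; [apply: h; lia | case: rot_modEp_subspace].
have := @word_rel a b c.+1 d.+1; rewrite /= addrC => h.
apply: (Q_solve (h _ _) _) ; rewrite ?pnatr_eq0 //; try lia.
by apply/QZ/IHc; lia.
Qed.

(** Mirror image of [word_gt]: the chain ends at [d = 0]. *)
Lemma word_lt a b c d : (a + b = c + d)%N -> (a + (b + (c + d)) = n.+1)%N ->
  (d < b)%N -> Q (word a b c d g).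
Proof.
have QZ k x : Q x -> Q (k *: x) by apply: subspaceZ; exact: rot_modEp_subspace.
elim: d a b c => [|d IHd] a [//|b] c h1 h2 hlt.
  have := @word_rel a b c.+1 0; rewrite scale0r addr0 /= => h.
  by apply: (@Q_solve c.+1%:R _ 0); rewrite ?addr0 ?pnatr_eq0 //; [apply: h; lia | case: rot_modEp_subspace].
have := @word_rel a b c.+1 d.+1; rewrite /= => h.
apply: (Q_solve (h _ _) _) ; rewrite ?pnatr_eq0 //; try lia.
by apply/QZ/IHd; lia.
Qed.

(** When [a = c] and [b = d] the chain gives no vanishing term: the words of one
    length are all proportional modulo [rot_modEp]. Multiplication by the
    rotation [Z_rot], which preserves [rot_modEp], raises the length and
    determines the remaining class, the coefficient [s + 2] being nonzero. *)
Lemma word_diag0 s : (s.+1 + s.+1 = n.+1)%N -> Q (word 0 s.+1 0 s.+1 g).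
Proof.
move=> hs; have Qs := rot_modEp_subspace.
set X := word _ _ _ _ _; pose Y := word 1 s 1 s g.
have h1 : Q (X + s.+1%:R *: Y).
  by have := @word_rel 0 s 1 s.+1; rewrite /= scale1r; apply; lia.
have h2 : Q (X - Y).
  pose y := w false ^+ s * g.
  have hy : filt s y by have := filt_wX s false (filt_G0 z w hg); rewrite addn0.
  have hQ : Q (Zrot * word 0 s 0 s g).
    apply/rot_modEp_Zrot/IH; last exact: br_H_word0.
    by apply: (@filt_le _ _ z w G (0 + (s + (0 + s)))); [lia | apply: filt_word].
  pose f := z false * (w false * (z false ^+ s * y) - z false ^+ s * (w false * y))
    - z true * (w true * (z false ^+ s * y) - z false ^+ s * (w true * y)).
  have e : Zrot * word 0 s 0 s g = (X - Y) + f.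
    rewrite /f /X /Y /ordered_word !expr0 !mul1r -/y /Z_rot mulrBl !mulrBr.
    by rewrite !expr1 !exprS !opprB -!mulrA -/y addrCA !subrKA.
  have hf : filt n f.
    have -> : n = (s + s).+1 by lia.
    apply: subspaceB; first exact: filt_subspace.
      by apply/filt_z/(filt_w_zX D).
    by apply/filt_z/(filt_w_zX D).
  have -> : X - Y = Zrot * word 0 s 0 s g - f by rewrite e addrK.
  apply: subspaceB => //; apply: IH => //.
  have -> : f = Zrot * word 0 s 0 s g - (X - Y) by rewrite e addrC addKr.
  by rewrite !brBr (br_mul0 _ br_H_Zrot) !br_H_word0 ?mulr0 ?subrr //; lia.
apply: (@Q_solve s.+2%:R _ 0); rewrite ?addr0 ?pnatr_eq0 //; last by case: Qs.
have -> : s.+2%:R *: X = s.+1%:R *: (X - Y) + (X + s.+1%:R *: Y).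
  by rewrite scalerBr addrCA -addrA [- _ + _]addrC subrr addr0 -natr1 scalerDl scale1r addrC.
by apply: Qs.2.
Qed.

Lemma word_diag a b : (a + b + (a + b) = n.+1)%N -> Q (word a b a b g).
Proof.
have QZ k x : Q x -> Q (k *: x) by apply: subspaceZ; exact: rot_modEp_subspace.
elim: a b => [|a IHa] b hs; first by case: b hs => [//|b] hs; apply: word_diag0.
have := @word_rel a b a.+1 b.+1; rewrite /= addrC => h.
apply: (Q_solve (h _ _) _); rewrite ?pnatr_eq0 //; try lia.
by apply/QZ/IHa; lia.
Qed.

Lemma word_Q a b c d : (a + b = c + d)%N -> (a + (b + (c + d)) = n.+1)%N ->
  Q (word a b c d g).
Proof.
move=> h1 h2; case: (ltngtP c a) => [h|h|e].
- exact: word_gt.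
- by apply: word_lt => //; lia.
- have -> : c = a by []. have -> : d = b by lia.
  by apply: word_diag; lia.
Qed.

End Step.

End WeightZeroElements.

Section CentraliserOfSl2.
Variables (K : numClosedFieldType) (A : algType K).
Variables (z w : bool -> A) (S : int -> A) (G : set A).
Hypothesis D : cherednik_rel z w S G.
Local Notation Ep := (E_plus z).
Local Notation Em := (E_minus w).
Local Notation Hg := (H_grad z w S).
Local Notation word := (ordered_word z w).
Local Notation filt := (filt z w G).
Local Notation Q := (rot_modEp z w S G).
Implicit Types (x y : A) (e : bool).

Lemma br_lin x (a : K) (y t : A) : br x (a *: y + t) = a *: br x y + br x t.
Proof. by rewrite brDr brZr. Qed.

Lemma weight0_rot_modEp n x : filt n x -> br Hg x = 0 -> Q x.
Proof.
elim: n x => [|n IH] x hx hw.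
  exists x, 0; rewrite !br0r scaler0 addr0; split=> //.
  apply: (span_min (span_subspace _) _ hx) => g hg.
  by apply: sub_span; exists 0%N, g; rewrite expr0 mul1r.
have [r [k [v [hv hs]]]] := filt_sub_words D hx.
have /choice [nu hnu] : forall i, exists nu : K, br Hg (v i) = nu *: v i.
  move=> i; have [a [b [c [d [g [hg _ ->]]]]]] := hv i.
  by exists ((a + b)%:R - (c + d)%:R); apply: (br_H_word D).
have hw' : br Hg x = 0 *: x by rewrite hw scale0r.
have h1 i : true -> br Hg (k i *: v i) = nu i *: (k i *: v i).
  by move=> _; rewrite brZr hnu !scalerA mulrC.
rewrite (eigen_proj (br_lin Hg) hw' hs h1).
apply: subspace_sum => [|i /= /eqP hi]; first exact: rot_modEp_subspace.
apply: subspaceZ; first exact: rot_modEp_subspace.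
move: (hnu i) (hi); rewrite hi scale0r.
have [a [b [c [d [g [hg hl ->]]]]]] := hv i => h0 _.
have [hlt|hlt] := ltnP (a + (b + (c + d))) n.+1.
  apply: IH; last first. exact: h0.
  by apply: filt_le (filt_word z w a b c d hg); rewrite -ltnS.
have [->|wn0] := eqVneq (word a b c d g) 0; first by case: (rot_modEp_subspace z w S G).
apply: (word_Q D hg IH); last by apply/eqP; rewrite eqn_leq hl hlt.
move: h0; rewrite (br_H_word D) // => /eqP; rewrite scaler_eq0 (negbTE wn0) orbF.
by rewrite subr_eq0 eqr_nat => /eqP.
Qed.

Lemma iter_br00 x n : iter n (br x) 0 = 0.
Proof. by elim: n => //= n ->; rewrite br0r. Qed.

Lemma iter_br_mono x y n p : (n <= p)%N -> iter n (br x) y = 0 -> iter p (br x) y = 0.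
Proof. by move=> /subnK <- h; rewrite iterD h iter_br00. Qed.

(** [ad E_minus] is a derivation whose square kills the letters [z] and which
    kills [w] and the group. *)
Lemma ad_Em_nilpotent x : exists n, iter n (br Em) x = 0.
Proof.
have skip y t n : br Em y = 0 -> iter n (br Em) (y * t) = y * iter n (br Em) t.
  by move=> h; elim: n => //= n ->; rewrite br_mul0.
move: x; apply: (word_ind D) => [| |e x [n hn]|e x [n hn]|g x hg [n hn]].
- split=> [|k x y [n hn] [p hp]]; first by exists 0%N.
  exists (n + p)%N.
  have -> : iter (n + p) (br Em) (k *: x + y) =
      k *: iter (n + p) (br Em) x + iter (n + p) (br Em) y.
    by elim: (n + p)%N => //= r ->; rewrite br_lin.
  by rewrite (iter_br_mono (leq_addr p n) hn) (iter_br_mono (leq_addl n p) hp) scaler0 addr0.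
- by exists 1%N; rewrite /= br_def mulr1 mul1r subrr.
- exists n.+1.
  have h : br Em (br Em (z e)) = 0 by rewrite (br_Em_z D) brZr (br_Em_w D) scaler0.
  have -> : iter n.+1 (br Em) (z e * x) = z e * iter n.+1 (br Em) x
      + n.+1%:R *: (br Em (z e) * iter n (br Em) x).
    elim: n {hn} => [|n IH]; first by rewrite /= brMr scale1r addrC.
    rewrite [LHS]iterS IH brDr brZr brMr [br Em (br Em (z e) * _)]br_mul0 //.
    rewrite -iterS addrC addrA -[in RHS]natr1 scalerDl scale1r [RHS]addrC.
    by rewrite -!addrA; congr (_ + _); rewrite addrC.
  by rewrite hn mulr0 scaler0 addr0 /= hn br0r mulr0.
- by exists n; rewrite skip ?hn ?mulr0 // (br_Em_w D).
- by exists n; rewrite skip ?hn ?mulr0 // (br_Em_G D).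
Qed.

(** With [v n = ad E_minus ^ n (y)] one gets [br E_plus (v n.+1)] equal to
    [- (n + 1) (n + 2) v n], so the first vanishing [v n], which exists by local
    nilpotency, is [v 0 = y]. *)
Lemma br_Em_Ep_inj y : br Hg y = (- 2) *: y -> br Em (br Ep y) = 0 -> y = 0.
Proof.
move=> hy h0; pose v n := iter n (br Em) y.
have hv n : br Hg (v n) = (- (2 + 2 * n%:R)) *: v n.
  elim: n => [|n IH]; first by rewrite mulr0 addr0.
  have := jacobi Hg Em (v n); rewrite (br_H_Em D) brZl IH brZr /v /= => /eqP.
  rewrite eq_sym subr_eq => /eqP ->; rewrite -scalerDl -natr1; congr (_ *: _); ring.
have rec n : br Ep (v n.+1) = (- (n.+1%:R * n.+2%:R)) *: v n.
  elim: n => [|n IH].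
    have := jacobi Ep Em y; rewrite (br_Ep_Em D) h0 subr0 hy => <-.
    by congr (_ *: _); rewrite mul1r.
  have := jacobi Ep Em (v n.+1); rewrite (br_Ep_Em D) hv IH brZr -/(v n.+2) => /eqP.
  rewrite eq_sym subr_eq => /eqP ->; rewrite -/(v n.+1) -scalerDl.
  by congr (_ *: _); rewrite -(natr1 n.+2) -(natr1 n.+1) -(natr1 n); ring.
have [n hn] := ad_Em_nilpotent y.
have down p : v p.+1 = 0 -> v p = 0.
  move=> hp; have := rec p; rewrite hp br0r => /esym/eqP.
  by rewrite scaler_eq0 oppr_eq0 mulf_eq0 !pnatr_eq0 /= => /eqP.
suff : v 0%N = 0 by [].
by elim: n hn => // n IH /down.
Qed.

(** Write the invariant element as an element of [rot_alg] plus
    [br E_plus y]; the bracket is invariant too, so [y = 0] by [br_Em_Ep_inj]. *)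
Lemma centraliser_rot x : br Ep x = 0 -> br Em x = 0 -> rot_alg z w G x.
Proof.
move=> hp hm; have [n hn] := filt_all D x.
have [b [y [hb hy hx]]] := weight0_rot_modEp hn (br_H0 D hp hm).
suff y0 : y = 0 by rewrite hx y0 br0r addr0.
apply: br_Em_Ep_inj => //.
have -> : br Ep y = x - b by rewrite hx addrC addKr.
rewrite brBr hm sub0r.
suff -> : br Em b = 0 by rewrite oppr0.
apply: (span_min (subspace_br0 Em) _ hb) => t [p [g [hg ->]]] /=.
elim: p => [|p IH]; first by rewrite expr0 mul1r (br_Em_G D).
by rewrite exprS -mulrA br_mul0 ?IH ?mulr0 // (br_Em_Zrot D).
Qed.

End CentraliserOfSl2.

(** * The standard module under sl2 *)

Section StandardModule.
Variables (K : numClosedFieldType) (A : algType K).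
Variables (z w : bool -> A) (S : int -> A) (G : set A).
Variables (M : lmodType K) (act : A -> M -> M) (v : bool -> M) (u : int) (s : int -> K).

(** The standard module on the two-dimensional representation of weight [u]:
    [v true], [v false] are the basis vectors of weights [u] and [- u], and [s]
    gives the action of the twisted reflection sums on them. [std_indep] says
    that the pure powers are independent modulo the multiples of [z zbar]. *)
Record std_rep : Prop := StdRep {
  actDl : forall g h p, act (g + h) p = act g p + act h p;
  actDr : forall h p q, act h (p + q) = act h p + act h q;
  actA : forall g h p, act (g * h) p = act g (act h p);
  act1 : forall p, act 1 p = p;
  actZl : forall k h p, act (k *: h) p = k *: act h p;
  act_wv : forall e t, act (w e) (v t) = 0;
  act_Sv : forall n t, act (S n) (v t) = s (n + if t then u else - u) *: v (~~ t);
  s_even : forall n, s (- n) = s n;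
  s_u : s u = 0;
  act_Gv : forall g, G g -> exists (b : bool) (a a' : bool -> K),
    (forall e, g * z e = a e *: (z (e (+) b) * g)) /\
    (forall t, act g (v t) = a' t *: v (t (+) b));
  std_gen : forall p, exists h : bool -> A, p = act (h true) (v true) + act (h false) (v false);
  std_indep : forall k (a : bool -> bool -> K) q, (0 < k)%N ->
    \sum_(e : bool) \sum_(t : bool) a e t *: act (z e ^+ k) (v t) = act (E_plus z) q ->
    forall e t, a e t = 0
}.

Hypothesis D : cherednik_rel z w S G.
Hypothesis T : std_rep.
Local Notation Ep := (E_plus z).
Local Notation Em := (E_minus w).
Local Notation Hg := (H_grad z w S).
Implicit Types (h x y : A) (p q : M) (e t : bool).

Lemma actZr k h p : act h (k *: p) = k *: act h p.
Proof.
by rewrite -[p in LHS](act1 T) -(actZl T) -(actA T) -scalerAr mulr1 (actZl T).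
Qed.

Lemma act_lin h (k : K) p q : act h (k *: p + q) = k *: act h p + act h q.
Proof. by rewrite (actDr T) actZr. Qed.

Lemma act0r h : act h 0 = 0. Proof. exact: lin0 (act_lin h). Qed.
Lemma act0l p : act 0 p = 0.
Proof. by rewrite -(scale0r (1 : A)) (actZl T) scale0r. Qed.
Lemma actNl h p : act (- h) p = - act h p.
Proof. by rewrite -[- h]scaleN1r (actZl T) scaleN1r. Qed.
Lemma actBl g h p : act (g - h) p = act g p - act h p.
Proof. by rewrite (actDl T) actNl. Qed.
Lemma actNr h p : act h (- p) = - act h p.
Proof. by rewrite -[- p]scaleN1r actZr scaleN1r. Qed.
Lemma actBr h p q : act h (p - q) = act h p - act h q.
Proof. by rewrite (actDr T) actNr. Qed.

Lemma act_sum h (I : Type) (r : seq I) (P : pred I) (F : I -> M) :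
  act h (\sum_(i <- r | P i) F i) = \sum_(i <- r | P i) act h (F i).
Proof. exact: (lin_sum (act_lin h)). Qed.

Lemma act_br g h p : act g (act h p) = act h (act g p) + act (br g h) p.
Proof. by rewrite -!(actA T) -(actDl T) -brE. Qed.

Lemma subspace_act h (W : set M) : subspace W -> subspace [set p | W (act h p)].
Proof.
move=> hW; split; first by rewrite /= act0r; case: hW.
by move=> k p q /= hp hq; rewrite act_lin; apply: hW.2.
Qed.

Lemma subspace_actl p (W : set M) : subspace W -> subspace [set h | W (act h p)].
Proof.
move=> hW; split; first by rewrite /= act0l; case: hW.
by move=> k x y /= hp hq; rewrite (actDl T) (actZl T); apply: hW.2.
Qed.

Lemma subspace_eigen h (k : K) : subspace [set p | act h p = k *: p].
Proof.
split=> [|a p q /= hp hq]; first by rewrite /= act0r scaler0.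
by rewrite act_lin hp hq scalerDr !scalerA mulrC.
Qed.

Definition gen_wt t : int := if t then u else - u.

Lemma act_Sv0 t : act (S 0) (v t) = 0.
Proof. by rewrite (act_Sv T) add0r; case: t; rewrite ?(s_even T) (s_u T) scale0r. Qed.

Definition mono (a b : nat) t : M := act (z true ^+ a * z false ^+ b) (v t).

Lemma act_Hv t : act Hg (v t) = v t.
Proof.
rewrite /H_grad actBl !(actDl T) !(actA T) !(act_wv T) !act0r !add0r act_Sv0 (act1 T).
by rewrite subr0.
Qed.

Lemma act_H_mono a b t : act Hg (mono a b t) = (a + b).+1%:R *: mono a b t.
Proof.
rewrite /mono act_br act_Hv -[X in X + _]scale1r -natr1 addrC.
have h1 : br Hg 1 = (0 : K) *: 1 by rewrite scale0r br_def mulr1 mul1r subrr.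
have := br_H_zX D a true (br_H_zX D b false h1); rewrite mulr1 => ->.
by rewrite (actZl T) -scalerDl addr0 natrD.
Qed.

(** In a normally ordered word the letters [w] act first on the lowest degree,
    which they annihilate. *)
Lemma span_mono p : span [set q | exists a b t, q = mono a b t] p.
Proof.
set Mo := [set q | _]; have hM := span_subspace Mo.
have gv g t : G g -> exists (k : K) t', act g (v t) = k *: v t'.
  by move=> hg; have [b [a [a' [_ h]]]] := act_Gv T hg; exists (a' t), (t (+) b).
have wv0 e n t : (0 < n)%N -> act (w e ^+ n) (v t) = 0.
  by case: n => // n _; rewrite exprSr (actA T) (act_wv T) act0r.
have hv h t : span Mo (act h (v t)).
  have [n /(filt_sub_words D) hn] := filt_all D h.
  apply: (span_min (subspace_actl (v t) hM) _ hn) => {hn}_ [a [b [c [d [g [hg _ ->]]]]]] /=.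
  have [k [t' E]] := gv g t hg.
  rewrite /ordered_word !(actA T) E !actZr; apply: subspaceZ => //.
  have [d0|d0] := posnP d; last first.
    by rewrite wv0 // !act0r; case: hM.
  rewrite d0 expr0 (act1 T); have [c0|c0] := posnP c; last first.
    by rewrite wv0 // !act0r; case: hM.
  by rewrite c0 expr0 (act1 T) -(actA T); apply: sub_span; exists a, b, t'.
by have [h ->] := std_gen T p; apply: subspaceD.
Qed.

(** The homogeneous parts are the eigenspaces of [H_grad]. *)
Lemma eigen_mono k p : act Hg p = k%:R *: p ->
  span [set q | exists a b t, (a + b).+1 = k /\ q = mono a b t] p.
Proof.
move=> hp; have [n [c [f [hf hs]]]] := span_mono p.
have /choice [nu hnu] : forall i, exists nu : nat, exists a b t, nu = (a + b).+1 /\ f i = mono a b t.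
  by move=> i; have [a [b [t E]]] := hf i; exists (a + b).+1, a, b, t.
have h1 i : true -> act Hg (c i *: f i) = (nu i)%:R *: (c i *: f i).
  move=> _; have [a [b [t [-> ->]]]] := hnu i.
  by rewrite actZr act_H_mono !scalerA mulrC.
rewrite (eigen_proj (act_lin Hg) hp hs h1).
apply: subspace_sum => [|i /=]; first exact: span_subspace.
rewrite eqr_nat => /eqP hi; apply: subspaceZ; first exact: span_subspace.
have [a [b [t [E ->]]]] := hnu i; apply: sub_span; exists a, b, t; split=> //.
by rewrite -E.
Qed.

Lemma eigen_weight (nu : K) p : act Hg p = nu *: p -> p != 0 -> exists k, nu = k.+1%:R.
Proof.
move=> hp p0; have [n [c [f [hf hs]]]] := span_mono p.
have /choice [mu hmu] : forall i, exists nu : nat, exists a b t, nu = (a + b).+1 /\ f i = mono a b t.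
  by move=> i; have [a [b [t E]]] := hf i; exists (a + b).+1, a, b, t.
have h1 i : true -> act Hg (c i *: f i) = (mu i)%:R *: (c i *: f i).
  move=> _; have [a [b [t [-> ->]]]] := hmu i.
  by rewrite actZr act_H_mono !scalerA mulrC.
case: (pselect (exists i, (mu i)%:R == nu)) => [[i /eqP <-]|hno].
  by have [a [b [t [-> _]]]] := hmu i; exists (a + b)%N.
case/eqP: p0; apply: (eigen_sum_eq0 (act_lin Hg) hp hs h1) => i _.
by apply/negP => h; apply: hno; exists i.
Qed.

(** Being annihilated by [E_minus] in degree [k]; the degree is read off the
    eigenvalue of [H_grad]. *)
Definition harm k : set M := [set p | act Hg p = k.+1%:R *: p /\ act Em p = 0].

Lemma harm_subspace k : subspace (harm k).
Proof.
split; first by rewrite /harm /= !act0r scaler0.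
move=> a p q [h1 h2] [h3 h4]; split; first exact: (subspace_eigen Hg _).2.
by rewrite act_lin h2 h4 scaler0 addr0.
Qed.

Lemma act_H_shift h (a nu : K) p : br Hg h = a *: h -> act Hg p = nu *: p ->
  act Hg (act h p) = (nu + a) *: act h p.
Proof. by move=> hh hp; rewrite act_br hp hh actZr (actZl T) scalerDl. Qed.

Lemma act_H_EpX n (nu : K) p : act Hg p = nu *: p ->
  act Hg (act (Ep ^+ n) p) = (nu + (2 * n)%:R) *: act (Ep ^+ n) p.
Proof.
move=> hp; elim: n => [|n IH]; first by rewrite expr0 !(act1 T) hp muln0 addr0.
rewrite exprS (actA T) (act_H_shift (br_H_Ep D) IH); congr (_ *: _).
by rewrite -addrA -natrD; congr (_ + _%:R); lia.
Qed.

Lemma act_Em_EpX n k p : harm k p ->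
  act Em (act (Ep ^+ n.+1) p) = - (n.+1 * (n.+1 + k))%:R *: act (Ep ^+ n) p.
Proof.
move=> [hp hm]; elim: n => [|n IH].
  rewrite expr1 act_br hm act0r add0r brN (br_Ep_Em D) actNl hp expr0 (act1 T) scaleNr.
  by rewrite mul1n add1n.
rewrite exprS (actA T) act_br IH brN (br_Ep_Em D) actNl (act_H_EpX _ hp) actZr.
rewrite -(actA T) -exprS -scaleNr -scalerDl; congr (_ *: _).
by rewrite -opprD -!natrD; congr (- _%:R); lia.
Qed.

Definition isotypic k : set M :=
  [set p | exists j n q, [/\ (j + 2 * n)%N = k, harm j q & p = act (Ep ^+ n) q]].

(** Since [E_minus E_plus ^ n.+1] is a nonzero multiple of [E_plus ^ n] on
    harmonic vectors, [E_minus p], expanded by induction on the degree, has an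
    explicit preimage under [E_minus]; the difference from [p] is harmonic. *)
Lemma weight_isotypic k p : act Hg p = k.+1%:R *: p -> span (isotypic k) p.
Proof.
elim/ltn_ind: k p => k IH p hp; have Isp := span_subspace (isotypic k).
have hEm : act Hg (act Em p) = (k.+1%:R - 2) *: act Em p.
  by rewrite (act_H_shift (br_H_Em D) hp).
have [/eqP E0|E0] := boolP (act Em p == 0).
  by apply: sub_span; exists k, 0%N, p; rewrite expr0 (act1 T) addn0.
have [j hj] := eigen_weight hEm E0.
have jk : (j + 2)%N = k.
  by apply/eqP; rewrite -eqSS -addSn -(eqr_nat K) natrD -hj subrK.
have [n [c [f [hf hs]]]] : span (isotypic j) (act Em p) by apply: IH; [lia | rewrite -hj].
have /choice [g hg] : forall i, exists q, isotypic k q /\ act Em q = f i.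
  move=> i; have [i1 [i2 [q [e1 hq ->]]]] := hf i.
  exists ((- (i2.+1 * (i2.+1 + i1))%:R)^-1 *: act (Ep ^+ i2.+1) q); split.
    exists i1, i2.+1, ((- (i2.+1 * (i2.+1 + i1))%:R)^-1 *: q); split; first lia.
      by apply: subspaceZ => //; exact: harm_subspace.
    by rewrite actZr.
  rewrite actZr (act_Em_EpX _ hq) scalerA mulVf ?scale1r //.
  by rewrite oppr_eq0 pnatr_eq0.
have gH i : act Hg (g i) = k.+1%:R *: g i.
  have [[i1 [i2 [q [e1 [hq _] ->]]]] _] := hg i.
  by rewrite (act_H_EpX _ hq) -natrD -e1; congr (_%:R *: _); lia.
rewrite -[p](subrK (\sum_i c i *: g i)); apply: subspaceD => //; last first.
  by apply: subspace_sum => // i _; apply: subspaceZ => //; apply: sub_span; case: (hg i).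
apply: sub_span; exists k, 0%N, (p - \sum_i c i *: g i).
rewrite addn0 expr0 (act1 T); split=> //; split.
  have hW := subspace_eigen Hg k.+1%:R.
  have hsum : [set p | act Hg p = k.+1%:R *: p] (\sum_i c i *: g i).
    by apply: subspace_sum => // i _; apply: subspaceZ => //; apply: gH.
  exact: (subspaceB hW hp hsum).
rewrite actBr act_sum hs -sumrB big1 // => i _.
by rewrite actZr (hg i).2 subrr.
Qed.

Lemma span_isotypic p : span [set q | exists k, isotypic k q] p.
Proof.
have hI := span_subspace [set q | exists k, isotypic k q].
apply: (span_min hI _ (span_mono p)) => _ [a [b [t ->]]].
apply: (span_min hI _ (weight_isotypic (act_H_mono a b t))) => q hq.
by apply: sub_span; exists (a + b)%N.
Qed.

Lemma harm_split k p : act Hg p = k.+1%:R *: p ->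
  exists (h : M) q, harm k h /\ p = h + act Ep q.
Proof.
move=> hp.
have hsub : subspace [set p | exists (h : M) q, harm k h /\ p = h + act Ep q].
  split.
    by exists 0, 0; rewrite act0r addr0; split=> //; case: (harm_subspace k).
  move=> a _ _ [h1 [q1 [hh1 ->]]] [h2 [q2 [hh2 ->]]].
  exists (a *: h1 + h2), (a *: q1 + q2); split; first exact: (harm_subspace k).2.
  by rewrite act_lin scalerDr addrACA.
apply: (span_min hsub _ (weight_isotypic hp)) => _ [j [n [q [e hq ->]]]].
case: n e => [|n] e.
  by exists q, 0; rewrite act0r addr0 expr0 (act1 T); split=> //; rewrite -e addn0.
exists 0, (act (Ep ^+ n) q); rewrite add0r -(actA T) -exprS; split=> //.
by case: (harm_subspace k).
Qed.

End StandardModule.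

(** * Harmonic vectors modulo the image of the raising operator *)

Section Harmonics.
Variables (K : numClosedFieldType) (A : algType K).
Variables (z w : bool -> A) (S : int -> A) (G : set A).
Variables (M : lmodType K) (act : A -> M -> M) (v : bool -> M) (u : int) (s : int -> K).
Variable (eps : K) (beta : M -> M -> K).

(** What unitarity gives on the level of sl2: a positive form for which the
    raising and lowering operators are adjoint up to sign and the central element
    is self-adjoint. *)
Record contravariant_form : Prop := ContravariantForm {
  beta_lin : forall k p q r, beta (k *: p + q) r = k * beta p r + beta q r;
  beta_conj : forall p q, beta q p = (beta p q)^*;
  beta_pos : forall p, p != 0 -> 0 < beta p p;
  beta_Ep : forall p q, beta (act (E_plus z) p) q = - beta p (act (E_minus w) q);
  beta_Z : forall p q, beta (act (Zdef z w S eps) p) q = beta p (act (Zdef z w S eps) q)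
}.

Hypothesis D : cherednik_rel z w S G.
Hypothesis T : std_rep z w S G act v u s.
Hypothesis B : contravariant_form.
Local Notation Ep := (E_plus z).
Local Notation Em := (E_minus w).
Local Notation Hg := (H_grad z w S).
Local Notation Zrot := (Z_rot z w).
Local Notation Zt := (Zdef z w S eps).
Local Notation harm := (harm z w S act).
Local Notation wt := (gen_wt u).
Implicit Types (p q : M) (e t : bool).

Definition imEp : set M := [set p | exists q, p = act Ep q].

Lemma imEp_subspace : subspace imEp.
Proof.
split; first by exists 0; rewrite (act0r T).
by move=> k _ _ [p ->] [q ->]; exists (k *: p + q); rewrite (act_lin T).
Qed.

Lemma imEp_act x p : br Ep x = 0 -> imEp p -> imEp (act x p).
Proof.
move=> hx [q ->]; exists (act x q).
by rewrite [in RHS](act_br T) hx (act0l T) addr0.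
Qed.

Lemma imEp_zz e p : imEp (act (z e) (act (z (~~ e)) p)).
Proof.
exists (2 *: p); rewrite (actZr T) -(actZl T) (Ep_z D e) scalerA divff ?pnatr_eq0 //.
by rewrite scale1r (actA T).
Qed.

Lemma beta0 p : beta p 0 = 0.
Proof.
have h0 : beta 0 p = 0.
  have := beta_lin B 1 0 0 p; rewrite scale1r addr0 mul1r => h.
  by apply: (addIr (beta 0 p)); rewrite add0r.
by rewrite (beta_conj B) h0 conjC0.
Qed.

Lemma beta_eq0 p : beta p p = 0 -> p = 0.
Proof.
by move=> h; apply/eqP/negPn/negP => /(beta_pos B); rewrite h ltxx.
Qed.

(** The kernel of [E_minus] is orthogonal to the image of its adjoint. *)
Lemma harm_imEp k p : harm k p -> imEp p -> p = 0.
Proof.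
move=> [_ hm] [q hq]; apply: beta_eq0.
by rewrite {1}hq (beta_Ep B) hm beta0 oppr0.
Qed.

Lemma harm_eq k p q : harm k p -> harm k q -> imEp (p - q) -> p = q.
Proof.
move=> hp hq h; apply/eqP; rewrite -subr_eq0; apply/eqP.
apply: (@harm_imEp k) h; apply: subspaceB => //; exact: harm_subspace T k.
Qed.

Lemma harm_act k x p : br Ep x = 0 -> br Em x = 0 -> harm k p -> harm k (act x p).
Proof.
move=> h1 h2 [hp hm]; have h3 := br_H0 D h1 h2.
by split; rewrite (act_br T) ?h2 ?h3 ?hp ?hm (act0l T) addr0 ?(actZr T) ?(act0r T).
Qed.

Definition zv k e t : M := act (z e ^+ k) (v t).

Lemma zv_S k e t : act (z e) (zv k e t) = zv k.+1 e t.
Proof. by rewrite /zv -(actA T) -exprS. Qed.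

Lemma zv_H k e t : act Hg (zv k e t) = k.+1%:R *: zv k e t.
Proof.
rewrite /zv (act_br T) (act_Hv T) -[X in X + _]scale1r.
have h1 : br Hg 1 = (0 : K) *: 1 by rewrite scale0r br_def mulr1 mul1r subrr.
have := br_H_zX D k e h1; rewrite mulr1 => ->.
by rewrite (actZl T) -scalerDl addr0 nat1r.
Qed.

Lemma act_S_zv n k e t : act (S n) (zv k e t) =
  s (n + k%:Z * sg (~~ e) + wt t) *: zv k (~~ e) (~~ t).
Proof.
elim: k n => [|k IH] n.
  by rewrite /zv expr0 !(act1 T) (act_Sv T) mul0r addr0.
rewrite -zv_S -(actA T) (Sz D) (actA T) IH (actZr T) zv_S.
by congr (s _ *: _); rewrite intS mulrDl mul1r; ring.
Qed.

(** Only the last term of the commutator of [w e] with [z e ^+ k] can escape the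
    ideal of [z zbar], and it involves [S 0], which kills [v t]. *)
Lemma zw_same k e t :
  imEp (act (z e) (act (w e) (zv k e t)) - k%:R *: zv k e t).
Proof.
have hE := imEp_subspace.
elim: k => [|k IH].
  rewrite /zv expr0 (act1 T) (act_wv T) (act0r T) scale0r subrr.
  by case: hE.
rewrite -zv_S [act (w e) _](act_br T) (br_wz D) eqxx (actBl T) (act1 T) act_S_zv.
rewrite zv_S.
have -> : act (z e) (act (z e) (act (w e) (zv k e t)) + (zv k e t
   - s (0 + k%:Z * sg (~~ e) + wt t) *: zv k (~~ e) (~~ t))) - k.+1%:R *: zv k.+1 e t
   = act (z e) (act (z e) (act (w e) (zv k e t)) - k%:R *: zv k e t)
   - s (0 + k%:Z * sg (~~ e) + wt t) *: act (z e) (zv k (~~ e) (~~ t)).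
  rewrite (actDr T) !(actBr T) !(actZr T) !zv_S -natr1 scalerDl scale1r.
  rewrite opprD -!addrA; congr (_ + _).
  by rewrite [LHS]addrC -!addrA addNr addr0 addrC.
apply: subspaceB => //; first by apply: imEp_act (br_Ep_z D e) IH.
case: k {IH} => [|k]; last first.
  by apply: subspaceZ => //; rewrite -zv_S; apply: imEp_zz.
rewrite mul0r !add0r; case: t; rewrite /gen_wt ?(s_even T) (s_u T) scale0r; by case: hE.
Qed.

(** Only the first term of the commutator of [w (~~ e)] with [z e ^+ k] escapes
    the ideal of [z zbar]. *)
Lemma zw_opp k e t :
  imEp (act (z (~~ e)) (act (w (~~ e)) (zv k.+1 e t))
    - s (k.+1%:Z * sg (~~ e) + wt t) *: zv k.+1 (~~ e) (~~ t)).
Proof.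
have hE := imEp_subspace.
rewrite -zv_S [act (w _) _](act_br T) (br_wz D).
have -> : (~~ e == e) = false by case: e.
rewrite act_S_zv (actDr T) (actZr T) zv_S.
have -> : sg (~~ e) + k%:Z * sg (~~ e) + wt t = k.+1%:Z * sg (~~ e) + wt t.
  by rewrite intS mulrDl mul1r.
by rewrite addrK -{2}[e]negbK; apply: imEp_zz.
Qed.

Definition sgK e : K := if e then -1 else 1.

Lemma Zrot_zv k e t : imEp (act Zrot (zv k.+1 e t) -
  ((sgK e * k.+1%:R) *: zv k.+1 e t
   + (sgK (~~ e) * s (k.+1%:Z * sg (~~ e) + wt t)) *: zv k.+1 (~~ e) (~~ t))).
Proof.
have hE := imEp_subspace.
set X := (X in imEp X).
have -> : X = sgK e *: (act (z e) (act (w e) (zv k.+1 e t)) - k.+1%:R *: zv k.+1 e t)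
  + sgK (~~ e) *: (act (z (~~ e)) (act (w (~~ e)) (zv k.+1 e t))
    - s (k.+1%:Z * sg (~~ e) + wt t) *: zv k.+1 (~~ e) (~~ t)).
  rewrite !scalerBr !scalerA addrACA -opprD /X; congr (_ - _).
  rewrite /Z_rot (actBl T) !(actA T) /sgK.
  by case: e {X}; rewrite /= scale1r scaleN1r // addrC.
by apply: subspaceD => //; apply: subspaceZ => //; [exact: zw_same | exact: zw_opp].
Qed.

(** The harmonic part of [z e ^+ k (x) v t], given by [harm_split]. *)
Definition hv k e t : M := xget 0 [set h | harm k h /\ imEp (zv k e t - h)].

Lemma hvP k e t : harm k (hv k e t) /\ imEp (zv k e t - hv k e t).
Proof.
apply: (@xgetPex _ 0 [set h | harm k h /\ imEp (zv k e t - h)]).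
have [h [q [hh ->]]] := harm_split D T (zv_H k e t).
by exists h; split=> //; rewrite addrC addKr; exists q.
Qed.

(** For fixed [t] the two vectors, for [e = true] and [e = false], have weights
    [k + wt t] and its opposite; they span a plane stable under the rotation and
    the reflections. *)
Definition harmf k t e : M := hv k e (t == e).

Lemma hvZ k e t : act Zt (hv k.+1 e t) =
  (sgK e * k.+1%:R) *: hv k.+1 e t
   + ((sgK (~~ e) + eps) * s (k.+1%:Z * sg (~~ e) + wt t)) *: hv k.+1 (~~ e) (~~ t).
Proof.
have hE := imEp_subspace; have hH := harm_subspace T k.+1.
have [h1 e1] := hvP k.+1 e t; have [h2 e2] := hvP k.+1 (~~ e) (~~ t).
apply: (@harm_eq k.+1).
- exact: harm_act (br_Ep_Zdef D eps) (br_Em_Zdef D eps) h1.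
- by apply: subspaceD => //; apply: subspaceZ.
set a := sgK e * _; set c := _ * s _.
have h3 : imEp (act Zt (zv k.+1 e t) - (a *: zv k.+1 e t + c *: zv k.+1 (~~ e) (~~ t))).
  rewrite /Zdef (actDl T) (actZl T) act_S_zv add0r scalerA /c mulrDl [in X in _ - X]scalerDl.
  rewrite addrA [in X in imEp X]opprD [X in imEp X]addrACA subrr addr0.
  exact: Zrot_zv.
have h4 := imEp_act (br_Ep_Zdef D eps) e1.
rewrite (actBr T) in h4.
have := subspaceB hE (subspaceD hE h3 (subspaceD hE (subspaceZ a hE e1) (subspaceZ c hE e2))) h4.
congr imEp; rewrite !scalerBr [X in _ + X - _]addrACA -opprD subrKA.
by rewrite opprB addrC subrKA.
Qed.

Lemma harmf_harm k t e : harm k (harmf k t e).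
Proof. by case: (hvP k e (t == e)). Qed.

(** The matrix of the central element in an invariant plane; its square is the
    scalar [mu2]. *)
Lemma harmfZ k t e : act Zt (harmf k.+1 t e) =
  (sgK e * k.+1%:R) *: harmf k.+1 t e
   + ((sgK (~~ e) + eps) * s (k.+1%:Z + wt t)) *: harmf k.+1 t (~~ e).
Proof.
rewrite /harmf hvZ; have -> : (t == ~~ e) = ~~ (t == e) by case: t; case: e.
congr (_ + (_ * _) *: _); case: e; case: t; rewrite /= ?mulr1 ?mulrN1 //.
all: by rewrite -(s_even T) opprD !opprK.
Qed.

Lemma harmf_indep k (a : bool -> bool -> K) :
  \sum_(t : bool) \sum_(e : bool) a t e *: harmf k.+1 t e = 0 -> forall t e, a t e = 0.
Proof.
move=> h t e; have hE := imEp_subspace.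
have [q hq] : imEp (\sum_(e : bool) \sum_(t : bool) a (t == e) e *: zv k.+1 e t).
  have -> : \sum_(e : bool) \sum_(t : bool) a (t == e) e *: zv k.+1 e t =
     \sum_(e : bool) \sum_(t : bool) a (t == e) e *: (zv k.+1 e t - hv k.+1 e t).
    under [in RHS]eq_bigr do (under eq_bigr do rewrite scalerBr; rewrite sumrB).
    rewrite sumrB; suff -> : \sum_(e : bool) \sum_(t : bool) a (t == e) e *: hv k.+1 e t = 0.
      by rewrite subr0.
    rewrite -[RHS]h /harmf !big_bool /= [RHS]addrACA.
    by congr (_ + _); rewrite addrC.
  apply: subspace_sum => // i _; apply: subspace_sum => // i' _.
  by apply: subspaceZ => //; case: (hvP k.+1 i i').
have := std_indep T (ltn0Sn k) hq e (t == e).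
by have -> : ((t == e) == e) = t by case: t; case: e.
Qed.

Lemma harm_harmf k p : harm k.+1 p ->
  exists a : bool -> bool -> K, p = \sum_(t : bool) \sum_(e : bool) a t e *: harmf k.+1 t e.
Proof.
move=> hp; have hE := imEp_subspace; have hH := harm_subspace T k.+1.
pose W := [set p | exists a : bool -> bool -> K,
   imEp (p - \sum_(t : bool) \sum_(e : bool) a t e *: harmf k.+1 t e)].
have hW : subspace W.
  split; first by exists (fun _ _ => 0); under eq_bigr do (under eq_bigr do rewrite scale0r;
    rewrite big1_eq); rewrite big1_eq subr0; case: hE.
  move=> c x y [a ha] [a' ha']; exists (fun t e => c * a t e + a' t e).
  have := hE.2 c _ _ ha ha'; congr imEp.
  rewrite scalerBr addrACA -opprD; congr (_ - _).
  rewrite scaler_sumr -big_split; apply: eq_bigr => t _.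
  rewrite scaler_sumr -big_split; apply: eq_bigr => e _ /=.
  by rewrite scalerA -scalerDl.
have [a ha] : W p.
  apply: (span_min hW _ (eigen_mono D T hp.1)) => _ [a [b [t [E ->]]]].
  have one e : W (zv k.+1 e t).
    exists (fun t' e' => if (t' == (t == e)) && (e' == e) then 1 else 0).
    have := (hvP k.+1 e t).2; congr (imEp (_ - _)).
    rewrite (bigD1 (t == e)) //= (bigD1 e) //= !eqxx scale1r.
    rewrite big1 ?addr0; last by move=> e' /negbTE ->; rewrite scale0r.
    rewrite big1 ?addr0; first by rewrite /harmf; have -> : ((t == e) == e) = t by case: t; case: e.
    by move=> t' /negbTE ->; rewrite big1 // => e' _; rewrite scale0r.
  case: a E => [|a] E.
    have -> : mono z act v 0 b t = zv k.+1 false t.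
      by rewrite /mono expr0 mul1r /zv; have -> : b = k.+1 by lia.
    exact: one.
  case: b E => [|b] E.
    have -> : mono z act v a.+1 0 t = zv k.+1 true t.
      by rewrite /mono expr0 mulr1 /zv; have <- : a.+1 = k.+1 by lia.
    exact: one.
  exists (fun _ _ => 0); under eq_bigr do (under eq_bigr do rewrite scale0r;
    rewrite big1_eq); rewrite big1_eq subr0.
  rewrite /mono exprS exprSr.
  have -> : z true * z true ^+ a * (z false ^+ b * z false) =
     z true * (z false * (z true ^+ a * z false ^+ b)).
    rewrite -!mulrA; congr (_ * _).
    have c1 x n : GRing.comm (z false) (z x ^+ n) by apply/commrX/(zC D).
    by rewrite !mulrA (c1 true a) -!mulrA (c1 false b).
  by rewrite !(actA T); apply: (imEp_zz true).
exists a; apply: (harm_eq hp _ ha).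
apply: subspace_sum => // i _; apply: subspace_sum => // i' _.
by apply: subspaceZ => //; apply: harmf_harm.
Qed.

End Harmonics.

(** * Eigenlines in the invariant planes *)

Section Eigenlines.
Variables (K : numClosedFieldType) (A : algType K).
Variables (z w : bool -> A) (S : int -> A) (G : set A).
Variables (M : lmodType K) (act : A -> M -> M) (v : bool -> M) (u : int) (s : int -> K).
Variable (eps : K) (beta : M -> M -> K).
Hypothesis D : cherednik_rel z w S G.
Hypothesis T : std_rep z w S G act v u s.
Hypothesis B : contravariant_form z w S act eps beta.
Local Notation Ep := (E_plus z).
Local Notation Em := (E_minus w).
Local Notation Zrot := (Z_rot z w).
Local Notation Zt := (Zdef z w S eps).
Local Notation harm := (harm z w S act).
Local Notation wt := (gen_wt u).
Variable k : nat.
Local Notation f := (harmf z w S act v k.+1).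
Implicit Types (p q : M) (e t : bool).

Definition mu2 t : K := k.+1%:R ^+ 2 - (1 - eps ^+ 2) * s (k.+1%:Z + wt t) ^+ 2.

Definition piece t : set M := [set p | exists a : bool -> K, p = \sum_(e : bool) a e *: f t e].
Definition eigenline t lam : set M := [set p | piece t p /\ act Zt p = lam *: p].
Definition harm_eigen lam : set M := [set p | harm k.+1 p /\ act Zt p = lam *: p].

Lemma piece_subspace t : subspace (piece t).
Proof.
split; first by exists (fun _ => 0); rewrite big1 // => e _; rewrite scale0r.
move=> c _ _ [a ->] [b ->]; exists (fun e => c * a e + b e).
rewrite scaler_sumr -big_split; apply: eq_bigr => e _ /=.
by rewrite scalerA -scalerDl.
Qed.

Lemma piece_f t e : piece t (f t e).
Proof.
exists (fun e' => if e' == e then 1 else 0); rewrite (bigD1 e) //= eqxx scale1r.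
by rewrite big1 ?addr0 // => e' /negbTE ->; rewrite scale0r.
Qed.

Lemma piece_harm t p : piece t p -> harm k.+1 p.
Proof.
move=> [a ->]; apply: subspace_sum => [|e _]; first exact: harm_subspace T _.
apply: subspaceZ; first exact: harm_subspace T _.
exact: harmf_harm D T _ _ _.
Qed.

Lemma piece_stable t x : (forall e, piece t (act x (f t e))) ->
  forall p, piece t p -> piece t (act x p).
Proof.
move=> h p [a ->]; rewrite (act_sum T); apply: subspace_sum => [|e _]; first exact: piece_subspace.
by rewrite (actZr T); apply: subspaceZ => //; exact: piece_subspace.
Qed.

Lemma piece_Z t p : piece t p -> piece t (act Zt p).
Proof.
apply: piece_stable => e; rewrite (harmfZ D T B).
by apply: subspaceD; rewrite ?subspaceZ //; try apply: subspaceZ; try apply: piece_subspace; apply: piece_f.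
Qed.

Lemma piece_split p : harm k.+1 p -> exists p1 p2, [/\ piece true p1, piece false p2 & p = p1 + p2].
Proof.
move=> /(harm_harmf D T B) [a ->]; rewrite big_bool /=.
by do 2!eexists; split; [exists (a true); reflexivity | exists (a false); reflexivity | by []].
Qed.

Lemma f_indep2 t (a : bool -> K) : \sum_(e : bool) a e *: f t e = 0 -> forall e, a e = 0.
Proof.
move=> h e; pose a' t' e' := if t' == t then a e' else 0.
suff : a' t e = 0 by rewrite /a' eqxx.
apply: (harmf_indep D T (k := k) (a := a')); rewrite (bigD1 t) //= /a' eqxx h add0r.
rewrite big1 // => t' /negbTE ->; rewrite big1 // => e' _; exact: scale0r.
Qed.

Lemma piece_indep p1 p2 : piece true p1 -> piece false p2 -> p1 + p2 = 0 -> p1 = 0 /\ p2 = 0.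
Proof.
move=> [a ->] [b ->] h.
have h0 := harmf_indep D T (k := k) (a := fun t => if t then a else b).
rewrite !big_bool /= in h h0; have {}h0 := h0 h.
rewrite !big_bool /= (h0 true true) (h0 true false) (h0 false true) (h0 false false).
by rewrite !scale0r addr0.
Qed.

Lemma piece_Z2 t p : piece t p -> act Zt (act Zt p) = mu2 t *: p.
Proof.
move=> [a ->]; rewrite !(act_sum T) scaler_sumr; apply: eq_bigr => e _.
rewrite !(actZr T) scalerA mulrC -scalerA; congr (_ *: _).
rewrite (harmfZ D T B) (act_lin T) (actZr T) !(harmfZ D T B) negbK.
rewrite !scalerDr !scalerA addrACA [X in _ + X]addrC addrACA -!scalerDl.
rewrite [X in _ + X *: _](_ : _ = 0); last by case: e; rewrite /sgK /=; ring.
by rewrite scale0r addr0; congr (_ *: _); rewrite /mu2; case: e; rewrite /sgK /=; ring.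
Qed.

Lemma Z_coef t (lam : K) (a : bool -> K) :
  act Zt (\sum_(e : bool) a e *: f t e) = lam *: \sum_(e : bool) a e *: f t e ->
  forall e, (lam - sgK K e * k.+1%:R) * a e = (sgK K e + eps) * s (k.+1%:Z + wt t) * a (~~ e).
Proof.
move=> h e.
pose b e := (sgK K e * k.+1%:R - lam) * a e + (sgK K e + eps) * s (k.+1%:Z + wt t) * a (~~ e).
have hb : \sum_(e : bool) b e *: f t e = 0.
  rewrite -[RHS](subrr (lam *: \sum_(e : bool) a e *: f t e)) -{1}h.
  rewrite (act_sum T) !big_bool /= !(actZr T) !(harmfZ D T B) /b /=.
  rewrite !scalerDr !scalerA opprD -!scaleNr.
  rewrite [X in _ = _ + X + _]addrC [X in _ = X + _]addrACA [RHS]addrACA -!scalerDl.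
  by congr (_ *: _ + _ *: _); ring.
have /eqP := f_indep2 hb e; rewrite /b addr_eq0 => /eqP h1.
by rewrite -[LHS]opprK -mulNr opprB h1 opprK.
Qed.

(** Self-adjointness turns [Z ^ 2 = 0] into [Z = 0] on the plane, but [Z] has a
    nonzero diagonal entry. *)
Lemma mu2_neq0 t : mu2 t != 0.
Proof.
apply/eqP => h.
have := piece_Z2 (piece_f t true); rewrite h scale0r => h2.
have : act Zt (f t true) = 0.
  by apply: (beta_eq0 B); rewrite (beta_Z B) h2 (beta0 B).
have E : f t true = \sum_(e : bool) (if e then 1 else 0) *: f t e.
  by rewrite big_bool /= scale1r scale0r addr0.
move=> h3; have := @Z_coef t 0 (fun e => if e then 1 else 0).
rewrite -E h3 scale0r => /(_ erefl true) /eqP.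
by rewrite /= mulr0 mulr1 sub0r oppr_eq0 mulN1r oppr_eq0 pnatr_eq0.
Qed.

Lemma eigenline_val t lam p : eigenline t lam p -> p != 0 -> lam ^+ 2 = mu2 t.
Proof.
move=> [hp hl] p0; have := piece_Z2 hp; rewrite hl (actZr T) hl scalerA => /eqP.
rewrite -subr_eq0 -scalerBl scaler_eq0 (negbTE p0) orbF subr_eq0 => /eqP <-.
by rewrite expr2.
Qed.

(** As [Z ^ 2 = lam ^ 2] on the plane, [Z + lam] maps into the eigenspace; it does
    not vanish because its diagonal entries [lam - k] and [lam + k] differ. *)
Lemma eigenline_ex t lam : lam ^+ 2 = mu2 t -> exists2 p, p != 0 & eigenline t lam p.
Proof.
move=> hl; pose g e := lam *: f t e + act Zt (f t e).
have hg e : eigenline t lam (g e).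
  split.
    apply: subspaceD; first exact: piece_subspace.
      by apply: subspaceZ; [exact: piece_subspace | exact: piece_f].
    exact/piece_Z/piece_f.
  rewrite /g (act_lin T) (piece_Z2 (piece_f t e)) -hl scalerDr scalerA -expr2.
  by rewrite addrC.
have [g1|] := eqVneq (g true) 0; last by exists (g true).
have [g2|] := eqVneq (g false) 0; last by exists (g false).
have h e : g e = 0 -> lam + sgK K e * k.+1%:R = 0.
  move=> h0; have Z0 : act Zt (f t e) = (- lam) *: f t e.
    by move/eqP: h0; rewrite /g addrC addr_eq0 => /eqP ->; rewrite scaleNr.
  have E : f t e = \sum_(e' : bool) (if e' == e then 1 else 0) *: f t e'.
    by rewrite (bigD1 e) //= eqxx scale1r big1 ?addr0 // => e' /negbTE ->; rewrite scale0r.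
  have := @Z_coef t (- lam) (fun e' => if e' == e then 1 else 0).
  rewrite -E Z0 => /(_ erefl e); rewrite eqxx.
  have -> : (~~ e == e) = false by case: (e).
  by rewrite mulr1 mulr0 -opprD => /eqP; rewrite oppr_eq0 => /eqP.
have := h _ g1; have := h _ g2; rewrite /sgK mul1r mulN1r => a1 a2.
have : (k.+1%:R : K) *+ 2 = 0.
  have -> : (k.+1%:R : K) *+ 2 = (lam + k.+1%:R) - (lam - k.+1%:R) by rewrite mulr2n; ring.
  by rewrite a1 a2 subr0.
by move/eqP; rewrite mulrn_eq0 pnatr_eq0.
Qed.

(** One of the two coordinate equations of an eigenvector has a nonzero
    diagonal coefficient and determines one coordinate from the other. *)
Lemma eigenline_line t lam p q : eigenline t lam p -> eigenline t lam q -> p != 0 ->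
  exists c, q = c *: p.
Proof.
move=> [[a ->] ha] [[b ->] hb] p0.
have [e he] : exists e, lam - sgK K e * k.+1%:R != 0.
  have [h|] := eqVneq (lam - sgK K true * k.+1%:R) 0; last by exists true.
  exists false; apply/eqP => h'; have : (k.+1%:R : K) *+ 2 = 0.
    have -> : (k.+1%:R : K) *+ 2 = (lam - sgK K true * k.+1%:R) - (lam - sgK K false * k.+1%:R).
      by rewrite /sgK mulr2n; ring.
    by rewrite h h' subr0.
  by move/eqP; rewrite mulrn_eq0 pnatr_eq0.
have solve (x : bool -> K) : act Zt (\sum_(e : bool) x e *: f t e) = lam *: \sum_(e : bool) x e *: f t e ->
    x e = (lam - sgK K e * k.+1%:R)^-1 * ((sgK K e + eps) * s (k.+1%:Z + wt t) * x (~~ e)).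
  by move=> /Z_coef /(_ e) <-; rewrite mulrA mulVf // mul1r.
have ae := solve _ ha; have be := solve _ hb.
have a0 : a (~~ e) != 0.
  apply/eqP => h; case/eqP: p0; rewrite big1 // => e' _.
  have [->|ne] := eqVneq e' e; first by rewrite ae h !mulr0 scale0r.
  have -> : e' = ~~ e by case: e' ne; case: (e).
  by rewrite h scale0r.
exists (b (~~ e) / a (~~ e)); rewrite scaler_sumr; apply: eq_bigr => e' _.
rewrite scalerA; congr (_ *: _).
have [->|ne] := eqVneq e' e.
  rewrite ae be; move: he a0; set X := lam - _; set Y := a _; set Y' := b _.
  by move=> he a0; field; rewrite a0 he.
have -> : e' = ~~ e by case: e' ne; case: (e).
by rewrite divfK.
Qed.

Lemma eigenline_sub t lam : subspace (eigenline t lam).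
Proof.
split; first by split; [case: (piece_subspace t) | rewrite (act0r T) scaler0].
move=> c p q [h1 h2] [h3 h4]; split; first exact: (piece_subspace t).2.
exact: (subspace_eigen T Zt lam).2.
Qed.

Lemma eigenline_harm t lam p : eigenline t lam p -> harm_eigen lam p.
Proof. by move=> [h1 h2]; split=> //; apply: piece_harm h1. Qed.

Lemma harm_eigen_split lam p : harm_eigen lam p ->
  exists p1 p2, [/\ eigenline true lam p1, eigenline false lam p2 & p = p1 + p2].
Proof.
move=> [/piece_split [p1 [p2 [h1 h2 ->]]] hl]; exists p1, p2.
have [] := @piece_indep (act Zt p1 - lam *: p1) (act Zt p2 - lam *: p2).
- by apply: subspaceB; [exact: piece_subspace | exact: piece_Z | apply: subspaceZ => //; exact: piece_subspace].
- by apply: subspaceB; [exact: piece_subspace | exact: piece_Z | apply: subspaceZ => //; exact: piece_subspace].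
- by rewrite addrACA -(actDr T) hl scalerDr -opprD subrr.
move=> /eqP; rewrite subr_eq0 => /eqP e1 /eqP; rewrite subr_eq0 => /eqP e2.
by split.
Qed.

Lemma eigenline0 t lam p : lam ^+ 2 != mu2 t -> eigenline t lam p -> p = 0.
Proof.
move=> h hp; apply/eqP; apply: contraNT h => p0.
by apply/eqP; apply: eigenline_val hp p0.
Qed.

Lemma act_G_f g t e : G g -> exists (c : K) e', act g (f t e) = c *: f t e'.
Proof.
move=> hg; have [b [a [a' [h1 h2]]]] := act_Gv T hg.
have hz n e0 t0 : act g (zv z act v n e0 t0) =
    (a e0 ^+ n * a' t0) *: zv z act v n (e0 (+) b) (t0 (+) b).
  elim: n => [|n IH].
    by rewrite /zv !expr0 !(act1 T) h2 mul1r.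
  by rewrite -(zv_S T) -(actA T) h1 (actZl T) (actA T) IH (actZr T) scalerA (zv_S T) exprS mulrA.
exists (a e ^+ k.+1 * a' (t == e)), (e (+) b).
have E : (t == e (+) b) = (t == e) (+) b by case: t; case: e; case: (b).
have [hh1 e1] := hvP D T k.+1 e (t == e).
have [hh2 e2] := hvP D T k.+1 (e (+) b) ((t == e) (+) b).
have hE := imEp_subspace T.
rewrite /harmf E; apply: (harm_eq T B _ _ (k := k.+1)).
- exact: (harm_act D T (br_Ep_G D hg) (br_Em_G D hg)).
- by apply: subspaceZ => //; exact: harm_subspace T _.
have := subspaceB hE (subspaceZ (a e ^+ k.+1 * a' (t == e)) hE e2) (imEp_act T (br_Ep_G D hg) e1).
rewrite (actBr T) hz; congr imEp.
by rewrite scalerBr opprB addrC subrKA.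
Qed.

(** By [centraliser_rot] it suffices that the rotation and the group preserve
    the plane. *)
Lemma piece_centraliser t x p : br Ep x = 0 -> br Em x = 0 -> piece t p -> piece t (act x p).
Proof.
move=> h1 h2 hp; have hx := centraliser_rot D h1 h2.
have hP := piece_subspace t.
have pG g : G g -> forall q, piece t q -> piece t (act g q).
  move=> hg; apply: piece_stable => e; have [c [e' ->]] := act_G_f t e hg.
  by apply: subspaceZ => //; apply: piece_f.
have pZ q : piece t q -> piece t (act Zrot q).
  move=> hq; have -> : Zrot = Zt - eps *: S 0 by rewrite /Zdef addrK.
  rewrite (actBl T) (actZl T); apply: subspaceB => //; first exact: piece_Z.
  apply: subspaceZ => //.
  by apply: (span_min (subspace_actl T q hP) _ (SG D 0)) => g hg; apply: pG.
apply: (span_min (subspace_actl T p hP) _ hx) => _ [n [g [hg ->]]] /=.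
elim: n => [|n IH]; first by rewrite expr0 mul1r; apply: pG.
by rewrite exprS -mulrA (actA T); apply: pZ.
Qed.

Lemma eigenline_centraliser t lam x p : br Ep x = 0 -> br Em x = 0 -> br Zt x = 0 ->
  eigenline t lam p -> eigenline t lam (act x p).
Proof.
move=> h1 h2 h3 [hp hl]; split; first exact: piece_centraliser.
by rewrite (act_br T) hl (actZr T) h3 (act0l T) addr0.
Qed.

End Eigenlines.

(** * Lowest weight modules and tensor products *)

Section LowestWeightModules.
Variables (K : numClosedFieldType) (A : algType K).
Variables (z w : bool -> A) (S : int -> A) (G : set A).
Variables (M : lmodType K) (act : A -> M -> M) (v : bool -> M) (u : int) (s : int -> K).
Variable (eps : K).
Hypothesis D : cherednik_rel z w S G.
Hypothesis T : std_rep z w S G act v u s.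
Local Notation Ep := (E_plus z).
Local Notation Em := (E_minus w).
Local Notation Hg := (H_grad z w S).
Local Notation Zt := (Zdef z w S eps).
Local Notation harm := (harm z w S act).
Implicit Types (p q : M) (l : {poly K}).

(** [p (x) X ^ i |-> E_plus ^ i p]: the lowest weight module is modelled on the
    polynomials in the raising operator. *)
Definition jb p l : M := \sum_(i < size l) l`_i *: act (Ep ^+ i) p.

Lemma jbE n p l : (size l <= n)%N -> jb p l = \sum_(i < n) l`_i *: act (Ep ^+ i) p.
Proof.
move=> h; rewrite /jb -!(big_mkord xpredT (fun i => l`_i *: act (Ep ^+ i) p)).
rewrite [RHS](big_cat_nat (n := size l)) //= [X in _ = _ + X]big_nat_cond.
rewrite [X in _ = _ + X]big1 ?addr0 // => i /andP[/andP[hi _] _].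
by rewrite nth_default // scale0r.
Qed.

Lemma jb_linr p a l l' : jb p (a *: l + l') = a *: jb p l + jb p l'.
Proof.
pose n := maxn (size (a *: l + l')) (maxn (size l) (size l')).
rewrite !(@jbE n) ?leq_max ?leqnn ?orbT //.
rewrite scaler_sumr -big_split; apply: eq_bigr => i _ /=.
by rewrite coefD coefZ scalerDl scalerA.
Qed.

Lemma jb_linl l a p q : jb (a *: p + q) l = a *: jb p l + jb q l.
Proof.
rewrite scaler_sumr -big_split; apply: eq_bigr => i _ /=.
by rewrite (act_lin T) scalerDr !scalerA mulrC.
Qed.

Lemma jb_X p i : jb p 'X^i = act (Ep ^+ i) p.
Proof.
rewrite (@jbE i.+1) ?size_polyXn // big_ord_recr /= coefXn eqxx scale1r.
rewrite big1 ?add0r // => j _; rewrite coefXn ltn_eqF ?scale0r //.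
Qed.

Section Piece.
Variables (W : set M) (k : nat) (lam : K).
Hypothesis W_sub : subspace W.
Hypothesis W_harm : forall p, W p -> harm k p.
Hypothesis W_Z : forall p, W p -> act Zt p = lam *: p.

Lemma EpX_inj n p : harm k p -> act (Ep ^+ n) p = 0 -> p = 0.
Proof.
move=> hp; elim: n => [|n IH]; first by rewrite expr0 (act1 T).
move=> h; apply: IH; have := act_Em_EpX D T n hp; rewrite h (act0r T).
by move=> /esym/eqP; rewrite scaler_eq0 oppr_eq0 pnatr_eq0 => /eqP.
Qed.

(** The terms have distinct [H_grad]-eigenvalues. *)
Lemma EpX_indep n (ws : nat -> M) : (forall i, W (ws i)) ->
  \sum_(i < n) act (Ep ^+ i) (ws i) = 0 -> forall i, (i < n)%N -> ws i = 0.
Proof.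
move=> hw h i hi; apply: (EpX_inj (n := i)); first exact/W_harm/hw.
have h0 : act Hg 0 = (k.+1 + 2 * i)%:R *: 0 by rewrite (act0r T) scaler0.
have hv (j : 'I_n) : true -> act Hg (act (Ep ^+ j) (ws j)) = (k.+1 + 2 * j)%:R *: act (Ep ^+ j) (ws j).
  by move=> _; have [hj _] := W_harm (hw j); rewrite (act_H_EpX D T _ hj) natrD.
have := eigen_proj (act_lin T Hg) h0 (esym h) hv.
rewrite (bigD1 (Ordinal hi)) /=; last by rewrite eqxx.
rewrite big1 ?addr0 => [/esym //|j /andP[]].
rewrite eqr_nat eqn_add2l eqn_mul2l /= => h1 /negP[]; apply/eqP/val_inj/eqP.
exact: h1.
Qed.

Variable w0 : M.
Hypotheses (W_w0 : W w0) (w0_neq0 : w0 != 0).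

Lemma jb_inj l l' : jb w0 l = jb w0 l' -> l = l'.
Proof.
move=> h; apply/eqP; rewrite -subr_eq0 -[l - l']addr0; apply/eqP; rewrite addr0.
have h0 : jb w0 (l - l') = 0.
  by rewrite addrC -scaleN1r jb_linr h scaleN1r addNr.
apply/polyP => i; rewrite coef0; have [hi|hi] := ltnP i (size (l - l')); last exact: nth_default.
have /eqP : (l - l')`_i *: w0 = 0.
  apply: (@EpX_indep (size (l - l')) (fun i => (l - l')`_i *: w0)) hi => [j|].
    exact: subspaceZ.
  by rewrite -[RHS]h0 /jb; apply: eq_bigr => j _; rewrite (actZr T).
by rewrite scaler_eq0 (negbTE w0_neq0) orbF => /eqP.
Qed.

Definition u11_span : set A := span [set h | [\/ h = Ep, h = Em, h = Hg | h = Zt]].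

Lemma jb_Ep p l : jb p ('X * l) = act Ep (jb p l).
Proof.
rewrite (@jbE (size l).+1) ?(leq_trans (size_polyMleq _ _)) ?size_polyX //.
rewrite big_ord_recl coefXM eqxx scale0r add0r (act_sum T).
apply: eq_bigr => i _; rewrite lift0 coefXM /= (actZr T) -(actA T).
by rewrite -exprS.
Qed.

Lemma jb_Em p l : harm k p ->
  jb p (\poly_(i < size l) (- (i.+1 * (i.+1 + k))%:R * l`_i.+1)) = act Em (jb p l).
Proof.
move=> hp; rewrite (@jbE (size l)) ?size_poly //.
rewrite (@jbE (size l).+1 p l) // big_ord_recl (actDr T) (actZr T) expr0 (act1 T).
have [_ ->] := hp; rewrite scaler0 add0r (act_sum T); apply: eq_bigr => i _.
rewrite coef_poly ltn_ord lift0 (actZr T) (act_Em_EpX D T _ hp) scalerA.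
by rewrite mulrC.
Qed.

Lemma jb_Hg p l : harm k p ->
  jb p (\poly_(i < size l) ((k.+1 + 2 * i)%:R * l`_i)) = act Hg (jb p l).
Proof.
move=> [hp _]; rewrite (@jbE (size l)) ?size_poly // (act_sum T).
apply: eq_bigr => i _; rewrite coef_poly ltn_ord (actZr T) (act_H_EpX D T _ hp).
by rewrite scalerA mulrC natrD.
Qed.

Lemma act_comm x p (nu : K) l : br x Ep = 0 -> act x p = nu *: p ->
  act x (jb p l) = nu *: jb p l.
Proof.
move=> h hp; rewrite (act_sum T) scaler_sumr; apply: eq_bigr => i _.
rewrite (actZr T) scalerA mulrC -scalerA; congr (_ *: _).
elim: (i : nat) => [|n IH]; first by rewrite expr0 (act1 T).
by rewrite exprS (actA T) (act_br T) h (act0l T) addr0 IH (actZr T).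
Qed.

Lemma br_Zt_Ep : br Zt Ep = 0.
Proof. by rewrite brN (br_Ep_Zdef D) oppr0. Qed.

Lemma jb_Zt p l : W p -> jb p (lam *: l) = act Zt (jb p l).
Proof.
move=> /W_Z hp; rewrite (act_comm l br_Zt_Ep hp).
rewrite -[lam *: l]addr0 jb_linr [X in _ + X](_ : _ = 0) ?addr0 //.
by rewrite /jb size_poly0 big_ord0.
Qed.

Lemma jb_lift X l : u11_span X -> exists l', forall p, W p -> jb p l' = act X (jb p l).
Proof.
have hsub : subspace [set X | exists l', forall p, W p -> jb p l' = act X (jb p l)].
  split; first by exists 0 => p _; rewrite (act0l T) /jb size_poly0 big_ord0.
  move=> a X1 X2 [l1 h1] [l2 h2]; exists (a *: l1 + l2) => p hp.
  by rewrite jb_linr h1 // h2 // (actDl T) (actZl T).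
apply: (span_min hsub) => _ [] ->; eexists => p hp.
- exact: jb_Ep.
- exact/jb_Em/W_harm.
- exact/jb_Hg/W_harm.
- exact: jb_Zt.
Qed.

(** The action of [u(1,1)] on polynomials, characterised through the embedding
    [jb w0]; it exists by [jb_lift] and is unique by [jb_inj], which reduces all
    identities of the action to those in the standard module. *)
Definition poly_act X l : {poly K} := xget 0 [set l' | forall p, W p -> jb p l' = act X (jb p l)].

Lemma poly_act_eq X l l' : (forall p, W p -> jb p l' = act X (jb p l)) -> poly_act X l = l'.
Proof.
move=> h; have hP : [set l' | forall p, W p -> jb p l' = act X (jb p l)] (poly_act X l).
  by apply: xgetPex; exists l'.
by apply: jb_inj; rewrite (hP _ W_w0) h.
Qed.

Lemma poly_actP X l p : u11_span X -> W p -> jb p (poly_act X l) = act X (jb p l).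
Proof.
move=> hX hp; apply: (@xgetPex _ 0 [set l' | forall p, W p -> jb p l' = act X (jb p l)]) hp.
exact: jb_lift.
Qed.

Lemma poly_act_linl l : linear_on u11_span (poly_act^~ l).
Proof.
move=> a X Y hX hY; apply: poly_act_eq => p hp.
by rewrite jb_linr !poly_actP // (actDl T) (actZl T).
Qed.

Lemma poly_act_linr X : u11_span X -> linear_on setT (poly_act X).
Proof.
move=> hX a l l' _ _; apply: poly_act_eq => p hp.
by rewrite !jb_linr !poly_actP // (act_lin T).
Qed.

Lemma poly_act_br X Y l : u11_span X -> u11_span Y ->
  poly_act (X * Y - Y * X) l = poly_act X (poly_act Y l) - poly_act Y (poly_act X l).
Proof.
move=> hX hY; apply: poly_act_eq => p hp.
rewrite addrC -scaleN1r jb_linr !poly_actP // scaleN1r addrC.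
by rewrite (actBl T) !(actA T).
Qed.

Lemma u11_mem : [/\ u11_span Ep, u11_span Em, u11_span Hg & u11_span Zt].
Proof.
by split; apply: sub_span; [constructor 1|constructor 2|constructor 3|constructor 4].
Qed.

Lemma poly_act_Ep l : poly_act Ep l = 'X * l.
Proof. by apply: poly_act_eq => p _; apply: jb_Ep. Qed.

Lemma poly_act_Em l :
  poly_act Em l = \poly_(i < size l) (- (i.+1 * (i.+1 + k))%:R * l`_i.+1).
Proof. by apply: poly_act_eq => p hp; apply/jb_Em/W_harm. Qed.

Lemma poly_act_lowest : [/\ poly_act Em 1 = 0, poly_act Hg 1 = k.+1%:R *: 1
  & poly_act Zt 1 = lam *: 1].
Proof.
have j1 p : jb p 1 = p by rewrite -(expr0 'X) jb_X expr0 (act1 T).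
have j0 p : jb p 0 = 0 by rewrite /jb size_poly0 big_ord0.
have jZ p a : jb p (a *: 1) = a *: p by rewrite -[a *: 1]addr0 jb_linr j0 addr0 j1.
split; apply: poly_act_eq => p hp; rewrite ?j0 ?jZ j1.
- by case: (W_harm hp).
- by case: (W_harm hp) => ->.
- by rewrite W_Z.
Qed.

(** Lowering a nonzero polynomial down to degree 0 and raising the result gives
    all monomials. *)
Lemma poly_act_irr (V : set {poly K}) : subspace V ->
  (forall X l, u11_span X -> V l -> V (poly_act X l)) -> V = [set 0] \/ V = setT.
Proof.
move=> hV st; have [u1 u2 u3 u4] := u11_mem.
have [[l hl l0]|h] := pselect (exists2 l, V l & l != 0); last first.
  left; apply/seteqP; split=> [l hl|_ ->]; last by case: hV.
  by apply/eqP/negPn/negP => l0; apply: h; exists l.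
right; apply/seteqP; split=> // l' _.
have V1 : V 1.
  have [n] := ubnP (size l); elim: n l hl l0 => // n IH l hl l0 hn.
  have [h1|h1] := leqP (size l) 1.
    have [c e] : exists c, l = c%:P by exists l`_0; apply: size1_polyC.
    have c0 : c != 0 by move: l0; rewrite e polyC_eq0.
    have -> : 1 = c^-1 *: l by rewrite e -mul_polyC -polyCM mulVf.
    exact: subspaceZ.
  apply: (IH (poly_act Em l)); first exact: st.
    apply/eqP => /(congr1 (fun q : {poly K} => q`_(size l).-2)).
    rewrite poly_act_Em coef_poly coef0.
    have -> : ((size l).-2 < size l)%N by lia.
    have -> : (size l).-2.+1 = (size l).-1 by lia.
    move=> /eqP; rewrite mulf_eq0 oppr_eq0 pnatr_eq0 -/(lead_coef l) lead_coef_eq0 (negbTE l0).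
    by rewrite orbF muln_eq0 addn_eq0; lia.
  rewrite poly_act_Em; apply: (@leq_ltn_trans (size l).-1); last by lia.
  apply/leq_sizeP => j hj; rewrite coef_poly; case: ifP => // _.
  by rewrite (@nth_default _ 0 l) ?mulr0 //; move: hj; case: (size l).
rewrite -[l']coefK poly_def; apply: subspace_sum => // i _; apply: subspaceZ => //.
elim: (i : nat) => [|n IH]; first by rewrite expr0.
by rewrite exprS -poly_act_Ep; apply: st.
Qed.

Definition expansion (p : M) (ws : nat -> M) : Prop :=
  (forall i, W (ws i)) /\ exists n, (forall i, (n <= i)%N -> ws i = 0) /\
     p = \sum_(i < n) act (Ep ^+ i) (ws i).

Lemma expansion_uniq p ws ws' : expansion p ws -> expansion p ws' -> ws = ws'.
Proof.
move=> [h [n [z1 e1]]] [h' [n' [z2 e2]]]; apply/funext => i.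
pose N := maxn n n'.
have pad (x : nat -> M) r : (forall i, (r <= i)%N -> x i = 0) -> (r <= N)%N ->
    \sum_(i < r) act (Ep ^+ i) (x i) = \sum_(i < N) act (Ep ^+ i) (x i).
  move=> hx hr; rewrite -!(big_mkord xpredT (fun i => act (Ep ^+ i) (x i))).
  rewrite [RHS](big_cat_nat (n := r)) //= [X in _ = _ + X]big_nat_cond.
  by rewrite [X in _ = _ + X]big1 ?addr0 // => j /andP[/andP[hj _] _]; rewrite hx // (act0r T).
have [hi|hi] := ltnP i N; last by rewrite z1 ?z2 // (leq_trans _ hi) // ?leq_maxl ?leq_maxr.
apply/eqP; rewrite -subr_eq0; apply/eqP.
apply: (@EpX_indep N (fun i => ws i - ws' i)) hi => [j|]; first exact: subspaceB.
under eq_bigr do rewrite (actBr T); rewrite sumrB -(pad ws n) ?leq_maxl // -(pad ws' n') ?leq_maxr //.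
by rewrite -e1 -e2 subrr.
Qed.

Lemma expansion_lin a p q ws ws' : expansion p ws -> expansion q ws' ->
  expansion (a *: p + q) (fun i => a *: ws i + ws' i).
Proof.
move=> [h [n [z1 e1]]] [h' [n' [z2 e2]]]; split; first by move=> i; apply: W_sub.2.
exists (n + n')%N; split.
  by move=> i hi; rewrite z1 ?z2 ?scaler0 ?addr0 //; lia.
under eq_bigr do rewrite (act_lin T).
rewrite big_split -scaler_sumr /=; congr (_ *: _ + _).
  by rewrite big_split_ord /= [X in _ + X]big1 ?addr0 // => i _; rewrite z1 ?(act0r T) // leq_addr.
rewrite addnC big_split_ord /= [X in _ + X]big1 ?addr0 // => i _.
by rewrite z2 ?(act0r T) // leq_addr.
Qed.

Lemma expansion_jb p l : W p -> expansion (jb p l) (fun i => l`_i *: p).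
Proof.
move=> hp; split; first by move=> i; apply: subspaceZ.
exists (size l); split; first by move=> i hi; rewrite nth_default ?scale0r.
by apply: eq_bigr => i _; rewrite (actZr T).
Qed.

Definition jspan : set M := span [set q | exists p l, W p /\ q = jb p l].

Lemma expansion_ex q : jspan q -> exists ws, expansion q ws.
Proof.
have hs : subspace [set q | exists ws, expansion q ws].
  split; last by move=> a x y [ws h] [ws' h']; eexists; apply: expansion_lin h h'.
  exists (fun _ => 0); split; first by case: W_sub.
  by exists 0%N; rewrite big_ord0.
apply: (span_min hs) => _ [p [l [hp ->]]]; eexists; exact: expansion_jb.
Qed.

(** The universal property holds because every vector of [jspan] has exactly one
    expansion in powers of [E_plus] with coefficients in [W]. *)
Lemma jspan_tensor : is_tensor_product W jb jspan.
Proof.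
split; first by split=> [l a p q _ _|p _ a l l' _ _]; [apply: jb_linl | apply: jb_linr].
  by [].
move=> U f [f1 f2].
have f0 l : f 0 l = 0.
  have h0 := W_sub.1; have := f1 l 1 0 0 h0 h0; rewrite !scale1r addr0 => h.
  by apply: (addIr (f 0 l)); rewrite add0r.
pose rel q t := exists ws n, [/\ expansion q ws, (forall i, (n <= i)%N -> ws i = 0)
   & t = \sum_(i < n) f (ws i) 'X^i].
have pad (x : nat -> M) r N : (forall i, (r <= i)%N -> x i = 0) -> (r <= N)%N ->
    \sum_(i < r) f (x i) 'X^i = \sum_(i < N) f (x i) 'X^i.
  move=> hx hr; rewrite -!(big_mkord xpredT (fun i => f (x i) 'X^i)).
  rewrite [RHS](big_cat_nat (n := r)) //= [X in _ = _ + X]big_nat_cond.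
  by rewrite [X in _ = _ + X]big1 ?addr0 // => j /andP[/andP[hj _] _]; rewrite hx.
have rel_uniq q t t' : rel q t -> rel q t' -> t = t'.
  move=> [ws [n [e zn ->]]] [ws' [n' [e' zn' ->]]].
  have E := expansion_uniq e e'; rewrite -E in zn' *.
  by rewrite (pad _ n (n + n')%N) ?leq_addr // [RHS](pad _ n' (n + n')%N) ?leq_addl.
have rel_ex q : jspan q -> exists t, rel q t.
  move=> /expansion_ex [ws e]; have [_ [n [zn _]]] := e.
  by eexists; exists ws, n.
have rel_lin a q t q' t' : rel q t -> rel q' t' -> rel (a *: q + q') (a *: t + t').
  move=> [ws [n [e zn ->]]] [ws' [n' [e' zn' ->]]].
  exists (fun i => a *: ws i + ws' i), (n + n')%N; split.
  - exact: expansion_lin.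
  - by move=> i hi; rewrite zn ?zn' ?scaler0 ?addr0 //; lia.
  rewrite (pad _ n (n + n')%N) ?leq_addr // (pad _ n' (n + n')%N) ?leq_addl //.
  rewrite scaler_sumr -big_split; apply: eq_bigr => i _ /=.
  by rewrite f1 //; [case: e | case: e'].
have relP q : jspan q -> rel q (xget 0 [set t | rel q t]).
  by move=> /rel_ex h; apply: (@xgetPex _ 0 [set t | rel q t]).
exists (fun q => xget 0 [set t | rel q t]); split.
  move=> a q q' hq hq'; apply: (rel_uniq (a *: q + q')).
    by apply: relP; apply: (span_subspace _).2.
  by apply: rel_lin; apply: relP.
move=> p l hp; apply: (rel_uniq (jb p l)).
  by apply: relP; apply: sub_span; exists p, l.
exists (fun i => l`_i *: p), (size l); split; first exact: expansion_jb.
  by move=> i hi; rewrite nth_default ?scale0r.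
have flin : forall a x y, f p (a *: x + y) = a *: f p x + f p y by move=> a x y; apply: f2.
rewrite -{1}[l]coefK poly_def (lin_sum flin); apply: eq_bigr => i _.
rewrite (linZ flin); have := f1 'X^i (l`_i) p 0 hp W_sub.1.
by rewrite !addr0 f0 addr0.
Qed.

End Piece.
End LowestWeightModules.

(** * Separation of the summands by Casimir eigenvalues *)

Section Decomposition.
Variables (K : numClosedFieldType) (A : algType K).
Variables (z w : bool -> A) (S : int -> A) (G : set A).
Variables (M : lmodType K) (act : A -> M -> M) (v : bool -> M) (u : int) (s : int -> K).
Variable (eps : K).
Hypothesis D : cherednik_rel z w S G.
Hypothesis T : std_rep z w S G act v u s.
Local Notation Ep := (E_plus z).
Local Notation Em := (E_minus w).
Local Notation Hg := (H_grad z w S).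
Local Notation Zt := (Zdef z w S eps).
Local Notation harm := (harm z w S act).
Local Notation jb := (jb z act).
Implicit Types (p q : M) (l : {poly K}).

Lemma jb_act x p l : br x Ep = 0 -> jb (act x p) l = act x (jb p l).
Proof.
move=> h; rewrite (act_sum T); apply: eq_bigr => i _; rewrite (actZr T); congr (_ *: _).
elim: (i : nat) => [|n IH]; first by rewrite expr0 !(act1 T).
by rewrite exprS !(actA T) IH [RHS](act_br T) h (act0l T) addr0.
Qed.

(** A multiple and shift of the Casimir element of sl2, normalised to act by
    [k ^ 2] on the summands with harmonic part of degree [k]. *)
Definition casimir : A := (Hg - 1) ^+ 2 + 4 *: (Ep * Em).

Lemma br_casimir_Ep : br casimir Ep = 0.
Proof.
have hH : br (Hg - 1) Ep = 2 *: Ep.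
  by rewrite brDl (br_H_Ep D) brN brNr br_def mulr1 mul1r subrr !oppr0 addr0.
have hm : br Em Ep = - Hg by rewrite brN (br_Ep_Em D).
have E : (Hg - 1) * Ep = Ep * (Hg - 1) + 2 *: Ep by rewrite -hH -brE.
have h0 : br Ep Ep = 0 by rewrite br_def subrr.
rewrite /casimir brDl expr2 brMl hH brZl brMl hm h0 mul0r addr0 mulrN.
rewrite -scalerAl -scalerAr -scalerDr E addrAC -mulr2n -scaler_nat -scalerDr scalerA.
have -> : Ep * (Hg - 1) + Ep = Ep * Hg by rewrite mulrBr mulr1 subrK.
by rewrite scalerN -natrM subrr.
Qed.

Lemma casimir_jb k p l : harm k p -> act casimir (jb p l) = (k ^ 2)%:R *: jb p l.
Proof.
move=> [hp hm]; apply: (act_comm T) br_casimir_Ep _.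
have e1 : act (Hg - 1) p = k%:R *: p.
  by rewrite (actBl T) hp (act1 T) -[X in _ - X]scale1r -scalerBl -natr1 addrK.
rewrite /casimir (actDl T) (actZl T) (actA T Ep) hm (act0r T) scaler0 addr0 expr2.
by rewrite (actA T) e1 (actZr T) e1 scalerA natrX.
Qed.

Lemma joint_indep (X Y : A) (I : eqType) (r : seq I) (f : I -> M) (a b : I -> K) :
  uniq r -> (forall i, i \in r -> act X (f i) = a i *: f i /\ act Y (f i) = b i *: f i) ->
  {in r &, forall i j, a i = a j -> b i = b j -> i = j} ->
  \sum_(i <- r) f i = 0 -> forall i, i \in r -> f i = 0.
Proof.
move=> ur he inj h i hi.
have h0 (x : A) (c : K) : act x 0 = c *: 0 by rewrite (act0r T) scaler0.
have h1 : 0 = \sum_(j <- r | (j \in r) && (a j == a i)) f j.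
  apply: (eigen_proj (act_lin T X)) (h0 X (a i)) _ _ => [|j hj].
    by rewrite -big_seq h.
  by case: (he j hj).
have h2 : 0 = \sum_(j <- r | (j \in r) && (a j == a i) && (b j == b i)) f j.
  apply: (eigen_proj (act_lin T Y)) (h0 Y (b i)) h1 _ => j /andP[hj _].
  by case: (he j hj).
move: h2; rewrite big_mkcond (bigD1_seq i) //= hi !eqxx /= big1 ?addr0 // => j ji.
case: ifP => // /andP[/andP[hj /eqP e1] /eqP e2].
by case/eqP: ji; apply: inj.
Qed.

(** A vector of an invariant plane is the half sum of [q + Z q / r] and
    [q - Z q / r], which are eigenvectors for [r] and [- r], with [r ^ 2 = mu2]. *)
Lemma span_jb (beta : M -> M -> K) (r : nat -> bool -> K) (p : M) :
  contravariant_form z w S act eps beta ->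
  (forall k t, r k t ^+ 2 = mu2 u s eps k t) ->
  span [set q | exists h l, q = jb h l /\ (harm 0 h \/ exists k t (b : bool),
     harm_eigen z w S act eps k ((-1) ^+ b * r k t) h)] p.
Proof.
move=> B hr; set V := [set q | _].
have hV := span_subspace V.
apply: (span_min hV _ (span_isotypic D T p)) => _ [_ [j [n [h [_ hh ->]]]]].
case: j hh => [|k] hh.
  by apply: sub_span; exists h, 'X^n; rewrite jb_X; split=> //; left.
have hs : subspace [set h | span V (act (Ep ^+ n) h)] by apply: (subspace_act T).
have [p1 [p2 [h1 h2 ->]]] := piece_split D T B hh.
have piece_ok t q : piece z w S act v k t q -> span V (act (Ep ^+ n) q).
  move=> hq; have Zq := piece_Z D T B hq; have Z2 := piece_Z2 D T B hq.
  have r0 : r k t != 0.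
    by apply/eqP => r0; have := mu2_neq0 D T B k t; rewrite -hr r0 expr0n eqxx.
  have -> : q = 2^-1 *: (q + (r k t)^-1 *: act Zt q) + 2^-1 *: (q - (r k t)^-1 *: act Zt q).
    rewrite -scalerDr addrACA subrr addr0 -mulr2n -scaler_nat scalerA mulVf ?scale1r //.
    by rewrite pnatr_eq0.
  have hsp := piece_subspace z w S act v k t.
  have ok (b : bool) : span V (act (Ep ^+ n) (q + ((-1) ^+ b * (r k t)^-1) *: act Zt q)).
    apply: sub_span; exists (q + ((-1) ^+ b * (r k t)^-1) *: act Zt q), 'X^n.
    rewrite jb_X; split=> //; right; exists k, t, b; split.
      by apply: (piece_harm D T (t := t)); apply: subspaceD => //; apply: subspaceZ.
    rewrite (actDr T) (actZr T) Z2 -hr scalerDr !scalerA addrC -[X in _ + X = _]scale1r; congr (_ *: _ + _ *: _).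
      by case: b; rewrite /= ?expr1 ?expr0; field.
    by case: b; rewrite /= ?expr1 ?expr0; field.
  have := ok false; have := ok true; rewrite /= expr0 expr1 mul1r mulN1r scaleNr => o1 o2.
  exact: (subspaceD hs (subspaceZ _ hs o2) (subspaceZ _ hs o1)).
rewrite (actDr T); apply: subspaceD => //; [exact: piece_ok h1 | exact: piece_ok h2].
Qed.

End Decomposition.

(** * Transposed Dunkl operators *)

Section Model.
Variables (R : realType) (m : nat) (c : 'M[R]_2 -> R[i]) (u : nat).
Hypothesis m_gt0 : (0 < m)%N.
Hypothesis hc : conj_invariant m c.
Local Notation om := (omega R m).
Local Notation C := R[i].
Local Notation sig := (sigma_k m c).

(** Linear functionals on the standard module, encoded as functions of the
    exponents of [z], [zbar] and of the basis vector. The algebra acts on them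
    from the right by transposition; this needs no finiteness of support and no
    division, the operators being given by recursion on the exponents. *)
Local Notation F := (nat -> nat -> bool -> C).
Implicit Types (f g : F) (e t : bool) (a b : nat).

(** The weight of a monomial under rotations. *)
Definition mono_wt a b t : int := a%:Z - b%:Z + (if t then u%:Z else - u%:Z).
Local Notation W := mono_wt.

Lemma mono_wt_flip a b t : W b a (~~ t) = - W a b t.
Proof. by rewrite /mono_wt; case: t => /=; ring. Qed.

Definition fadd f g : F := fun a b t => f a b t + g a b t.
Definition fscale (k : C) f : F := fun a b t => k * f a b t.
Definition ftrZ e f : F := fun a b t => if e then f a.+1 b t else f a b.+1 t.
Definition ftrS (n : int) f : F := fun a b t => sig (n + W a b t) * f b a (~~ t).
(** The transpose of the commutator of [w_letter e] with [z_letter e']; the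
    recursion defining [ftrW] moves a derivative past one coordinate. *)
Definition ftrC e e' f : F := fun a b t =>
  if e == e' then f a b t - ftrS 0 f a b t else ftrS (sg e) f a b t.
Definition is_rot (g : 'M[R]_2) : bool := (g 0 0 == g 1 1) && (g 0 1 == - g 1 0).
Definition ftrG (g : 'M[R]_2) f : F := fun a b t =>
  if is_rot g then (g 0 0 +i* g 1 0) ^ (- W a b t) * f a b t
  else (g 0 0 +i* g 1 0) ^ W a b t * f b a (~~ t).

Fixpoint ftrW0 e f b t : C :=
  if b is b'.+1 then ftrW0 e (ftrZ false f) b' t + ftrC e false f 0 b' t else 0.
Fixpoint ftrW e f a b t : C :=
  if a is a'.+1 then ftrW e (ftrZ true f) a' b t + ftrC e true f a' b t
  else ftrW0 e f b t.

Lemma fext f g : (forall a b t, f a b t = g a b t) -> f = g.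
Proof. by move=> h; do 3!apply/funext => ?; apply: h. Qed.

(** The recursion for [ftrW] strips the coordinate [z] first; that stripping [zbar]
    obeys the same rule at every exponent is the consistency of the relations. *)
Lemma ftrW_zz e e' f : ftrZ e' (ftrW e f) = fadd (ftrW e (ftrZ e' f)) (ftrC e e' f).
Proof.
apply: fext => a b t; case: e' => //; rewrite /fadd /=.
elim: a f => [|a IH] f //.
rewrite /= -/(ftrZ false (ftrW e f) a b t).
have -> : ftrW e (ftrZ true f) a b.+1 t =
  ftrW e (ftrZ false (ftrZ true f)) a b t + ftrC e false (ftrZ true f) a b t by exact: IH.
have -> : ftrZ false (ftrZ true f) = ftrZ true (ftrZ false f) by [].
rewrite -!addrA; congr (_ + _).
have e1 : W a b t + 1 = W a.+1 b t by rewrite /mono_wt intS; ring.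
have e2 : W a b.+1 t + 1 = W a b t by rewrite /mono_wt intS; ring.
clear IH; rewrite /ftrC /ftrS /ftrZ; case: e; rewrite /sg /= !add0r.
  have -> : -1 + W a b t = W a b.+1 t by rewrite -e2; ring.
  have -> : -1 + W a.+1 b t = W a b t by rewrite -e1; ring.
  by ring.
rewrite ![1 + _]addrC e1 e2; ring.
Qed.

Lemma ftrW_lin e k f g : ftrW e (fadd (fscale k f) g) = fadd (fscale k (ftrW e f)) (ftrW e g).
Proof.
apply: fext => a b t; elim: a f g => [|a IH] f g /=.
  rewrite /fadd /fscale /=; elim: b f g => [|b IH] f g /=; first by rewrite mulr0 addr0.
  rewrite (IH (ftrZ false f) (ftrZ false g)) /ftrC /ftrS.
  by case: (e == false); ring.
rewrite (IH (ftrZ true f) (ftrZ true g)) /fadd /fscale /= /ftrC /ftrS.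
by case: (e == true); ring.
Qed.

Lemma ftrG_gmx (bb : bool) (k : int) f a b t :
  ftrG (gmx bb (om ^ k)) f a b t =
  if bb then om ^ (k * W a b t) * f b a (~~ t) else om ^ (- (k * W a b t)) * f a b t.
Proof.
rewrite /ftrG /is_rot !mxE /=.
have eta : complex.Re (om ^ k) +i* complex.Im (om ^ k) = om ^ k by case: (om ^ k).
rewrite eta; case: bb; rewrite ?expr0 ?expr1 ?mul1r ?mulN1r.
  case: ifP => [/andP[/eqP h1 /eqP h2]|_]; last by rewrite exprz_exp.
  have := expfz_neq0 k (omega_neq0 R m_gt0); rewrite -eta.
  have -> : complex.Re (om ^ k) = 0 by lra.
  have -> : complex.Im (om ^ k) = 0 by move: h2; rewrite ?opprK; lra.
  by rewrite eqxx.
by rewrite !eqxx exprz_exp mulrN.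
Qed.

(** Either [sigma_N] vanishes or [omega ^ (2 N) = 1]. *)
Lemma sig_om N k : sig N * om ^ (k * N) = sig N * om ^ (- (k * N)).
Proof.
have /eqP := sigma_k_shift m_gt0 hc N; rewrite mulf_eq0 => /orP[/eqP ->|]; first by rewrite !mul0r.
rewrite subr_eq0 => /eqP h; congr (_ * _).
have : om ^ (k * N + k * N) = 1.
  have -> : k * N + k * N = (N *+ 2) * k by ring.
  by rewrite -exprz_exp -h exp1rz.
rewrite expfzDr ?omega_neq0 // => h'.
apply: (mulfI (expfz_neq0 (k * N) (omega_neq0 R m_gt0))).
by rewrite h' -expfzDr ?omega_neq0 // subrr.
Qed.

Section GroupElement.
Variables (bb : bool) (k : int).
Local Notation gk := (gmx bb (om ^ k)).

Lemma ftrG_lin x f g : ftrG gk (fadd (fscale x f) g) = fadd (fscale x (ftrG gk f)) (ftrG gk g).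
Proof. by apply: fext => a b t; rewrite /fadd /fscale !ftrG_gmx; case: bb; ring. Qed.

Lemma ftrG_add f g : ftrG gk (fadd f g) = fadd (ftrG gk f) (ftrG gk g).
Proof. by apply: fext => a b t; rewrite /fadd !ftrG_gmx; case: bb; ring. Qed.

Lemma ftrG_zz e f :
  ftrZ e (ftrG gk f) = fscale (om ^ (k * sg (e (+) bb))) (ftrG gk (ftrZ (e (+) bb) f)).
Proof.
apply: fext => a b t; rewrite /ftrZ /fscale !ftrG_gmx.
have e1 : W a.+1 b t = W a b t + 1 by rewrite /mono_wt intS; ring.
have e2 : W a b.+1 t = W a b t - 1 by rewrite /mono_wt intS; ring.
rewrite ?e1 ?e2; case: bb; case: e; rewrite /sg /= mulrA -expfzDr ?omega_neq0 //;
  congr (om ^ _ * _); ring.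
Qed.

Lemma ftrC_G e e' f : ftrC e e' (ftrG gk f) =
  fscale (om ^ (k * sg (e' (+) bb) - k * sg (e (+) bb)))
    (ftrG gk (ftrC (e (+) bb) (e' (+) bb) f)).
Proof.
apply: fext => a b t; rewrite /fscale /ftrC ftrG_gmx.
have -> : (e (+) bb == e' (+) bb) = (e == e') by case: e; case: e'; case: bb.
have [->|ne] := eqVneq e e'.
  rewrite subrr expr0z mul1r /ftrS !ftrG_gmx !add0r mono_wt_flip mulrN opprK negbK.
  case: bb; rewrite mulrBr; congr (_ - _).
    by rewrite sigma_kN // [RHS]mulrCA !mulrA sig_om.
  by rewrite [RHS]mulrCA !mulrA sig_om.
have -> : e' = ~~ e by case: e e' ne => [] [].
have sgNb x : sg (~~ x) = - sg x by case: x.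
have oM x y : om ^ (x + y) = om ^ x * om ^ y by rewrite expfzDr ?omega_neq0.
rewrite addNb sgNb /ftrS !ftrG_gmx mono_wt_flip; set N := W a b t.
case: bb; rewrite ?addbT ?addbF ?sgNb ?negbK ?sgNb.
  have -> : sig (- sg e - N) = sig (sg e + N) by rewrite -sigma_kN // opprD !opprK.
  have -> : k * - N = - (k * (sg e + N)) + k * sg e by ring.
  have -> : k * - - sg e - k * - sg e = k * sg e + k * sg e by ring.
  have -> : k * N = k * (sg e + N) - k * sg e by ring.
  rewrite !oM; have := sig_om (sg e + N) k => h.
  transitivity (sig (sg e + N) * om ^ (k * (sg e + N)) * om ^ (k * sg e) * f a b t).
    by rewrite h; ring.
  have h2 : om ^ (k * sg e) * om ^ (- (k * sg e)) = 1 by rewrite -oM subrr.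
  rewrite -[LHS]mul1r -h2; ring.
have -> : - (k * - N) = k * (sg e + N) - k * sg e by ring.
have -> : k * - sg e - k * sg e = - (k * sg e) - k * sg e by ring.
have -> : - (k * N) = - (k * (sg e + N)) + k * sg e by ring.
rewrite !oM; have := sig_om (sg e + N) k => h.
transitivity (sig (sg e + N) * om ^ (k * (sg e + N)) * om ^ (- (k * sg e)) * f b a (~~ t)).
  by ring.
have h2 : om ^ (k * sg e) * om ^ (- (k * sg e)) = 1 by rewrite -oM subrr.
rewrite h -[LHS]mul1r -h2; ring.
Qed.

Lemma ftrW_0 e : ftrW e (fun _ _ _ => 0) = fun _ _ _ => 0.
Proof.
have z0 : (fun (_ _ : nat) (_ : bool) => 0 : C) = fscale 0 (fun _ _ _ => 0).
  by apply: fext => a b t; rewrite /fscale mul0r.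
have z1 g : fadd (fscale 0 g) (fun _ _ _ => 0) = fun _ _ _ => 0.
  by apply: fext => a b t; rewrite /fscale /fadd mul0r addr0.
have := ftrW_lin e (-1) (fun _ _ _ => 0) (fun _ _ _ => 0).
have -> : fadd (fscale (-1) (fun _ _ _ => 0)) (fun _ _ _ => 0) = fun _ _ _ => 0.
  by apply: fext => a b t; rewrite /fscale /fadd mulr0 addr0.
by move=> ->; apply: fext => a b t; rewrite /fscale /fadd mulN1r addNr.
Qed.

Lemma ftrW_scale e x f : ftrW e (fscale x f) = fscale x (ftrW e f).
Proof.
have h : forall g, fadd g (fun _ _ _ => 0) = g by move=> g; apply: fext => a b t; rewrite /fadd addr0.
by rewrite -[fscale x f]h ftrW_lin ftrW_0 h.
Qed.

Lemma ftrW_add e f g : ftrW e (fadd f g) = fadd (ftrW e f) (ftrW e g).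
Proof.
have h : forall g, fscale 1 g = g by move=> g'; apply: fext => a b t; rewrite /fscale mul1r.
by rewrite -[f in LHS]h ftrW_lin h.
Qed.

Lemma mono_ind (P : nat -> nat -> Prop) : P 0%N 0%N ->
  (forall b, P 0%N b -> P 0%N b.+1) -> (forall a b, P a b -> P a.+1 b) ->
  forall a b, P a b.
Proof. by move=> h0 hb ha a b; elim: a => [|a /ha //]; elim: b => [|b /hb]. Qed.

Lemma ftrW_G e f : ftrW e (ftrG gk f) =
  fscale (om ^ (- (k * sg (e (+) bb)))) (ftrG gk (ftrW (e (+) bb) f)).
Proof.
have oM x y : om ^ (x + y) = om ^ x * om ^ y by rewrite expfzDr ?omega_neq0.
pose P a b := forall f t, ftrW e (ftrG gk f) a b t =
  fscale (om ^ (- (k * sg (e (+) bb)))) (ftrG gk (ftrW (e (+) bb) f)) a b t.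
have step e' a b : P a b -> forall g t, ftrZ e' (ftrW e (ftrG gk g)) a b t =
    ftrZ e' (fscale (om ^ (- (k * sg (e (+) bb)))) (ftrG gk (ftrW (e (+) bb) g))) a b t.
  move=> hP g t; rewrite ftrW_zz ftrG_zz ftrW_scale ftrC_G.
  have -> : ftrZ e' (fscale (om ^ (- (k * sg (e (+) bb)))) (ftrG gk (ftrW (e (+) bb) g))) =
    fscale (om ^ (- (k * sg (e (+) bb)))) (ftrZ e' (ftrG gk (ftrW (e (+) bb) g))) by case: (e').
  rewrite ftrG_zz ftrW_zz ftrG_add /fadd /fscale hP /fscale oM; ring.
move: f; suff H : forall a b, P a b by move=> f; apply: fext => a b t; apply: H.
apply: mono_ind => [f t|b hP f t|a b hP f t].
- by rewrite /fscale ftrG_gmx /=; case: bb; rewrite !mulr0.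
- exact: (step false 0%N b hP f t).
- exact: (step true a b hP f t).
Qed.

End GroupElement.

Lemma ftrW_sum e n (x : nat -> C) (h : nat -> F) :
  ftrW e (fun a b t => \sum_(1 <= j < n) x j * h j a b t) =
  fun a b t => \sum_(1 <= j < n) x j * ftrW e (h j) a b t.
Proof.
elim: n => [|n IH].
  have -> : (fun a b t => \sum_(1 <= j < 0) x j * h j a b t) = fun _ _ _ => 0.
    by apply: fext => a b t; rewrite big_geq.
  by rewrite ftrW_0; apply: fext => a b t; rewrite big_geq.
case: n IH => [|n] IH.
  have -> : (fun a b t => \sum_(1 <= j < 1) x j * h j a b t) = fun _ _ _ => 0.
    by apply: fext => a b t; rewrite big_geq.
  by rewrite ftrW_0; apply: fext => a b t; rewrite big_geq.
have -> : (fun a b t => \sum_(1 <= j < n.+2) x j * h j a b t) =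
   fadd (fscale (x n.+1) (h n.+1)) (fun a b t => \sum_(1 <= j < n.+1) x j * h j a b t).
  by apply: fext => a b t; rewrite big_nat_recr //= /fadd /fscale addrC.
rewrite ftrW_lin IH; apply: fext => a b t.
by rewrite big_nat_recr //= /fadd /fscale addrC.
Qed.

Lemma ftrS_sum n f : ftrS n f = fun a b t =>
  \sum_(1 <= j < m.+1) (c (refl R m j) * om ^ (n * j%:Z)) * ftrG (gmx true (om ^ j%:Z)) f a b t.
Proof.
apply: fext => a b t; rewrite /ftrS /sigma_k mulr_suml; apply: eq_bigr => j _.
rewrite ftrG_gmx mulrDl expfzDr ?omega_neq0 // -!mulrA; congr (_ * (_ * (om ^ _ * _))).
by rewrite mulrC.
Qed.

Lemma ftrW_S e n f : ftrW e (ftrS n f) = ftrS (n + sg e) (ftrW (~~ e) f).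
Proof.
rewrite !ftrS_sum ftrW_sum; apply: fext => a b t; apply: eq_bigr => j _.
rewrite ftrW_G addbT /fscale mulrA; congr (_ * _); rewrite -mulrA -expfzDr ?omega_neq0 //.
by congr (_ * om ^ _); case: e; rewrite /sg /=; ring.
Qed.

(** The Dunkl operators commute: their commutator commutes with multiplication
    by coordinates and vanishes in degree 0. *)
Lemma ftrW_comm f : ftrW true (ftrW false f) = ftrW false (ftrW true f).
Proof.
pose P a b := forall f t, ftrW true (ftrW false f) a b t = ftrW false (ftrW true f) a b t.
have oppD g1 g2 : (fun a b t => g1 a b t - g2 a b t) = fadd (fscale (-1) g2) g1 :> F.
  by apply: fext => a b t; rewrite /fadd /fscale mulN1r addrC.
have Ceq e g : ftrC e e g = fadd (fscale (-1) (ftrS 0 g)) g.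
  by rewrite -oppD; apply: fext => a b t; rewrite /ftrC eqxx.
have CTF g : ftrC true false g = ftrS (-1) g by [].
have CFT g : ftrC false true g = ftrS 1 g by [].
have step e a b : P a b -> forall g t, ftrZ e (ftrW true (ftrW false g)) a b t =
    ftrZ e (ftrW false (ftrW true g)) a b t.
  move=> hP g t; rewrite !ftrW_zz !ftrW_add /fadd hP -!addrA; congr (_ + _).
  case: e.
    rewrite !CFT !(Ceq true) ftrW_lin !ftrW_S /fadd /fscale /sg addrN add0r /=; ring.
  rewrite !CTF !(Ceq false) ftrW_lin !ftrW_S /fadd /fscale /sg addNr add0r /=; ring.
move: f; suff H : forall a b, P a b by move=> f; apply: fext => a b t; apply: H.
apply: mono_ind => [f t|b hP f t|a b hP f t] //.
- exact: (step false 0%N b hP f t).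
- exact: (step true a b hP f t).
Qed.

End Model.

Section Evaluation.
Variables (R : realType) (m : nat) (c : 'M[R]_2 -> R[i]) (u : nat).
Hypothesis m_gt0 : (0 < m)%N.
Hypothesis hc : conj_invariant m c.
Local Notation om := (omega R m).
Local Notation C := R[i].
Local Notation F := (nat -> nat -> bool -> C).
Local Notation ftrW := (ftrW m c u).
Local Notation ftrG := (ftrG u).
Local Notation ftrC := (ftrC m c u).
Implicit Types (f g : F) (e t : bool) (a b : nat).

Definition vcoord (v : 'cV[C]_2) e : C := v 0 0 + (if e then 'i else - 'i) * v 1 0.
Definition fcoord (f : 'rV[C]_2) e : C := (f 0 0 + (if e then - 'i else 'i) * f 0 1) / 2.

Definition lcomb (x y : C) f g : F := fadd (fscale x f) (fscale y g).

Fixpoint ev (h : term R m) (f : F) : F :=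
  match h with
  | Scal k => fscale k f
  | Vec v => lcomb (vcoord v true) (vcoord v false) (ftrW true f) (ftrW false f)
  | Cov x => lcomb (fcoord x true) (fcoord x false) (ftrZ true f) (ftrZ false f)
  | Grp g _ => ftrG g f
  | Add h1 h2 => fadd (ev h1 f) (ev h2 f)
  | Mul h1 h2 => ev h2 (ev h1 f)
  end.

Lemma ev_lin h x f g : ev h (fadd (fscale x f) g) = fadd (fscale x (ev h f)) (ev h g).
Proof.
elim: h f g => [k|v|y|A hA|h1 IH1 h2 IH2|h1 IH1 h2 IH2] f g /=.
- by apply: fext => a b t; rewrite /fadd /fscale; ring.
- by rewrite !ftrW_lin; apply: fext => a b t; rewrite /lcomb /fadd /fscale; ring.
- by apply: fext => a b t; rewrite /lcomb /fadd /fscale /ftrZ; ring.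
- by have [b [k ->]] := dihedral_gmx m_gt0 hA; rewrite ftrG_lin.
- by rewrite IH1 IH2; apply: fext => a b t; rewrite /fadd /fscale; ring.
- by rewrite IH1 IH2.
Qed.

Lemma ev_scale h x f : ev h (fscale x f) = fscale x (ev h f).
Proof.
have h0 : ev h (fun _ _ _ => 0) = fun _ _ _ => 0.
  have := ev_lin h (-1) (fun _ _ _ => 0) (fun _ _ _ => 0).
  have -> : fadd (fscale (-1) (fun _ _ _ => 0)) (fun _ _ _ => 0) = (fun _ _ _ => 0) :> F.
    by apply: fext => a b t; rewrite /fscale /fadd mulr0 addr0.
  by move=> ->; apply: fext => a b t; rewrite /fscale /fadd mulN1r addNr.
have h1 : forall g, fadd g (fun _ _ _ => 0) = g by move=> g; apply: fext => a b t; rewrite /fadd addr0.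
by rewrite -[fscale x f]h1 ev_lin h0 h1.
Qed.

Lemma ev_add h f g : ev h (fadd f g) = fadd (ev h f) (ev h g).
Proof.
have h1 : forall g, fscale 1 g = g by move=> g'; apply: fext => a b t; rewrite /fscale mul1r.
by rewrite -[f in LHS]h1 ev_lin h1.
Qed.

Lemma vcoord_gmx bb (k : int) v e :
  vcoord (cplx_mx (gmx bb (om ^ k)) *m v) e = om ^ (k * (if e then 1 else -1)) * vcoord v (e (+) bb).
Proof.
have [h1 h2] := omz_ReIm R m_gt0 k; have := sqrCi C => i2.
have -> : om ^ (k * (if e then 1 else -1)) =
    (complex.Re (om ^ k))%:C + (if e then 'i else - 'i) * (complex.Im (om ^ k))%:C.
  by case: e; rewrite ?mulr1 ?mulrN1 ?h2 -?h1 // mulNr.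
rewrite /vcoord !mxE !big_ord_recl !big_ord0 !mxE /=.
rewrite (_ : lift 0 0 = 1); last exact/val_inj.
by case: e; case: bb; rewrite /= ?expr0 ?expr1 ?mulN1r ?mul1r ?rmorphN /=; ring: i2.
Qed.

Lemma fcoord_gmx bb (k : int) x e :
  fcoord (x *m cplx_mx (gmx bb (om ^ k))) e =
  om ^ (k * (if e (+) bb then 1 else -1)) * fcoord x (e (+) bb).
Proof.
have [h1 h2] := omz_ReIm R m_gt0 k; have := sqrCi C => i2.
have E : forall b : bool, om ^ (k * (if b then 1 else -1)) =
    (complex.Re (om ^ k))%:C + (if b then 'i else - 'i) * (complex.Im (om ^ k))%:C.
  by case; rewrite ?mulr1 ?mulrN1 ?h2 -?h1 // mulNr.
rewrite E /fcoord !mxE !big_ord_recl !big_ord0 !mxE /=.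
rewrite (_ : lift 0 0 = 1); last exact/val_inj.
by case: e; case: bb; rewrite /= ?expr0 ?expr1 ?mulN1r ?mul1r ?rmorphN /=; field: i2.
Qed.

Lemma pairing_coord x v :
  pairing x v = fcoord x true * vcoord v true + fcoord x false * vcoord v false :> C.
Proof.
rewrite /pairing /fcoord /vcoord !mxE !big_ord_recl big_ord0.
have := sqrCi C => i2; rewrite (_ : lift 0 0 = 1); last exact/val_inj.
by field: i2.
Qed.

Lemma pairing_alpha j x v :
  2 * (pairing x (cplx_mx (alpha R m j)) * pairing (cplx_mx (coalpha R m j)) v) =
  fcoord x true * vcoord v true + fcoord x false * vcoord v false
  - fcoord x true * vcoord v false * om ^ j%:Z - fcoord x false * vcoord v true * om ^ (- j%:Z).
Proof.
have hp' : om ^ j%:Z = expi (2 * theta R m j) by rewrite -[om ^ _]/(om ^+ _) omega_expi.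
have hn : om ^ (- j%:Z) = (expi (2 * theta R m j))^* by rewrite -conj_omz // hp'.
rewrite hp' hn /expi.
have hcos : cos (2 * theta R m j) = 1 - 2 * sin (theta R m j) ^+ 2.
  by rewrite mulr_natl cos_mulr2n cos2sin2 mulr2n; ring.
have hsin : sin (2 * theta R m j) = 2 * (sin (theta R m j) * cos (theta R m j)).
  by rewrite mulr_natl sin_mulr2n mulr2n; ring.
have hC (x' y' : R) : x' +i* y' = x'%:C + 'i * y'%:C.
  rewrite -complexiE; apply/eqP; rewrite eq_complex /=.
  by apply/andP; split; apply/eqP; ring.
have hCc (x' y' : R) : (x' +i* y')^* = x'%:C - 'i * y'%:C.
  rewrite -complexiE; apply/eqP; rewrite eq_complex /=.
  by apply/andP; split; apply/eqP; ring.
have r2 : (2 : R)%:C = 2 :> C by rewrite -[RHS](rmorph_nat (real_complex R)).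
rewrite hCc hC hcos hsin expr2 !(rmorphB, rmorphM, rmorph1) /= r2.
have cs : (cos (theta R m j))%:C ^+ 2 = 1 - (sin (theta R m j))%:C ^+ 2 :> C.
  by apply/eqP; rewrite -subr_eq opprK -!rmorphXn /= -rmorphD /= cos2Dsin2.
have := sqrCi C => i2.
rewrite /pairing /fcoord /vcoord !mxE !big_ord_recl !big_ord0 !mxE /= rmorphN /=.
rewrite (_ : lift 0 0 = 1); last exact/val_inj.
by move: cs; set cc := (cos _)%:C; set ss := (sin _)%:C => cs; field: i2 cs.
Qed.

Lemma ev_sum f n (x : nat -> term R m) :
  ev (\big[@Add R m/Scal m 0]_(1 <= j < n) x j) f = fun a b t => \sum_(1 <= j < n) ev (x j) f a b t.
Proof.
have h0 : fscale 0 f = fun _ _ _ => 0 by apply: fext => a b t; rewrite /fscale mul0r.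
apply: fext => a b t; rewrite unlock; elim: (index_iota 1 n) => [|j r IH]; first by rewrite /= h0.
by rewrite /= /fadd IH.
Qed.

Lemma ev_refl_term j f : (0 < j <= m)%N -> ev (refl_term R m j) f = ftrG (gmx true (om ^ j%:Z)) f.
Proof.
rewrite /refl_term; case: pselect => [hj _|//].
rewrite [LHS]/= refl_gmx // exprnP; reflexivity.
Qed.

Lemma ev_VecCov v x f a b t :
  ev (Mul (Vec m v) (Cov m x)) f a b t - ev (Mul (Cov m x) (Vec m v)) f a b t =
  pairing x v * f a b t - 2 * \sum_(1 <= j < m.+1)
    (c (refl R m j) * pairing x (cplx_mx (alpha R m j)) * pairing (cplx_mx (coalpha R m j)) v)
    * ftrG (gmx true (om ^ j%:Z)) f a b t.
Proof.
have hT e e' : ftrZ e' (ftrW e f) a b t = ftrW e (ftrZ e' f) a b t + ftrC e e' f a b t.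
  by rewrite ftrW_zz.
have L : ev (Mul (Vec m v) (Cov m x)) f a b t - ev (Mul (Cov m x) (Vec m v)) f a b t =
   fcoord x true * vcoord v true * ftrC true true f a b t
   + fcoord x false * vcoord v false * ftrC false false f a b t
   + fcoord x true * vcoord v false * ftrC false true f a b t
   + fcoord x false * vcoord v true * ftrC true false f a b t.
  rewrite /= /lcomb /fadd /fscale.
  have zl e (y y' : C) (g g' : F) : ftrZ e (fun a b t => y * g a b t + y' * g' a b t) a b t
     = y * ftrZ e g a b t + y' * ftrZ e g' a b t by rewrite /ftrZ; case: e.
  have wl e (y y' : C) (g g' : F) : ftrW e (fun a b t => y * g a b t + y' * g' a b t) a b t
     = y * ftrW e g a b t + y' * ftrW e g' a b t.
    by have := ftrW_add m c u e (fscale y g) (fscale y' g'); rewrite !ftrW_scale => ->.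
  rewrite !zl !wl !hT; ring.
rewrite L /ftrC /= pairing_coord.
have hS n : ftrS m c u n f a b t = \sum_(1 <= j < m.+1)
   (c (refl R m j) * om ^ (n * j%:Z)) * ftrG (gmx true (om ^ j%:Z)) f a b t by rewrite ftrS_sum.
rewrite !hS.
have -> : 2 * \sum_(1 <= j < m.+1) (c (refl R m j) * pairing x (cplx_mx (alpha R m j)) *
   pairing (cplx_mx (coalpha R m j)) v * ftrG (gmx true (om ^ j%:Z)) f a b t) =
   (fcoord x true * vcoord v true + fcoord x false * vcoord v false) *
     (\sum_(1 <= j < m.+1) c (refl R m j) * om ^ (0 * j%:Z) * ftrG (gmx true (om ^ j%:Z)) f a b t)
   - fcoord x true * vcoord v false *
     (\sum_(1 <= j < m.+1) c (refl R m j) * om ^ (1 * j%:Z) * ftrG (gmx true (om ^ j%:Z)) f a b t)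
   - fcoord x false * vcoord v true *
     (\sum_(1 <= j < m.+1) c (refl R m j) * om ^ (-1 * j%:Z) * ftrG (gmx true (om ^ j%:Z)) f a b t).
  rewrite !mulr_sumr -!sumrB; apply: eq_bigr => j _.
  have := pairing_alpha j x v; rewrite mul0r mul1r mulN1r expr0z => h.
  transitivity (c (refl R m j) * ftrG (gmx true (om ^ j%:Z)) f a b t *
   (2 * (pairing x (cplx_mx (alpha R m j)) * pairing (cplx_mx (coalpha R m j)) v))); first by ring.
  by rewrite h; ring.
rewrite /sg; ring.
Qed.

(** The transposed operators satisfy all defining relations. *)
Lemma ev_eqv h h' : eqv c h h' -> forall f, ev h f = ev h' f.
Proof.
elim=> {h h'}.
- by [].
- by move=> h h' _ IH f; rewrite IH.
- by move=> h1 h2 h3 _ IH1 _ IH2 f; rewrite IH1 IH2.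
- by move=> h1 h1' h2 h2' _ IH1 _ IH2 f /=; rewrite IH1 IH2.
- by move=> h1 h1' h2 h2' _ IH1 _ IH2 f /=; rewrite IH1 IH2.
- by move=> h1 h2 h3 f /=; apply: fext => a b t; rewrite /fadd addrA.
- by move=> h1 h2 f /=; apply: fext => a b t; rewrite /fadd addrC.
- by move=> h1 f /=; apply: fext => a b t; rewrite /fadd /fscale mul0r add0r.
- move=> h1 f /=; rewrite ev_scale; apply: fext => a b t.
  by rewrite /fadd /fscale mulN1r addNr mul0r.
- by [].
- by move=> h1 f /=; congr (ev h1); apply: fext => a b t; rewrite /fscale mul1r.
- by move=> h1 h2 h3 f /=; rewrite ev_add.
- by [].
- by move=> k l f /=; apply: fext => a b t; rewrite /fadd /fscale mulrDl.
- by move=> k l f /=; apply: fext => a b t; rewrite /fscale mulrCA mulrA.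
- by move=> k h1 f /=; rewrite ev_scale.
- move=> k v w' f /=; rewrite !ftrW_scale; apply: fext => a b t; rewrite /lcomb /fadd /fscale /vcoord !mxE.
  ring.
- move=> k x x' f /=; apply: fext => a b t; rewrite /lcomb /fadd /fscale /ftrZ /fcoord !mxE.
  by field.
- move=> h1 f /=; apply: fext => a b t.
  have e1 : 1%:M = gmx false (om ^ 0) by rewrite expr0z gmx1.
  by rewrite {1}e1 ftrG_gmx // mul0r oppr0 expr0z /fscale.
- move=> g h hg hh hgh f /=; apply: fext => a b t.
  have [b1 [k1 e1]] := dihedral_gmx m_gt0 hg; have [b2 [k2 e2]] := dihedral_gmx m_gt0 hh.
  rewrite e1 e2 gmxM.
  have -> : om ^ k1 * (if b1 then (om ^ k2)^* else om ^ k2) = om ^ (k1 + if b1 then - k2 else k2).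
    by case: b1 {e1}; rewrite ?conj_omz // expfzDr ?omega_neq0.
  rewrite !ftrG_gmx //; case: b1 {e1}; case: b2 {e2}; rewrite /= ?mono_wt_flip ?negbK mulrA
    -expfzDr ?omega_neq0 //; congr (om ^ _ * _); ring.
- move=> g hg v f /=; have [bb [k e]] := dihedral_gmx m_gt0 hg; rewrite e.
  rewrite !vcoord_gmx // !ftrW_G //; apply: fext => a b t.
  rewrite /lcomb /fadd /fscale !ftrG_gmx //; case: bb {e}; rewrite /sg /= ?mulr1 ?mulrN1 ?opprK; ring.
- move=> g hg x f /=; have [bb [k e]] := dihedral_gmx m_gt0 hg; rewrite e inv_gmx //.
  rewrite !fcoord_gmx // !ftrG_zz //; apply: fext => a b t.
  rewrite /lcomb /fadd /fscale !ftrG_gmx //; case: bb {e}; rewrite /sg /= ?mulr1 ?mulrN1 ?opprK; ring.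
- move=> v w' f /=; rewrite /lcomb !ftrW_lin !ftrW_scale !ftrW_comm //.
  apply: fext => a b t; rewrite /fadd /fscale; ring.
- move=> x x' f /=; apply: fext => a b t; rewrite /lcomb /fadd /fscale /ftrZ; ring.
- move=> v x f; apply: fext => a b t.
  transitivity (ev (Mul (Vec m v) (Cov m x)) f a b t
     + ev (Mul (Cov m x) (Vec m v)) (fscale (-1) f) a b t); first by [].
  rewrite ev_scale [fscale _ _ _ _ _]/fscale mulN1r ev_VecCov.
  set big := \big[_/_]_(_ <- _ | _) _.
  transitivity (fscale (pairing x v) f a b t + ev big (fscale (- 2) f) a b t); last by [].
  rewrite ev_scale /big ev_sum /fscale mulNr; congr (_ - _ * _).
  rewrite !big_nat; apply: eq_bigr => j hj.
  set k := (X in Scal m X).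
  transitivity (ev (refl_term R m j) (fscale k f) a b t); last by [].
  by rewrite ev_scale ev_refl_term.
Qed.

Local Notation H := (cherednik m c).
Definition ev_class (h : H) : F -> F := ev (repr h).

Lemma evH_cls h f : ev_class (cls c h) f = ev h f.
Proof. exact/ev_eqv/eqv_repr. Qed.

Lemma evHD h h' f a b t : ev_class (h + h') f a b t = ev_class h f a b t + ev_class h' f a b t.
Proof. by elim/clsP: h => h; elim/clsP: h' => h'; rewrite -clsDE !evH_cls. Qed.

Lemma evHM h h' f : ev_class (h * h') f = ev_class h' (ev_class h f).
Proof. by elim/clsP: h => h; elim/clsP: h' => h'; rewrite -clsME !evH_cls. Qed.

Lemma evHZ k h f : ev_class (k *: h) f = ev_class h (fscale k f).
Proof. by elim/clsP: h => h; rewrite -clsZE !evH_cls. Qed.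

(** The functional on the free module of rank two attached to [f]; it vanishes
    on the relations of the standard module. *)
Definition ev_pair f (p : 'rV[H]_2) : C :=
  ev_class (p 0 0) f 0 0 true + ev_class (p 0 1) f 0 0 false.

Lemma pairHD f p q : ev_pair f (p + q) = ev_pair f p + ev_pair f q.
Proof. by rewrite /ev_pair !mxE !evHD addrACA. Qed.

Lemma pairHM f h p : ev_pair f (h *: p) = ev_pair (ev_class h f) p.
Proof. by rewrite /ev_pair !mxE !evHM. Qed.

End Evaluation.

(** * Functionals on the standard module *)

Section Functionals.
Variables (R : realType) (m : nat) (c : 'M[R]_2 -> R[i]) (u : nat).
Hypothesis m_gt0 : (0 < m)%N.
Hypothesis hc : conj_invariant m c.
Local Notation C := R[i].
Local Notation H := (cherednik m c).
Local Notation M := (std_module m c u).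
Local Notation F := (nat -> nat -> bool -> C).
Local Notation evH := (@ev_class R m c u).
Local Notation pairH := (@ev_pair R m c u).
Implicit Types (f : F).

Lemma evH1 f : evH 1 f = f.
Proof.
rewrite (_ : 1 = cls c (Scal m 1)) // evH_cls //=.
by apply: fext => a b t; rewrite /fscale mul1r.
Qed.

Lemma evH0 f a b t : evH 0 f a b t = 0.
Proof. by rewrite (_ : 0 = cls c (Scal m 0)) // evH_cls //= /fscale mul0r. Qed.

Lemma one_neq0 : 1 != 0 :> H.
Proof.
apply/eqP => h; have := evH1 (fun _ _ _ => 1); rewrite h => /(congr1 (fun f : F => f 0%N 0%N true)).
by rewrite evH0 => /esym/eqP; rewrite oner_eq0.
Qed.

Lemma pairH0 f : pairH f 0 = 0.
Proof. by rewrite /ev_pair !mxE !evH0 addr0. Qed.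

Lemma pairHB f p q : pairH f (p - q) = pairH f p - pairH f q.
Proof.
apply/eqP; rewrite -[X in _ == X]addr0 -(subrr (pairH f q)) eq_sym.
by apply/eqP; rewrite subrr addr0 -[p in LHS](subrK q) pairHD // addrK.
Qed.

Definition gen t : 'rV[H]_2 := if t then gen_z m c else gen_zbar m c.

Lemma pairH_gen f t : pairH f (gen t) = f 0%N 0%N t.
Proof. by rewrite /ev_pair /gen; case: t; rewrite !mxE /= evH1 evH0 ?addr0 ?add0r. Qed.

Lemma pairH_rel p : std_rel u p -> forall f, pairH f p = 0.
Proof.
elim=> {p}.
- exact: pairH0.
- by move=> p q _ h1 _ h2 f; rewrite pairHD // h1 h2 addr0.
- by move=> h p _ IH f; rewrite pairHM.
- move=> v f; rewrite pairHM // (pairH_gen _ true) evH_cls //=.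
  by rewrite /lcomb /fadd /fscale !mulr0 addr0.
- move=> v f; rewrite pairHM // (pairH_gen _ false) evH_cls //=.
  by rewrite /lcomb /fadd /fscale !mulr0 addr0.
- move=> j hj f; rewrite pairHB !pairHM // (pairH_gen _ true) (pairH_gen _ false) !evH_cls //.
  rewrite ev_refl_term // ftrG_gmx //= /fscale /mono_wt subr0 add0r.
  by rewrite PoszM subrr.
- move=> j hj f; rewrite pairHB !pairHM // (pairH_gen _ true) (pairH_gen _ false) !evH_cls //.
  rewrite ev_refl_term // ftrG_gmx //= /fscale /mono_wt subr0 add0r.
  by rewrite PoszM mulrN subrr.
Qed.

Definition Phi f (p : M) : C := pairH f (repr p).

Lemma Phi_mcls f p : Phi f (mcls u p) = pairH f p.
Proof.
have := pairH_rel (std_rel_repr u p) f; rewrite pairHB => /eqP.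
by rewrite subr_eq0 => /eqP.
Qed.

Lemma PhiD f p q : Phi f (p + q) = Phi f p + Phi f q.
Proof.
elim/mclsP: p => p; elim/mclsP: q => q.
have -> : mcls u p + mcls u q = mcls u (p + q) by rewrite -mclsD.
by rewrite !Phi_mcls pairHD.
Qed.

Lemma Phi_act f h p : Phi f (act h p) = Phi (evH h f) p.
Proof. by elim/mclsP: p => p; rewrite mclsZ !Phi_mcls pairHM. Qed.

Lemma PhiZ f (k : C) p : Phi f (k *: p) = k * Phi f p.
Proof.
have -> : k *: p = act (of_scal m c k) p by [].
rewrite Phi_act evH_cls //=; elim/mclsP: p => p; rewrite !Phi_mcls /ev_pair.
have E h a b t : evH h (fscale k f) a b t = k * evH h f a b t by rewrite /ev_class ev_scale.
by rewrite !E mulrDr.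
Qed.

End Functionals.

(** * The Cherednik algebra satisfies the abstract relations *)

Section Instantiation.
Variables (R : realType) (m : nat) (c : 'M[R]_2 -> R[i]) (u : nat).
Hypothesis m_gt0 : (0 < m)%N.
Hypothesis hc : conj_invariant m c.
Local Notation om := (omega R m).
Local Notation C := R[i].
Local Notation H := (cherednik m c).
Local Notation M := (std_module m c u).

Definition cherednik_nzSemiRing : nzSemiRingType :=
  HB.pack H (GRing.PzSemiRing_isNonZero.Build H (one_neq0 0 m_gt0 hc)).
Definition cherednik_lSemiAlg : lSemiAlgType C :=
  HB.pack H (GRing.PzSemiRing_isNonZero.Build H (one_neq0 0 m_gt0 hc))
    (GRing.LSemiModule_isLSemiAlgebra.Build C cherednik_nzSemiRing
       (fun a x y => esym (chZl a x y))).
(** The Cherednik algebra is nonzero because it acts nontrivially on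
    functionals; this allows the algebra structure, over the same operations. *)
Definition cherednik_alg : algType C :=
  HB.pack H (GRing.PzSemiRing_isNonZero.Build H (one_neq0 0 m_gt0 hc))
    (GRing.LSemiModule_isLSemiAlgebra.Build C cherednik_nzSemiRing
       (fun a x y => esym (chZl a x y)))
    (GRing.LSemiAlgebra_isSemiAlgebra.Build C cherednik_lSemiAlg
       (fun a x y => esym (chZr a x y))).
Local Notation A := cherednik_alg.
Local Notation zz := (z_letter m c : bool -> A).
Local Notation ww := (w_letter m c : bool -> A).
Local Notation S := (refl_sum m c : int -> A).

Definition group_elements : set A := [set h | exists g (hg : dihedral m g), h = of_grp c hg].

Lemma mulA_E (x y : A) : x * y = (x : H) * (y : H). Proof. by []. Qed.

Lemma group_Gzw g : group_elements g -> exists (b : bool) (k : int) (hg : dihedral m (gmx b (om ^ k))),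
  g = of_grp c hg.
Proof.
move=> [g' [hg ->]]; have [b [k E]] := dihedral_gmx m_gt0 hg; exists b, k.
by move: hg; rewrite E => hg; exists hg.
Qed.

Lemma of_grp1 : group_elements 1.
Proof.
have hg : dihedral m (1%:M : 'M[R]_2) by left.
by exists 1%:M, hg; symmetry; apply/cls_eqv/eqv_Grp1.
Qed.

Lemma dihedral_mul g h : dihedral m g -> dihedral m h -> dihedral m (g *m h : 'M[R]_2).
Proof.
elim=> [|j g' hj _ IH] hh; first by rewrite mul1mx.
by rewrite -mulmxA; apply: dihedralM => //; apply: IH.
Qed.

Lemma of_grpM g h : group_elements g -> group_elements h -> group_elements (g * h).
Proof.
move=> [g' [hg ->]] [h' [hh ->]]; exists (g' *m h'), (dihedral_mul hg hh).
by rewrite mulA_E [LHS]clsM; apply/cls_eqv/eqv_GrpM.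
Qed.

(** Left multiplications by the generators reach everything from 1. *)
Lemma ch_word_ind (P : set H) : subspace P -> P 1 ->
  (forall e x, P x -> P (z_letter m c e * x)) -> (forall e x, P x -> P (w_letter m c e * x)) ->
  (forall g (hg : dihedral m g) x, P x -> P (of_grp c hg * x)) -> forall x, P x.
Proof.
move=> [P0 PD] P1 Pz Pw Pg x; suff h : forall t y, P y -> P (cls c t * y).
  by elim/clsP: x => t; rewrite -[cls c t]mulr1; apply: h.
have PZ k y : P y -> P (k *: y) by move=> hy; rewrite -[k *: y]addr0; apply: PD.
elim=> [k|v|f|g hg|t1 IH1 t2 IH2|t1 IH1 t2 IH2] y hy.
- by rewrite -[cls c _ * y]ch_scaleE; apply: PZ.
- rewrite -/(of_vec m c v) of_vec_ww mulrDl !chZl; apply: PD; first exact: Pw.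
  by apply/PZ/Pw.
- rewrite -/(of_cov m c f) of_cov_zz mulrDl !chZl; apply: PD; first exact: Pz.
  by apply/PZ/Pz.
- exact: Pg.
- by rewrite clsDE mulrDl -[X in P X]scale1r scalerDr; apply: PD; [exact: IH1 | rewrite scale1r; exact: IH2].
- by rewrite clsME -mulrA; apply/IH1/IH2.
Qed.

Lemma cherednik_relP : cherednik_rel zz ww S group_elements.
Proof.
split.
- exact: zzC.
- exact: wwC.
- exact: (br_ww_zz c m_gt0).
- exact: (refl_sum_zz c m_gt0).
- exact: (refl_sum_ww c m_gt0).
- move=> n; have hsp := span_subspace group_elements.
  rewrite /refl_sum big_nat.
  refine (@subspace_sum _ A _ _ _ _ (fun j => (c (refl R m j) * om ^ (n * j%:Z)) *: (srefl m c j : A)) hsp _).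
  move=> j hj.
  apply: (subspaceZ _ hsp); apply: sub_span; have [hg ->] := sreflE c m_gt0 hj.
  by exists (gmx true (om ^ j%:Z)), hg.
- exact: of_grp1.
- exact: of_grpM.
- move=> g /group_Gzw [b [k [hg ->]]]; exists b, (fun e => om ^ (k * sg (e (+) b))); split.
  + rewrite -expfzDr ?omega_neq0 //; have -> : k * sg (true (+) b) + k * sg (false (+) b) = 0.
      by rewrite /sg; case: (b) => /=; ring.
    by [].
  + by move=> e; apply: (grp_zz c m_gt0).
  + move=> e; have -> : k * sg (~~ e (+) b) = - (k * sg (e (+) b)).
      by rewrite /sg; case: (b); case: (e) => /=; ring.
    exact: (grp_ww c m_gt0).
- move=> P hP h1 hz hw hg; apply: ch_word_ind => // g hg' x; apply: hg.
  by exists g, hg'.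
Qed.

Definition std_v t : M := mcls u (gen m c t).

Lemma std_gens (p : M) : exists h : bool -> A,
  p = act (h true) (std_v true) + act (h false) (std_v false).
Proof.
elim/mclsP: p => p; exists (fun t => if t then p 0 0 else p 0 1).
rewrite /std_v !mclsZ [RHS]mclsD; congr mcls.
apply/rowP => j; rewrite !mxE; case: j => [[|[|//]] hj] /=.
  rewrite (_ : Ordinal hj = 0); last exact/val_inj.
  by rewrite ?eqxx /= mulr1 mulr0 addr0.
rewrite (_ : Ordinal hj = 1); last exact/val_inj.
by rewrite ?eqxx /= mulr1 mulr0 add0r.
Qed.

Lemma std_scaleE (k : C) (p : M) : k *: p = act (of_scal m c k) p. Proof. by []. Qed.

Lemma std_act_wv e t : act (w_letter m c e) (std_v t) = 0.
Proof.
rewrite /std_v mclsZ; apply: mcls_eq; rewrite subr0.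
by case: t; [apply: std_rel_vec_z | apply: std_rel_vec_zbar].
Qed.

Lemma act_srefl_v j t : (0 < j <= m)%N ->
  act (srefl m c j) (std_v t) = om ^ ((if t then u%:Z else - u%:Z) * j%:Z) *: std_v (~~ t).
Proof.
move=> hj; rewrite std_scaleE /std_v !mclsZ; apply: mcls_eq.
have -> : (if t then u%:Z else - u%:Z) * j%:Z = if t then (j * u)%:Z else - (j * u)%:Z.
  by rewrite PoszM; case: (t); ring.
by case: t; [apply: std_rel_refl_z | apply: std_rel_refl_zbar].
Qed.

Lemma act_sum_l (I : Type) (r : seq I) (P : pred I) (h : I -> H) (p : M) :
  act (\sum_(i <- r | P i) h i) p = \sum_(i <- r | P i) act (h i) p.
Proof.
apply: (big_morph (fun h => act h p)) => [x y|]; first exact: Defs.actDl.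
have := Defs.actDl 0 0 p; rewrite addr0 => h0.
by apply: (addIr (act 0 p)); rewrite add0r.
Qed.

Lemma act_scale_l (k : C) (h : H) (p : M) : act (k *: h) p = k *: act h p.
Proof. by rewrite scale_of_scal -Defs.actA. Qed.

Lemma act_scale_r (k : C) (h : H) (p : M) : act h (k *: p) = k *: act h p.
Proof. by rewrite !std_scaleE !Defs.actA of_scalC. Qed.

Lemma act_grp_v g : dihedral m g -> forall hg : dihedral m g, exists (b : bool) (k : int) (a : bool -> C),
  g = gmx b (om ^ k) /\ forall t, act (of_grp c hg) (std_v t) = a t *: std_v (t (+) b).
Proof.
elim=> [|j g' hj hg' IH] h.
  exists false, 0, (fun _ => 1); rewrite expr0z gmx1; split=> // t.
  rewrite addbF scale1r -[RHS]Defs.act1; congr act.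
  exact/cls_eqv/eqv_Grp1.
have [b [k [a [E ha]]]] := IH hg'.
have [hr hs] := sreflE c m_gt0 hj.
exists (~~ b), (j%:Z - k), (fun t => a t * om ^ ((if t (+) b then u%:Z else - u%:Z) * j%:Z)); split.
  by rewrite E refl_gmx // gmxM conj_omz // expfzDr ?omega_neq0.
move=> t; have -> : of_grp c h = srefl m c j * of_grp c hg'.
  rewrite hs [RHS]clsM; move: h; rewrite refl_gmx // => h.
  by apply/esym/cls_eqv; apply: eqv_GrpM.
by rewrite -Defs.actA ha act_scale_r act_srefl_v // scalerA addbN.
Qed.

Lemma evH_zz e f : @ev_class R m c u (z_letter m c e) f = ftrZ e f.
Proof.
rewrite evH_cls //=; apply: fext => a b t; rewrite /lcomb /fadd /fscale /fcoord !mxE /=.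
have := sqrCi C => i2.
by case: e; rewrite /=; field: i2.
Qed.

Lemma evH_zzX e n f a b t :
  @ev_class R m c u (z_letter m c e ^+ n) f a b t = if e then f (n + a)%N b t else f a (n + b)%N t.
Proof.
elim: n f => [|n IH] f; first by rewrite expr0 evH1 //; case: e.
by rewrite exprS evHM // evH_zz IH /ftrZ; case: (e); rewrite ?addnS ?addSn.
Qed.

(** Pair with the functional that reads off one coefficient of a pure power; its
    transpose under [z zbar] is zero. *)
Lemma std_independent k (a : bool -> bool -> C) (q : M) : (0 < k)%N ->
  \sum_(e : bool) \sum_(t : bool) a e t *: act (z_letter m c e ^+ k) (std_v t)
    = act (2^-1 *: (z_letter m c true * z_letter m c false)) q ->
  forall e t, a e t = 0.
Proof.
move=> k0 h e0 t0.
pose f (x y : nat) (t : bool) : C := (if e0 then (x == k) && (y == 0) && (t == t0)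
  else (x == 0) && (y == k) && (t == t0))%:R.
have /(congr1 (Phi f)) := h.
have PS (g : bool -> M) : Phi f (\sum_(e : bool) g e) = \sum_(e : bool) Phi f (g e).
  by rewrite !big_bool /= PhiD.
have Phi0 g' : (forall a b t, g' a b t = 0) -> Phi g' q = 0.
  move=> hg'; have -> : g' = fscale 0 g' by apply: fext => a' b t; rewrite /fscale hg' mul0r.
  rewrite -[RHS](mul0r (Phi g' q)) -PhiZ //.
  by rewrite std_scaleE Phi_act // evH_cls.
have -> : Phi f (act (2^-1 *: (z_letter m c true * z_letter m c false)) q) = 0.
  rewrite Phi_act //; apply: Phi0 => x y t.
  rewrite evHZ // evHM // !evH_zz /ftrZ /fscale /f.
  by case: (e0); rewrite /= ?andbF /= ?mulr0n mulr0.
have E e t : Phi f (a e t *: act (z_letter m c e ^+ k) (std_v t)) =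
    a e t * (if e then f k 0%N t else f 0%N k t).
  by rewrite PhiZ // Phi_act // /std_v Phi_mcls // pairH_gen // evH_zzX addn0.
rewrite PS; under eq_bigr do (rewrite PS; under eq_bigr do rewrite E).
rewrite !big_bool /= /f.
have kn0 : (k == 0%N) = false by rewrite gtn_eqF.
have nk0 : (0%N == k) = false by rewrite ltn_eqF.
by case: e0 {f Phi0 E h PS}; case: t0; rewrite /= ?eqxx ?kn0 ?nk0 /= ?mulr0 ?mulr1 ?addr0 ?add0r.
Qed.

Lemma std_repP (hs : sigma_k m c u = 0) :
  std_rep zz ww S group_elements (@act R m c u : A -> M -> M) std_v u%:Z (sigma_k m c).
Proof.
split.
- exact: Defs.actDl.
- exact: Defs.actDr.
- by move=> g h p; rewrite Defs.actA.
- exact: Defs.act1.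
- exact: act_scale_l.
- exact: std_act_wv.
- move=> n t; rewrite /refl_sum act_sum_l /sigma_k scaler_suml !big_nat.
  apply: eq_bigr => j hj; rewrite act_scale_l act_srefl_v // scalerA -mulrA.
  by rewrite -expfzDr ?omega_neq0 // -mulrDl.
- exact: (sigma_kN m_gt0 hc).
- exact: hs.
- move=> _ [g [hg ->]]; have [b [k [a [E ha]]]] := act_grp_v hg hg.
  exists b, (fun e => om ^ (k * sg (e (+) b))), a; split=> // e.
  by move: hg {ha}; rewrite E => hg; apply: (grp_zz c m_gt0).
- exact: std_gens.
- exact: std_independent.
Qed.

End Instantiation.

Section UnitarityForm.
Variables (R : realType) (m : nat) (c : 'M[R]_2 -> R[i]) (u : nat) (eps : R).
Hypothesis m_gt0 : (0 < m)%N.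
Hypothesis hc : conj_invariant m c.
Hypothesis hs : sigma_k m c u = 0.
Hypothesis hreal : forall j, (0 < j <= m)%N -> c (refl R m j) \is Num.real.
Local Notation C := R[i].
Local Notation H := (cherednik m c).
Local Notation M := (std_module m c u).
Local Notation A := (cherednik_alg m_gt0 hc).
Local Notation zz := (z_letter m c : bool -> A).
Local Notation ww := (w_letter m c : bool -> A).
Local Notation SS := (refl_sum m c : int -> A).
Local Notation aM := (@act R m c u : A -> M -> M).
Local Notation Ep := (E_plus zz).
Local Notation Em := (E_minus ww).
Local Notation Hg := (H_grad zz ww SS).
Local Notation Zt := (Zdef zz ww SS eps%:C).

Let D := cherednik_relP m_gt0 hc.
Let T := std_repP m_gt0 hc hs.

Lemma Eplus_E : Eplus m c = Ep.
Proof. by rewrite /Eplus z_E zbar_E. Qed.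
Lemma Eminus_E : Eminus m c = Em.
Proof. by rewrite /Eminus zeta_E zetabar_E. Qed.
Lemma Hgrad_E : Hgrad m c = Hg.
Proof. by rewrite /Hgrad z_E zbar_E zeta_E zetabar_E sigma_E. Qed.
Lemma Zeps_E : Zeps m c eps = Zt.
Proof. by rewrite /Zeps /Z0 z_E zbar_E zeta_E zetabar_E sigma_E. Qed.

Section Form.
Variables (st : H -> H) (b : M -> M -> C).
Hypothesis hst : is_star st.
Hypothesis hb : hermitian_form b.
Hypothesis hadj : forall h p q, b (act h p) q = b p (act (st h) q).
Hypothesis hpos : forall p, p != 0 -> 0 < b p p.

Lemma st_lin (k : C) (g h : H) : st (k *: g + h) = k^* *: st g + st h.
Proof. by case: hst => -[]. Qed.

Lemma stM (g h : H) : st (g * h) = st h * st g.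
Proof. by case: hst => -[]. Qed.

Lemma st0 : st 0 = 0.
Proof.
have := st_lin 1 0 0; rewrite scale1r addr0 rmorph1 scale1r => h.
by apply: (addIr (st 0)); rewrite add0r.
Qed.

Lemma stZ (k : C) h : st (k *: h) = k^* *: st h.
Proof. by rewrite -[k *: h]addr0 st_lin st0 addr0. Qed.

Lemma stD g h : st (g + h) = st g + st h.
Proof. by rewrite -[g]scale1r st_lin rmorph1 !scale1r. Qed.

Lemma st_zz e : st (z_letter m c e) = 2 *: w_letter m c e.
Proof.
have [_ [sxi sx seta sy _]] := hst.
have s1 : st (z_ m c) = 2 *: zeta_ m c.
  rewrite /z_ stD stZ sx sy conjCi /zeta_ scalerA divff ?pnatr_eq0 // scale1r.
  by rewrite scaleNr.
have s2 : st (zbar_ m c) = 2 *: zetabar_ m c.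
  have ci : (- 'i : C)^* = 'i by rewrite rmorphN /= conjCi opprK.
  rewrite /zbar_ stD -scaleNr stZ sx sy ci /zetabar_ scalerA.
  by rewrite divff ?pnatr_eq0 // scale1r.
by case: e; rewrite -?z_E -?zbar_E ?s1 ?s2 ?zeta_E ?zetabar_E.
Qed.

Lemma st_ww e : st (w_letter m c e) = 2^-1 *: z_letter m c e.
Proof.
have [[_ _ stst] _] := hst; have := stst (z_letter m c e).
rewrite st_zz stZ conjC_nat => <-.
by rewrite scalerA mulVf ?pnatr_eq0 // scale1r.
Qed.

Lemma st_Eplus : st (2^-1 *: (z_letter m c true * z_letter m c false)) =
  - ((- 2) *: (w_letter m c true * w_letter m c false)).
Proof.
have c2 : (2^-1 : C)^* = 2^-1 by rewrite fmorphV /= conjC_nat.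
rewrite stZ c2 stM !st_zz chZl chZr wwC !scalerA.
by rewrite scaleNr opprK; congr (_ *: _); field.
Qed.

Lemma st_wwzz e : st (z_letter m c e * w_letter m c e) = z_letter m c e * w_letter m c e.
Proof.
by rewrite stM st_zz st_ww chZl chZr scalerA mulVf ?pnatr_eq0 // scale1r.
Qed.

Lemma st_refl_sum : st (refl_sum m c 0) = refl_sum m c 0.
Proof.
have [_ [_ _ _ _ sref]] := hst.
rewrite /refl_sum (big_morph st stD st0) !big_nat; apply: eq_bigr => j hj.
by have /CrealP hcj := hreal hj; rewrite mul0r expr0z mulr1 stZ sref // hcj.
Qed.

(** The star exchanges [z_letter e] and [w_letter e] up to the factor 2, hence
    maps [E_plus] to [- E_minus], and fixes the reflections; the reality of [c]
    gives the invariance of [sigma_]. *)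
Lemma contravariantP : contravariant_form zz ww SS aM eps%:C b.
Proof.
have [blin bconj] := hb; split=> //.
- move=> p q; rewrite hadj.
  have -> : st Ep = - Em by exact: st_Eplus.
  have -> : act (- Em) q = (-1) *: act Em q + 0 by rewrite (actNl T) addr0 scaleN1r.
  have b0 : b 0 p = 0.
    have := blin 1 0 0 p; rewrite scale1r addr0 mul1r => h.
    by apply: (addIr (b 0 p)); rewrite add0r.
  by rewrite bconj blin b0 addr0 rmorphM rmorphN /= conjC1 mulN1r -bconj.
- move=> p q; rewrite hadj; congr (b p (act _ q)).
  transitivity (st (z_letter m c false * w_letter m c false
    - z_letter m c true * w_letter m c true + eps%:C *: refl_sum m c 0)); first by [].
  rewrite stD stZ st_refl_sum -scaleN1r [z_letter m c false * _ + _]addrC st_lin !st_wwzz.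
  rewrite conjCN1 scaleN1r [- _ + _]addrC; congr (_ + _ *: _).
  by apply/CrealP/complex_realP; exists eps.
Qed.

Lemma act_of_cov f : br (Hg : H) (of_cov m c f) = of_cov m c f.
Proof.
rewrite of_cov_zz.
have h e : br (Hg : H) (z_letter m c e) = z_letter m c e by exact: (br_H_z D e).
rewrite brDr -{2}[z_letter m c true]h -{2}[z_letter m c false]h.
by rewrite /br !chZl !chZr -!scalerBr.
Qed.

End Form.

End UnitarityForm.

(** * The joint decomposition *)

Section SmallDimension.
Variables (K : fieldType) (V : lmodType K).
Implicit Types (W : set V) (p q : V).

Lemma has_dim1 W p : subspace W -> W p -> p != 0 -> (forall q, W q -> exists k, q = k *: p) ->
  has_dim W 1.
Proof.
move=> hW hp p0 h; exists (fun _ => p); split.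
  move=> a; rewrite big_ord1 => /eqP; rewrite scaler_eq0 (negbTE p0) orbF => /eqP h0 i.
  by rewrite ord1.
apply/seteqP; split=> [q /h [k ->]|q].
  apply: (subspaceZ _ (span_subspace _)); apply: sub_span; by exists ord0.
by apply: (span_min hW) => _ [_ _ <-].
Qed.

Lemma has_dim2 W p q : subspace W -> W p -> W q ->
  (forall a b, a *: p + b *: q = 0 -> a = 0 /\ b = 0) ->
  (forall x, W x -> exists a b, x = a *: p + b *: q) -> has_dim W 2.
Proof.
move=> hW hp hq hind h; exists (fun i => if i == ord0 then p else q); split.
  move=> a; rewrite big_ord_recl big_ord1 /= => /hind [h1 h2] i.
  case: i => [[|[|//]] hi].
    by rewrite -[RHS]h1; congr a; apply/val_inj.
  by rewrite -[RHS]h2; congr a; apply/val_inj.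
have hsp := span_subspace (range (fun i : 'I_2 => if i == ord0 then p else q)).
apply/seteqP; split=> [x /h [a [b ->]]|x].
  apply: subspaceD => //; apply: (subspaceZ _ hsp); apply: sub_span.
    by exists ord0.
  by exists (lift ord0 ord0).
by apply: (span_min hW) => _ [i _ <-]; case: eqP.
Qed.

End SmallDimension.

Section Dictionary.
Variables (R : realType) (m : nat) (c : 'M[R]_2 -> R[i]) (u : nat) (eps : R).
Hypothesis m_gt0 : (0 < m)%N.
Hypothesis hc : conj_invariant m c.
Hypothesis hs : sigma_k m c u = 0.
Local Notation C := R[i].
Local Notation M := (std_module m c u).
Local Notation A := (cherednik_alg m_gt0 hc).
Local Notation zz := (z_letter m c : bool -> A).
Local Notation ww := (w_letter m c : bool -> A).
Local Notation SS := (refl_sum m c : int -> A).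
Local Notation aM := (@act R m c u : A -> M -> M).
Local Notation v := (@std_v R m c u : bool -> M).
Local Notation Ep := (E_plus zz).
Local Notation Em := (E_minus ww).
Local Notation Hg := (H_grad zz ww SS).
Local Notation Zt := (Zdef zz ww SS eps%:C).
Local Notation harm := (harm zz ww SS aM).
Local Notation jb := (jb zz aM).
Local Notation jspan := (jspan zz aM).

Let D := cherednik_relP m_gt0 hc.
Let T := std_repP m_gt0 hc hs.

Lemma degree_partE k : (degree_part k : set M) = [set p | aM Hg p = k.+1%:R *: p].
Proof.
have dsub j : subspace (degree_part j : set M) by case: j => [|j]; apply: span_subspace.
apply/seteqP; split.
  elim: k => [|k IH].
    apply: (span_min (subspace_eigen T Hg 1%:R)) => _ /= [] ->; rewrite scale1r.
      exact: (act_Hv T true).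
    exact: (act_Hv T false).
  apply: (span_min (subspace_eigen T Hg k.+2%:R)) => _ [f [q [/IH hq ->]]] /=.
  have hf : br Hg (of_cov m c f : A) = (1 : C) *: (of_cov m c f : A).
    by rewrite scale1r; apply: (act_of_cov m_gt0 hc).
  by rewrite (act_H_shift T hf hq) natr1.
move=> p /= hp; apply: (span_min (dsub k) _ (eigen_mono D T hp)) => _ [a [b [t [[<-] ->]]]].
elim: a b {hp} => [|a IHa] b.
  elim: b => [|b IHb].
    rewrite /mono !expr0 mulr1 (act1 T); apply: sub_span.
    by case: t; [left | right].
  apply: sub_span; exists (covec2 1 (- 'i)), (mono zz aM v 0 b t); split=> //.
  by rewrite /mono !expr0 !mul1r exprS (actA T).
rewrite addSn; apply: sub_span; exists (covec2 1 'i), (mono zz aM v a b t); split; first exact: IHa.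
by rewrite /mono exprS -mulrA (actA T).
Qed.

Lemma VtauE : (@Vtau R m c u) = harm 0.
Proof.
have -> : @Vtau R m c u = degree_part 0 by [].
rewrite degree_partE; apply/seteqP; split=> [p hp|p [hp _]] //; split=> //.
have : @Vtau R m c u p by have -> : @Vtau R m c u = degree_part 0 by []; rewrite degree_partE.
apply: (span_min (subspace_act T Em _ (W := [set 0]))).
  by split=> // k x y -> ->; rewrite scaler0 addr0.
have h t : aM Em (v t) = 0.
  by rewrite /E_minus (actZl T) (actA T) (act_wv T) (act0r T) scaler0.
by move=> _ /= [] ->; [apply: (h true) | apply: (h false)].
Qed.

Lemma harmonicsE k : (harmonics k : set M) = harm k.
Proof.
have e : Eminus m c = Em by exact: Eminus_E.
by rewrite /harmonics degree_partE e.
Qed.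

Lemma harmonics_eigenE k lam : harmonics_eigen m c u eps k lam =
  [set p | harm k p /\ aM Zt p = lam *: p].
Proof.
have e : Zeps m c eps = Zt by exact: Zeps_E.
by rewrite /harmonics_eigen harmonicsE e.
Qed.

Lemma u11E : u11 m c eps = u11_span zz ww SS eps%:C.
Proof.
have e1 : Eplus m c = Ep by exact: Eplus_E.
have e2 : Eminus m c = Em by exact: Eminus_E.
have e3 : Hgrad m c = Hg by exact: Hgrad_E.
have e4 : Zeps m c eps = Zt by exact: Zeps_E.
by rewrite /u11 e1 e2 e3 e4.
Qed.

Lemma centraliser_br (h : A) : centraliser (u11 m c eps) h ->
  [/\ br Ep h = 0, br Em h = 0, br Hg h = 0 & br Zt h = 0].
Proof.
rewrite u11E => hh; have [h1 h2 h3 h4] := u11_mem zz ww SS eps%:C.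
have key (X : A) : u11_span zz ww SS eps%:C X -> br X h = 0.
  by move=> hX; apply: br0_comm; symmetry; apply: hh.
by split; apply: key.
Qed.

Lemma summandP (W : set M) k lam w0 : subspace W -> (forall p, W p -> harm k p) ->
  (forall p, W p -> aM Zt p = lam *: p) -> W w0 -> w0 != 0 ->
  submodule (centraliser (u11 m c eps)) W ->
  is_joint_summand eps W k.+1%:R lam (jspan W).
Proof.
move=> hW Wh WZ W0 w00 hsub; split=> //.
exists {poly C}, (poly_act zz aM W), jb; split.
- rewrite /is_lowest_weight_irrep /is_u11_rep u11E; split.
  + split.
    * move=> l; exact: (poly_act_linl D T hW Wh WZ W0 w00 l).
    * move=> X; exact: (poly_act_linr D T hW Wh WZ W0 w00).
    * move=> X Y l; exact: (poly_act_br D T hW Wh WZ W0 w00).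
  + move=> V hV st; exact: (poly_act_irr D T hW Wh W0 w00 hV st).
  + have [l1 l2 l3] := poly_act_lowest D T hW Wh WZ W0 w00.
    exists 1; split; first exact: oner_neq0.
    * by have e : Eminus m c = Em by [exact: Eminus_E]; rewrite e.
    * by have e : Hgrad m c = Hg by [exact: Hgrad_E]; rewrite e.
    * by have e : Zeps m c eps = Zt by [exact: Zeps_E]; rewrite e.
- exact: (jspan_tensor D T hW Wh w00).
- move=> h p l /centraliser_br [hE _ _ _] _; apply: (jb_act T).
  by rewrite brN hE oppr0.
- move=> X p l; rewrite u11E => hX hp; exact: (poly_actP D T Wh WZ l hX hp).
Qed.

End Dictionary.

Section SquareRoots.
Variable (K : numClosedFieldType) (x y : K).
Hypotheses (x0 : x != 0) (y0 : y != 0).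
Let L : seq K := [:: sqrtC x; - sqrtC x; sqrtC y; - sqrtC y].

Lemma eqN_root (r : K) : r != 0 -> r == - r = false.
Proof.
by move=> r0; apply/negP; rewrite -subr_eq0 opprK -mulr2n mulrn_eq0 (negbTE r0).
Qed.

Lemma size_roots : x = y -> (size (undup L) <= 2)%N.
Proof.
move=> e; apply: (@uniq_leq_size _ _ [:: sqrtC x; - sqrtC x]); first exact: undup_uniq.
by move=> r; rewrite mem_undup /L -e !inE; case: (r == sqrtC x); case: (r == - sqrtC x).
Qed.

Lemma uniq_roots4 : x != y -> uniq L.
Proof.
move=> ne; have s0 : sqrtC x != 0 by rewrite sqrtC_eq0.
have t0 : sqrtC y != 0 by rewrite sqrtC_eq0.
have h1 : sqrtC x == sqrtC y = false.
  by apply: contraNF ne => /eqP e; rewrite -[x]sqrtCK e sqrtCK.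
have h2 : sqrtC x == - sqrtC y = false.
  by apply: contraNF ne => /eqP e; rewrite -[x]sqrtCK e sqrrN sqrtCK.
rewrite /L /= !inE !eqr_opp h1 h2 (eqN_root s0) (eqN_root t0) /=.
by rewrite eqr_oppLR h2.
Qed.

Lemma mem_roots r : (r \in L) = (r ^+ 2 == x) || (r ^+ 2 == y).
Proof.
have e z : (r ^+ 2 == z) = (r == sqrtC z) || (r == - sqrtC z) by rewrite -eqf_sqr sqrtCK.
by rewrite /L !inE !e -!orbA.
Qed.

End SquareRoots.

Section Main.
Variables (R : realType) (m : nat) (c : 'M[R]_2 -> R[i]) (u : nat) (eps : R).
Hypothesis m_gt0 : (0 < m)%N.
Hypothesis hc : conj_invariant m c.
Hypothesis hs : sigma_k m c u = 0.
Local Notation C := R[i].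
Local Notation M := (std_module m c u).
Local Notation A := (cherednik_alg m_gt0 hc).
Local Notation zz := (z_letter m c : bool -> A).
Local Notation ww := (w_letter m c : bool -> A).
Local Notation SS := (refl_sum m c : int -> A).
Local Notation aM := (@act R m c u : A -> M -> M).
Local Notation v := (@std_v R m c u : bool -> M).
Variable beta : M -> M -> C.
Hypothesis B : contravariant_form zz ww SS aM eps%:C beta.
Local Notation Zt := (Zdef zz ww SS eps%:C).
Local Notation harm := (harm zz ww SS aM).
Local Notation mu := (mu2 u%:Z (sigma_k m c) eps%:C).
Local Notation line := (eigenline zz ww SS aM v eps%:C).
Local Notation heig := (harmonics_eigen m c u eps).
Local Notation cent := (centraliser (u11 m c eps)).

Let D := cherednik_relP m_gt0 hc.
Let T := std_repP m_gt0 hc hs.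

Lemma LambdaE k : Lambda m c u eps k.+1 =
  [:: sqrtC (mu k true); - sqrtC (mu k true); sqrtC (mu k false); - sqrtC (mu k false)].
Proof. by []. Qed.

Lemma mem_LambdaP k lam : lam \in Lambda m c u eps k.+1 <-> exists t, lam ^+ 2 = mu k t.
Proof.
rewrite LambdaE mem_roots; split.
  by case/orP => /eqP h; [exists true | exists false].
by move=> [[] ->]; rewrite eqxx ?orbT.
Qed.

Lemma heigE k lam : heig k.+1 lam = [set p | harm k.+1 p /\ aM Zt p = lam *: p].
Proof. exact: (harmonics_eigenE eps m_gt0 hc hs). Qed.

Lemma heig_subspace k lam : subspace (heig k.+1 lam).
Proof.
rewrite heigE; split; first by split; [case: (harm_subspace T k.+1) | rewrite (act0r T) scaler0].
move=> a p q [h1 h2] [h3 h4]; split; first exact: (harm_subspace T k.+1).2.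
exact: (subspace_eigen T Zt lam).2.
Qed.

Lemma harm_cent k x p : cent x -> harm k p -> harm k (aM x p).
Proof.
by move=> hx; have [h1 h2 _ _] := @centraliser_br R m c eps m_gt0 hc x hx; apply: (harm_act D T h1 h2).
Qed.

Lemma heig_submodule k lam : submodule cent (heig k.+1 lam).
Proof.
split=> [|x p hx]; first exact: heig_subspace.
rewrite !heigE => -[h1 h2]; split; first exact: harm_cent.
have [_ _ _ h3] := @centraliser_br R m c eps m_gt0 hc x hx.
by rewrite (act_br T) h2 h3 (actZr T) (act0l T) addr0.
Qed.

Lemma line_submodule k t lam : submodule cent (line k t lam).
Proof.
split=> [|x p hx hp]; first exact: (eigenline_sub eps%:C T).
have [h1 h2 _ h3] := @centraliser_br R m c eps m_gt0 hc x hx.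
exact: (eigenline_centraliser D T B h1 h2 h3 hp).
Qed.

Lemma line_heig k t lam p : line k t lam p -> heig k.+1 lam p.
Proof. by rewrite heigE; apply: (eigenline_harm D T). Qed.

Lemma line_irreducible k t lam : lam ^+ 2 = mu k t -> irreducible_submodule cent (line k t lam).
Proof.
move=> /(eigenline_ex D T B) [p p0 hp]; split; first exact: line_submodule.
  by move=> e; move: hp; rewrite e => /eqP; rewrite (negbTE p0).
move=> W [hW _] sub; have [[q Wq q0]|hno] := pselect (exists2 q, W q & q != 0); last first.
  left; apply/seteqP; split=> [q Wq|_ ->]; last by case: hW.
  by apply/eqP/negPn/negP => q0; apply: hno; exists q.
right; apply/seteqP; split=> // x hx.
have [a ->] := eigenline_line D T B (sub _ Wq) hx q0.
exact: subspaceZ.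
Qed.

Lemma heig_line k t lam : lam ^+ 2 != mu k (~~ t) -> heig k.+1 lam = line k t lam.
Proof.
move=> h; apply/seteqP; split=> [p|p]; last exact: line_heig.
rewrite heigE => /(harm_eigen_split D T B) [p1 [p2 [h1 h2 ->]]].
case: t h => /= h.
  by rewrite (eigenline0 D T B h h2) addr0.
by rewrite (eigenline0 D T B h h1) add0r.
Qed.

Lemma eigenvaluesP k lam :
  lam \in Lambda m c u eps k.+1 <-> exists2 p : M, p != 0 & heig k.+1 lam p.
Proof.
split=> [/mem_LambdaP [t /(eigenline_ex D T B) [p p0 hp]]|[p p0]].
  by exists p => //; apply: line_heig hp.
rewrite heigE => /(harm_eigen_split D T B) [p1 [p2 [h1 h2 e]]]; apply/mem_LambdaP.
have [z1|n1] := eqVneq p1 0; last by exists true; apply: (eigenline_val D T B h1).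
exists false; apply: (eigenline_val D T B h2).
by move: p0; rewrite e z1 add0r.
Qed.

(** The eigenvalue occurs in one of the two planes only, and there it is simple. *)
Lemma simple_case k lam : lam \in Lambda m c u eps k.+1 ->
  size (undup (Lambda m c u eps k.+1)) = 4%N ->
  has_dim (heig k.+1 lam) 1 /\ irreducible_submodule cent (heig k.+1 lam).
Proof.
move=> /mem_LambdaP [t ht] h4.
have ne : mu k t != mu k (~~ t).
  apply/eqP => e; have : (size (undup (Lambda m c u eps k.+1)) <= 2)%N.
    rewrite LambdaE; apply: size_roots.
    by case: t e {ht} => /= ->.
  by rewrite h4.
rewrite (@heig_line k t lam); last by rewrite ht.
split; last exact: line_irreducible.
have [p p0 hp] := eigenline_ex D T B ht.
apply: (has_dim1 (eigenline_sub eps%:C T k t lam) hp p0) => q hq.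
exact: (eigenline_line D T B hp hq p0).
Qed.

(** Both planes then have the same pair of eigenvalues, and the eigenspace is the
    sum of the eigenlines of the two planes, which the centraliser preserves. *)
Lemma double_case k lam : lam \in Lambda m c u eps k.+1 ->
  size (undup (Lambda m c u eps k.+1)) = 2%N ->
  has_dim (heig k.+1 lam) 2 /\
  exists W : bool -> set M, (forall i, irreducible_submodule cent (W i)) /\
    is_direct_sum predT W (heig k.+1 lam).
Proof.
move=> /mem_LambdaP [t ht] h2.
have e : mu k true = mu k false.
  apply/eqP/negPn/negP => ne.
  have := uniq_roots4 (mu2_neq0 D T B k true) (mu2_neq0 D T B k false) ne.
  by rewrite -LambdaE => /undup_id h; move: h2; rewrite h.
have hl t' : lam ^+ 2 = mu k t' by rewrite ht; case: t {ht}; case: t'; rewrite ?e.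
have [p p0 hp] := eigenline_ex D T B (hl true).
have [q q0 hq] := eigenline_ex D T B (hl false).
have split_heig x : heig k.+1 lam x -> exists x1 x2,
    [/\ line k true lam x1, line k false lam x2 & x = x1 + x2].
  by rewrite heigE => /(harm_eigen_split D T B).
have sub t' := eigenline_sub eps%:C T k t' lam.
have ind x1 x2 : line k true lam x1 -> line k false lam x2 -> x1 + x2 = 0 -> x1 = 0 /\ x2 = 0.
  by move=> [a1 _] [a2 _]; apply: (piece_indep D T (k := k)).
split.
  apply: (@has_dim2 _ _ _ p q).
  - exact: heig_subspace.
  - exact: line_heig hp.
  - exact: line_heig hq.
  - move=> a b h.
    have [/eqP] := ind _ _ (subspaceZ a (sub true) hp) (subspaceZ b (sub false) hq) h.
    rewrite scaler_eq0 (negbTE p0) orbF => /eqP -> /eqP.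
    by rewrite scaler_eq0 (negbTE q0) orbF => /eqP ->.
  - move=> x /split_heig [x1 [x2 [h1 h2' ->]]].
    have [a ->] := eigenline_line D T B hp h1 p0.
    have [b ->] := eigenline_line D T B hq h2' q0.
    by exists a, b.
exists (fun t' => line k t' lam); split; first by move=> t'; apply: line_irreducible.
split=> [t' _||r f ur hf h0 i hi]; first exact: sub.
  have hsp := span_subspace (\bigcup_(i in [set i | predT i]) line k i lam).
  apply/seteqP; split=> [x /split_heig [x1 [x2 [h1 h2' ->]]]|].
    by apply: subspaceD => //; apply: sub_span; [exists true | exists false].
  by apply: (span_min (heig_subspace k lam)) => x [t' _ hx]; apply: line_heig hx.
pose g t' : M := if t' \in r then f t' else 0.
have hg t' : line k t' lam (g t').
  rewrite /g; case: ifP => [hin|_]; last by case: (sub t').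
  by case: (hf _ hin).
have hsum : g true + g false = 0.
  move: h0; rewrite big_uniq //= big_mkcond big_bool /= => <-; reflexivity.
have [g1 g2] := ind _ _ (hg true) (hg false) hsum.
by move: g1 g2; rewrite /g; case: i hi => ->.
Qed.

End Main.

Section JointDecomposition.
Variables (R : realType) (m : nat) (c : 'M[R]_2 -> R[i]) (u : nat) (eps : R).
Hypothesis m_gt0 : (0 < m)%N.
Hypothesis hc : conj_invariant m c.
Hypothesis hs : sigma_k m c u = 0.
Local Notation C := R[i].
Local Notation M := (std_module m c u).
Local Notation A := (cherednik_alg m_gt0 hc).
Local Notation zz := (z_letter m c : bool -> A).
Local Notation ww := (w_letter m c : bool -> A).
Local Notation SS := (refl_sum m c : int -> A).
Local Notation aM := (@act R m c u : A -> M -> M).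
Local Notation v := (@std_v R m c u : bool -> M).
Variable beta : M -> M -> C.
Hypothesis B : contravariant_form zz ww SS aM eps%:C beta.
Local Notation Zt := (Zdef zz ww SS eps%:C).
Local Notation Cas := (casimir zz ww SS).
Local Notation harm := (harm zz ww SS aM).
Local Notation jspan := (jspan zz aM).
Local Notation mu := (mu2 u%:Z (sigma_k m c) eps%:C).
Local Notation heig := (harmonics_eigen m c u eps).
Local Notation Vt := (@Vtau R m c u).

Let D := cherednik_relP m_gt0 hc.
Let T := std_repP m_gt0 hc hs.

Lemma std_v_neq0 : v true != 0.
Proof.
apply/eqP => h; have := std_indep T (ltn0Sn 0) (a := fun e t => if e && t then 1 else 0) (q := 0).
rewrite !big_bool /= !scale0r !addr0 scale1r h (act0r T) (act0r T) => /(_ erefl true true) /eqP.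
by rewrite oner_eq0.
Qed.

Lemma Vtau_harm p : Vt p -> harm 0 p.
Proof. by rewrite (VtauE m_gt0 hc hs). Qed.

Lemma Vtau_Z p : Vt p -> aM Zt p = 0 *: p.
Proof.
have h t : aM Zt (v t) = 0 *: v t.
  rewrite /Zdef /Z_rot (actDl T) (actBl T) !(actA T) !(act_wv T) !(act0r T) subr0 add0r.
  by rewrite (actZl T) (act_Sv0 T) scaler0 scale0r.
apply: (span_min (subspace_eigen T Zt 0)) => _ /= [] ->; [exact: (h true) | exact: (h false)].
Qed.

Definition summand (i : option (nat * C)) : set M :=
  if i is Some (k, lam) then jspan (heig k lam) else jspan Vt.
Definition casimir_val (i : option (nat * C)) : C := if i is Some (k, _) then (k ^ 2)%:R else 0.
Definition Z_val (i : option (nat * C)) : C := if i is Some (_, lam) then lam else 0.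

Lemma jspan_eigen W k lam p : (forall q, W q -> harm k q) -> (forall q, W q -> aM Zt q = lam *: q) ->
  jspan W p -> aM Cas p = (k ^ 2)%:R *: p /\ aM Zt p = lam *: p.
Proof.
move=> h1 h2 hp; split.
  apply: (span_min (subspace_eigen T Cas _) _ hp) => _ [q [l [/h1 hq ->]]] /=.
  exact: (casimir_jb D T l hq).
apply: (span_min (subspace_eigen T Zt _) _ hp) => _ [q [l [/h2 hq ->]]] /=.
by apply: (act_comm T l _ hq); apply: (br_Zt_Ep _ D).
Qed.

Lemma heig_harm k lam p : heig k lam p -> harm k p /\ aM Zt p = lam *: p.
Proof. by rewrite (harmonics_eigenE eps m_gt0 hc hs). Qed.

Lemma summand_eigen i p : summand i p ->
  aM Cas p = casimir_val i *: p /\ aM Zt p = Z_val i *: p.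
Proof.
case: i => [[k lam]|]; rewrite /summand /casimir_val /Z_val => hp.
  by apply: (jspan_eigen _ _ hp) => q /heig_harm [].
have -> : 0 = (0 ^ 2)%:R :> C by [].
exact: (jspan_eigen Vtau_harm Vtau_Z hp).
Qed.

(** The Casimir element recovers the degree [k] and the central element the
    eigenvalue, so distinct summands have distinct pairs of eigenvalues. *)
Lemma direct_sum : is_direct_sum (joint_index m c u eps) summand setT.
Proof.
have jsub (W : set M) : subspace (jspan W) by apply: span_subspace.
split.
- by move=> [[k lam]|] _; apply: jsub.
- apply/seteqP; split=> // p _.
  pose r k t := sqrtC (mu k t).
  have hr k t : r k t ^+ 2 = mu k t by rewrite sqrtCK.
  apply: (span_min (span_subspace _) _ (span_jb D T p B hr)).
  move=> _ [h [l [-> [h0|[k [t [b hk]]]]]]]; apply: sub_span.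
    exists None => //; apply: sub_span; exists h, l; split=> //.
    by rewrite (VtauE m_gt0 hc hs).
  exists (Some (k.+1, (-1) ^+ b * r k t)).
    apply/andP; split=> //; apply/(mem_LambdaP m c u eps); exists t.
    by rewrite exprMn hr sqrr_sign mul1r.
  apply: sub_span; exists h, l; split=> //.
  by rewrite (harmonics_eigenE eps m_gt0 hc hs).
- move=> r f ur hf h0.
  apply: (joint_indep T (X := Cas) (Y := Zt) (a := casimir_val) (b := Z_val) ur _ _ h0).
    by move=> i /hf [_]; apply: summand_eigen.
  move=> [[k lam]|] [[k' lam']|] /hf [hi _] /hf [hj _] //=.
  + move/eqP; rewrite eqr_nat eqn_exp2r // => /eqP -> -> //.
  + by move/eqP; rewrite pnatr_eq0 expn_eq0; case/andP: hi; case: k.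
  + by move/eqP; rewrite eq_sym pnatr_eq0 expn_eq0; case/andP: hj; case: k'.
Qed.

Lemma joint_decompositionP : joint_decomposition m c u eps.
Proof.
exists summand; split; first exact: direct_sum.
  have hW : subspace Vt by apply: span_subspace.
  apply: (@summandP R m c u eps m_gt0 hc hs Vt 0 0 (v true)) => //.
  - exact: Vtau_harm.
  - exact: Vtau_Z.
  - by apply: sub_span; left.
  - exact: std_v_neq0.
  split=> // h p hh; rewrite (VtauE m_gt0 hc hs) => hp; exact: (harm_cent hs hh hp).
move=> [//|k] lam _ hl; have [p p0 hp] := (eigenvaluesP hs B k lam).1 hl.
apply: (@summandP R m c u eps m_gt0 hc hs (heig k.+1 lam) k.+1 lam p) => //.
- exact: (heig_subspace eps m_gt0 hc hs).
- by move=> q /heig_harm [].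
- by move=> q /heig_harm [].
- exact: (heig_submodule eps m_gt0 hc hs).
Qed.

End JointDecomposition.

Theorem corollary4p7 (R : realType) (m q u : nat)
  (hm : m = (2 * q)%N \/ m = (2 * q - 1)%N) (hu : (0 < u < q)%N)
  (c : 'M[R]_2 -> R[i]) (hc : conj_invariant m c)
  (hreal : forall j, (0 < j <= m)%N -> c (refl R m j) \is Num.real)
  (hirr : std_irreducible m c u) (hunit : unitarisable m c u)
  (eps : R) :
  [/\ forall (k : nat) (lam : R[i]), (0 < k)%N ->
        (lam \in Lambda m c u eps k <->
         exists2 p : std_module m c u, p != 0 & harmonics_eigen m c u eps k lam p),
      joint_decomposition m c u eps,
      forall (k : nat) (lam : R[i]), (0 < k)%N -> lam \in Lambda m c u eps k ->
        size (undup (Lambda m c u eps k)) = 4%N ->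
        has_dim (harmonics_eigen m c u eps k lam) 1 /\
        irreducible_submodule (centraliser (u11 m c eps))
          (harmonics_eigen m c u eps k lam)
    & forall (k : nat) (lam : R[i]), (0 < k)%N -> lam \in Lambda m c u eps k ->
        size (undup (Lambda m c u eps k)) = 2%N ->
        has_dim (harmonics_eigen m c u eps k lam) 2 /\
        exists W : bool -> set (std_module m c u),
          (forall i, irreducible_submodule (centraliser (u11 m c eps)) (W i)) /\
          is_direct_sum predT W (harmonics_eigen m c u eps k lam)].
Proof.
have m_gt0 : (0 < m)%N by lia.
have hs := sigma_k_eq0 m_gt0 hc hm hu.
have [st [b [hst hb hadj _ hpos]]] := hunit.
have B := contravariantP eps m_gt0 hc hs hreal hst hb hadj hpos.
split.
- by move=> [//|k] lam _; apply: (eigenvaluesP hs B).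
- exact: (joint_decompositionP hs B).
- by move=> [//|k] lam _; apply: (simple_case hs B).
- by move=> [//|k] lam _; apply: (double_case hs B).
Qed.
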